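(* Let $0<\varepsilon<2B$. For every integer $K\ge1$, the certificate-transport algorithm (CT) described in the context, run with accuracy $\varepsilon$ and block length $K$, terminates and returns $(\bar x,\hat y)\in\mathcal X\times\mathcal Y$ (with $\hat y=y_b$) such that $\operatorname{Gap}(\bar x,\hat y)\le\varepsilon$, after $$T_y=O\Big(\Big(m+\frac{\kappa}{K^2}\Big)\log\frac B\varepsilon\Big),\qquad T_x=I_0+O\Big(\Big(mK+\frac{\kappa}{K}\Big)\log\frac B\varepsilon\Big)$$ oracle calls, where $I_0=O\big(\sqrt\kappa\,[1+\log_+\frac{\mu R_x^2}{B}]\big)$ is the number of calls to $\mathsf O_x$ made by the initialization. In particular, for $K=\lceil\sqrt{8\kappa/m}\,\rceil$, $$T_x+T_y=I_0+O\Big(\big(m+\sqrt{m\kappa}\big)\log\frac{B}{\varepsilon}\Big),\qquad T_y=O\Big(m\log\frac B\varepsilon\Big).$$ All constants hidden in $O(\cdot)$ are absolute.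
   Context: Setting. $\|\cdot\|$ is the Euclidean norm. $\mathcal X\subseteq\mathbb R^n$ is nonempty, closed, convex, of diameter at most $R_x$. $\mathcal Y\subset\mathbb R^m$ is compact, convex, with nonempty interior in its affine hull, $m=\dim\operatorname{aff}\mathcal Y\ge1$, of diameter at most $R_y$. $f:\mathcal X\times\mathcal Y\to\mathbb R$; for every $y\in\mathcal Y$, $f(\cdot,y)$ is $\mu$-strongly convex and $L$-smooth on $\mathcal X$, $\mu>0$; for every $x\in\mathcal X$, $f(x,\cdot)$ is concave on $\mathcal Y$. Oracles: $\mathsf O_x(x,y)=\nabla_xf(x,y)$; $\mathsf O_y(x,y)=(f(x,y),g)$ with $g$ a supergradient of $f(x,\cdot)$ at $y$, and the returned $g$ always satisfies $\|g\|\le M_y$. $T_x,T_y$ are the total numbers of calls to $\mathsf O_x,\mathsf O_y$; all other computations (projections, centers of gravity, maxima of models) are free. $\kappa=L/\mu$, $B=M_yR_y>0$, $\sigma=\mu/2$, $\log_+t=\max\{0,\log t\}$, $\log_2^+t=\max\{0,\log_2t\}$. Bounds $O(\log\frac B\varepsilon)$ absorb additive constants, i.e. are read as $O(1+\log\frac B\varepsilon)$. $P(x)=\max_{y\in\mathcal Y}f(x,y)$, $\phi(y)=\min_{x\in\mathcal X}f(x,y)$, $\operatorname{Gap}(x,y)=P(x)-\phi(y)$. Block. Let $F$ be $\mu_F$-strongly convex and $L_F$-smooth on $\mathcal X$, $\pi(x)=c+\frac\gamma2\|x-\bar x\|^2$ with $\gamma>0$, $\bar x\in\mathcal X$, and $K\ge1$.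 $\mathrm{Block}(F,\pi,K)$: set $A_0=0$, $\Gamma_0=\gamma$, $u_0=z_0=\bar x$, $r_0=\gamma\bar x$; for $i=1,\dots,K$ set $a_i=\frac{(i+1)\gamma}{2L_F}$, $A_i=A_{i-1}+a_i$, $\Gamma_i=\Gamma_{i-1}+\mu_Fa_i$, $x_i=\frac{A_{i-1}u_{i-1}+a_iz_{i-1}}{A_i}$, $g_i=\nabla F(x_i)$, $r_i=r_{i-1}+a_i(\mu_Fx_i-g_i)$, $z_i=\operatorname{proj}_{\mathcal X}(r_i/\Gamma_i)$, $u_i=\frac{A_{i-1}u_{i-1}+a_iz_i}{A_i}$. Output $(u_K,z_K,A_K)$. For $F=f(\cdot,y)$ take $\mu_F=\mu$, $L_F=L$; each step is one call to $\mathsf O_x$. Initialization. Fix any $y_0\in\mathcal Y$, put $F=f(\cdot,y_0)$, $E=B/3$, $k=\lceil\sqrt{8\kappa}\,\rceil$. A run from $v\in\mathcal X$ is $\mathrm{Block}(F,\frac\mu4\|\cdot-v\|^2,k)$. From an arbitrary $v\in\mathcal X$ perform $1+\lceil\log_2^+\frac{\mu R_x^2}{4E}\rceil$ runs, each started at the $u$-output of the previous one, then one more run; let $(u,z)$ be the $u$- and $z$-outputs of the last run. Call $(v_0,g_0)=\mathsf O_y(u,y_0)$; set $b=v_0-B$, $x_b=z$, $y_b=y_0$, and store the plane $\ell_0(y)=v_0+\langle g_0,y-y_0\rangle$ with associated point $u_0=u$. Algorithm CT (inputs $\varepsilon$, $K$). At any time $U=\min_i\ell_i$ over the stored planes, $a=\max_{\mathcal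 Y}U$, $q_b(x)=b+\frac\sigma2\|x-x_b\|^2$. After initialization set $W=a-b$, $h=b+W/2$. While $a-b>\varepsilon$: (1) if $a-b\le\frac23W$, set $W=a-b$ and $h=b+W/2$; (2) let $y_c$ be the center of gravity of $\{y\in\mathcal Y:U(y)\ge h\}$; (3) $(u,z,A)=\mathrm{Block}(f(\cdot,y_c),q_b,K)$; (4) $(v,g)=\mathsf O_y(u,y_c)$, and store the plane $\ell(y)=v+\langle g,y-y_c\rangle$ with associated point $u$; (5) if $v>h$, replace $(b,x_b,y_b)$ by $\big(\frac{b+Av}{1+A},\,z,\,\frac{y_b+Ay_c}{1+A}\big)$; (6) recompute $a=\max_{\mathcal Y}U$. Output $(\bar x,y_b)$, where $\bar x=\sum_i\lambda_iu_i$ and $\lambda$ minimizes $\max_{y\in\mathcal Y}\sum_i\lambda_i\ell_i(y)$ over the probability simplex. *)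

(* Defs.v *)
(* Vectors of R^n are row vectors 'rV[R]_n, whose
   topology is the product topology; the Euclidean norm is [enorm], since the
   library norm on matrices is the sup norm. *)
From HB Require Import structures.
From mathcomp Require Export all_boot all_order all_algebra.
From mathcomp Require Export all_classical all_reals all_analysis.
Export numFieldNormedType.Exports.

Set Implicit Arguments.
Unset Strict Implicit.
Unset Printing Implicit Defensive.

Import Order.TTheory GRing.Theory Num.Theory.

Local Open Scope classical_set_scope.
Local Open Scope ring_scope.

Section Euclidean.
Context {R : realType}.

Definition dotv n (x y : 'rV[R]_n) : R := \sum_(i < n) x 0 i * y 0 i.

Definition enorm n (x : 'rV[R]_n) : R := Num.sqrt (dotv x x).

Definition diameter_at_most n (S : set 'rV[R]_n) (d : R) : Prop :=
  forall x y, S x -> S y -> enorm (x - y) <= d.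

(* Nearest point of S; it exists and is unique when S is nonempty, closed and
   convex. *)
Definition proj n (S : set 'rV[R]_n) (x : 'rV[R]_n) : 'rV[R]_n :=
  xget 0 [set p | S p /\ forall q, S q -> enorm (x - p) <= enorm (x - q)].

Definition strongly_convex_on n (S : set 'rV[R]_n) (mu : R)
    (F : 'rV[R]_n -> R) : Prop :=
  forall x y t, S x -> S y -> 0 <= t <= 1 ->
    F (t *: x + (1 - t) *: y) <=
      t * F x + (1 - t) * F y - mu / 2 * t * (1 - t) * enorm (x - y) ^+ 2.

(* First-order expansion at x along S.  F is only meaningful on S, which may
   have empty interior; at an interior point of S this is the usual (Frechet)
   gradient. *)
Definition is_gradient n (S : set 'rV[R]_n) (F : 'rV[R]_n -> R)
    (x g : 'rV[R]_n) : Prop :=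
  forall e, 0 < e -> exists2 d, 0 < d &
    forall x', S x' -> enorm (x' - x) < d ->
      `|F x' - F x - dotv g (x' - x)| <= e * enorm (x' - x).

Definition smooth_on n (S : set 'rV[R]_n) (L : R)
    (F : 'rV[R]_n -> R) (G : 'rV[R]_n -> 'rV[R]_n) : Prop :=
  (forall x, S x -> is_gradient S F x (G x)) /\
  (forall x x', S x -> S x' -> enorm (G x - G x') <= L * enorm (x - x')).

Definition concave_on n (S : set 'rV[R]_n) (h : 'rV[R]_n -> R) : Prop :=
  convex_function S (fun y => - h y).

Definition supergradient n (S : set 'rV[R]_n) (h : 'rV[R]_n -> R)
    (y g : 'rV[R]_n) : Prop :=
  forall y', S y' -> h y' <= h y + dotv g (y' - y).

(* Lebesgue integral over R^m, as an iterated integral (Fubini). *)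
Fixpoint rV_integral (m : nat) : ('rV[R]_m -> R) -> R :=
  match m with
  | 0 => fun F => F 0
  | m'.+1 => fun F =>
      \int[lebesgue_measure]_(t in [set: R])
        rV_integral (fun v : 'rV[R]_m' => F (row_mx (t%:M : 'rV[R]_1) v))
  end.

Definition center_of_gravity m (S : set 'rV[R]_m) : 'rV[R]_m :=
  (rV_integral (\1_S : 'rV[R]_m -> R))^-1 *:
    \row_(i < m) rV_integral (fun y : 'rV[R]_m => \1_S y * y 0 i).

Definition log_plus (t : R) : R := Num.max 0 (ln t).

(* ln 0 = 0 in the library, so that log2_plus 0 = 0, as it should be. *)
Definition log2_plus (t : R) : R := Num.max 0 (ln t / ln 2).

(* Only used for t >= 0. *)
Definition ceil_nat (t : R) : nat := `|Num.ceil t|%N.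

(* sup and inf are total; in all uses below the extremum is attained, so that
   these are the max and the min. *)
Definition max_over n (S : set 'rV[R]_n) (F : 'rV[R]_n -> R) : R :=
  sup (F @` S).

Definition min_over n (S : set 'rV[R]_n) (F : 'rV[R]_n -> R) : R :=
  inf (F @` S).

Definition Gap n m (X : set 'rV[R]_n) (Y : set 'rV[R]_m)
    (f : 'rV[R]_n -> 'rV[R]_m -> R) (x : 'rV[R]_n) (y : 'rV[R]_m) : R :=
  max_over Y (f x) - min_over X (f^~ y).

End Euclidean.

Section Block.
Context {R : realType} {n : nat}.

(* [b_calls] counts the gradient evaluations. *)
Record block_state := BlockState {
  b_A : R; b_Gamma : R; b_u : 'rV[R]_n; b_z : 'rV[R]_n; b_r : 'rV[R]_n;
  b_calls : nat }.

Definition block_init (gamma : R) (xbar : 'rV[R]_n) : block_state :=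
  BlockState 0 gamma xbar xbar (gamma *: xbar) 0.

Definition block_step (X : set 'rV[R]_n) (G : 'rV[R]_n -> 'rV[R]_n)
    (muF LF gamma : R) (i : nat) (s : block_state) : block_state :=
  let a := i.+1%:R * gamma / (2 * LF) in
  let A := b_A s + a in
  let Gamma := b_Gamma s + muF * a in
  let x := A^-1 *: (b_A s *: b_u s + a *: b_z s) in
  let g := G x in
  let r := b_r s + a *: (muF *: x - g) in
  let z := proj X (Gamma^-1 *: r) in
  let u := A^-1 *: (b_A s *: b_u s + a *: z) in
  BlockState A Gamma u z r (b_calls s).+1.

(* Block(F, c + gamma / 2 * |. - xbar|^2, K) with G the gradient map of F; the
   constant c plays no role. *)
Fixpoint block (X : set 'rV[R]_n) (G : 'rV[R]_n -> 'rV[R]_n)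
    (muF LF gamma : R) (xbar : 'rV[R]_n) (K : nat) : block_state :=
  match K with
  | 0 => block_init gamma xbar
  | i.+1 => block_step X G muF LF gamma i.+1 (block X G muF LF gamma xbar i)
  end.

End Block.
Arguments block_state : clear implicits.

Section CertificateTransport.
Context {R : realType} {n m : nat}.

(* The plane y |-> pl_v + <pl_g, y - pl_y> and its associated point pl_u. *)
Record plane := Plane {
  pl_v : R; pl_g : 'rV[R]_m; pl_y : 'rV[R]_m; pl_u : 'rV[R]_n }.

Definition plane_val (p : plane) (y : 'rV[R]_m) : R :=
  pl_v p + dotv (pl_g p) (y - pl_y p).

(* The list of stored planes is never empty, so the value 0 is a dummy. *)
Definition model (ps : seq plane) (y : 'rV[R]_m) : R :=
  match ps with
  | [::] => 0
  | p :: qs => \big[Num.min/plane_val p y]_(q <- qs) plane_val q y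
  end.

Definition in_simplex (k : nat) (lam : 'I_k -> R) : Prop :=
  (forall i, 0 <= lam i) /\ \sum_(i < k) lam i = 1.

Definition mixed_plane (ps : seq plane) (lam : 'I_(size ps) -> R)
    (y : 'rV[R]_m) : R :=
  \sum_(i < size ps) lam i * plane_val (tnth (in_tuple ps) i) y.

Definition mixed_point (ps : seq plane) (lam : 'I_(size ps) -> R) : 'rV[R]_n :=
  \sum_(i < size ps) lam i *: pl_u (tnth (in_tuple ps) i).

Definition optimal_weights (Y : set 'rV[R]_m) (ps : seq plane)
    (lam : 'I_(size ps) -> R) : Prop :=
  in_simplex lam /\
  forall lam' : 'I_(size ps) -> R, in_simplex lam' ->
    max_over Y (mixed_plane lam) <= max_over Y (mixed_plane lam').

(* [ct_Tx] and [ct_Ty] count the calls to the two oracles. *)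
Record ct_state := CTState {
  ct_planes : seq plane;
  ct_b : R; ct_xb : 'rV[R]_n; ct_yb : 'rV[R]_m;
  ct_W : R; ct_h : R;
  ct_Tx : nat; ct_Ty : nat }.

(* a - b, where a = max_Y U is recomputed from the stored planes. *)
Definition ct_width (Y : set 'rV[R]_m) (s : ct_state) : R :=
  max_over Y (model (ct_planes s)) - ct_b s.

(* One run of the initialization, started at the u-output of the previous one;
   the second component accumulates the gradient calls. *)
Definition init_run (X : set 'rV[R]_n) (G : 'rV[R]_n -> 'rV[R]_n) (mu L : R)
    (p : block_state R n * nat) : block_state R n * nat :=
  let k := ceil_nat (Num.sqrt (8 * (L / mu))) in
  let s := block X G mu L (mu / 2) (b_u p.1) k in
  (s, p.2 + b_calls s)%N.

Definition ct_init (X : set 'rV[R]_n) (Y : set 'rV[R]_m)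
    (Ox : 'rV[R]_n -> 'rV[R]_m -> 'rV[R]_n)
    (Oy : 'rV[R]_n -> 'rV[R]_m -> R * 'rV[R]_m)
    (mu L Rx B : R) (y0 : 'rV[R]_m) (v : 'rV[R]_n) : ct_state :=
  let E := B / 3 in
  let runs := ((1 + ceil_nat (log2_plus (mu * Rx ^+ 2 / (4 * E)))) + 1)%N in
  let p := iter runs (init_run X (Ox^~ y0) mu L) (block_init (mu / 2) v, 0%N) in
  let u := b_u p.1 in
  let z := b_z p.1 in
  let v0 := (Oy u y0).1 in
  let g0 := (Oy u y0).2 in
  let planes := [:: Plane v0 g0 y0 u] in
  let b := v0 - B in
  let W := max_over Y (model planes) - b in
  CTState planes b z y0 W (b + W / 2) p.2 1.

Definition ct_step (X : set 'rV[R]_n) (Y : set 'rV[R]_m)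
    (Ox : 'rV[R]_n -> 'rV[R]_m -> 'rV[R]_n)
    (Oy : 'rV[R]_n -> 'rV[R]_m -> R * 'rV[R]_m)
    (mu L : R) (K : nat) (s : ct_state) : ct_state :=
  let sigma := mu / 2 in
  let b := ct_b s in
  let w := ct_width Y s in
  let reset := w <= 2 / 3 * ct_W s in
  let W := if reset then w else ct_W s in
  let h := if reset then b + w / 2 else ct_h s in
  let yc := center_of_gravity [set y | Y y /\ h <= model (ct_planes s) y] in
  let blk := block X (Ox^~ yc) mu L sigma (ct_xb s) K in
  let u := b_u blk in
  let z := b_z blk in
  let A := b_A blk in
  let v := (Oy u yc).1 in
  let g := (Oy u yc).2 in
  let planes := Plane v g yc u :: ct_planes s in
  let Tx := (ct_Tx s + b_calls blk)%N in
  let Ty := (ct_Ty s).+1 in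
  if h < v then
    CTState planes ((b + A * v) / (1 + A)) z
      ((1 + A)^-1 *: (ct_yb s + A *: yc)) W h Tx Ty
  else
    CTState planes b (ct_xb s) (ct_yb s) W h Tx Ty.

End CertificateTransport.
Arguments plane : clear implicits.
Arguments ct_state : clear implicits.

(* Main.v *)
(* The running lower model b + mu/4 |x - xb|^2 minorizes f(., yb) on X: the
   accelerated block provides such a minorant of f(., yc), and concavity in y
   averages the two.  The stored planes majorize f(ui, .), so that by convexity
   in x and the minimax theorem for finitely many planes the returned pair has
   gap at most a - b.

   Each iteration either multiplies h - b by at most 1 / (1 + A), where
   A >= K^2 / (8 kappa), or cuts the level set {U >= h} through its center of
   gravity and multiplies its volume by at most 5/6.  A reset multiplies W by at
   most 2/3 and the volume by at most 6^m, since the new level set contracted by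
   1/6 towards a maximizer of U lies in the old one.  Before termination
   h - b >= W/6 and vol {U >= h} >= (W / (6 B))^m vol Y with W > eps, which
   bounds the numbers of iterations of the three kinds.

   The factor 5/6 replaces the constant 1 - 1/e of Gruenbaum's inequality and
   only needs the log-concavity of s |-> vol (S /\ {<g, y - yc> > s}).  That is
   the multiplicative Brunn-Minkowski inequality for convex bodies, proved by
   induction on the dimension from the one-dimensional Prekopa-Leindler
   inequality. *)
From HB Require Import structures.
Require Import Defs.
From mathcomp Require Import measurable_realfun.
From mathcomp Require Import ring lra.

Set Implicit Arguments.
Unset Strict Implicit.
Unset Printing Implicit Defensive.

Import Order.TTheory GRing.Theory Num.Theory.
Local Open Scope classical_set_scope.
Local Open Scope ring_scope.

(** * Euclidean geometry of row vectors *)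

(** The threshold h is frozen between resets because both potentials rely on it: progress of b is
    measured by h - b, and the level sets {U >= h} are nested only while h stands still. The window
    [h - W/2, h + W/2] always contains [b, a], and a reset is due once [b, a] fills at most 2/3 of
    its length; otherwise h is at distance at least (2/3 - 1/2) W = W/6 from both ends, which is
    where the sixths of W come from. Transporting the certificate costs no curvature because the
    block starts from the weight sigma = mu/2: when the old certificate and A times the block
    minorant are added, the term mu/4 |x - xb|^2 cancels, and the new coefficient mu/4 + A mu/2 is
    at least (1 + A) mu/4. The center of gravity is given by iterated integrals, so the volume on
    R^m is built by the same recursion on the first coordinate; scaling, null hyperplanes and
    Brunn-Minkowski all follow that recursion. *)

Section euclidean.
Context {R : realType} {n : nat}.
Implicit Types x y z g : 'rV[R]_n.

Lemma dotvC x y : dotv x y = dotv y x.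
Proof. by apply: eq_bigr => i _; rewrite mulrC. Qed.

Lemma dotvDl x y z : dotv (x + y) z = dotv x z + dotv y z.
Proof. by rewrite /dotv -big_split; apply: eq_bigr => i _; rewrite mxE mulrDl. Qed.

Lemma dotvDr x y z : dotv z (x + y) = dotv z x + dotv z y.
Proof. by rewrite dotvC dotvDl !(dotvC z). Qed.

Lemma dotvZl (a : R) x y : dotv (a *: x) y = a * dotv x y.
Proof. by rewrite /dotv mulr_sumr; apply: eq_bigr => i _; rewrite mxE mulrA. Qed.

Lemma dotvZr (a : R) x y : dotv x (a *: y) = a * dotv x y.
Proof. by rewrite dotvC dotvZl dotvC. Qed.

Lemma dotvNl x y : dotv (- x) y = - dotv x y.
Proof. by rewrite -scaleN1r dotvZl mulN1r. Qed.

Lemma dotvNr x y : dotv x (- y) = - dotv x y.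
Proof. by rewrite dotvC dotvNl dotvC. Qed.

Lemma dotv0l x : dotv 0 x = 0.
Proof. by rewrite -(scale0r x) dotvZl mul0r. Qed.

Lemma dotv0r x : dotv x 0 = 0.
Proof. by rewrite dotvC dotv0l. Qed.

Definition dotvE := (dotvDl, dotvDr, dotvNl, dotvNr, dotvZl, dotvZr, dotv0l, dotv0r).

Lemma dotv_subZ x y (t : R) :
  dotv (x - t *: y) (x - t *: y) = dotv x x - 2 * t * dotv x y + t ^+ 2 * dotv y y.
Proof. by rewrite !dotvE [dotv y x]dotvC; ring. Qed.

Lemma dotv_ge0 x : 0 <= dotv x x.
Proof. by apply: sumr_ge0 => i _; rewrite -expr2 sqr_ge0. Qed.

Lemma dotv_eq0 x : (dotv x x == 0) = (x == 0).
Proof.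
apply/eqP/eqP => [|->]; last exact: dotv0l.
move=> h; apply/rowP => i; rewrite mxE; apply/eqP; rewrite -sqrf_eq0 expr2; apply/eqP.
by apply: (psumr_eq0P _ h) => // j _; rewrite -expr2 sqr_ge0.
Qed.

Lemma enorm_ge0 x : 0 <= enorm x.
Proof. exact: sqrtr_ge0. Qed.

Lemma enorm_sqr x : enorm x ^+ 2 = dotv x x.
Proof. by rewrite sqr_sqrtr// dotv_ge0. Qed.

Lemma enorm_eq0 x : (enorm x == 0) = (x == 0).
Proof. by rewrite -sqrf_eq0 enorm_sqr dotv_eq0. Qed.

Lemma enorm0 : enorm (0 : 'rV[R]_n) = 0.
Proof. by apply/eqP; rewrite enorm_eq0. Qed.

Lemma enormZ (a : R) x : enorm (a *: x) = `|a| * enorm x.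
Proof.
by rewrite /enorm !dotvE mulrA -expr2 sqrtrM ?sqr_ge0// sqrtr_sqr.
Qed.

Lemma enormN x : enorm (- x) = enorm x.
Proof. by rewrite -scaleN1r enormZ normrN1 mul1r. Qed.

Lemma enormC x y : enorm (x - y) = enorm (y - x).
Proof. by rewrite -enormN opprB. Qed.

(** Expansion of the squared norm of [enorm y *: x - enorm x *: y]. *)
Lemma dotv_cauchy x y : dotv x y <= enorm x * enorm y.
Proof.
have [->|y0] := eqVneq y 0; first by rewrite dotv0r enorm0 mulr0.
have := dotv_ge0 (enorm y *: x - enorm x *: y).
rewrite !dotvE -!enorm_sqr [dotv y x]dotvC.
have ny : 0 < enorm y by rewrite lt_def enorm_eq0 y0 enorm_ge0.
have [->|x0] := eqVneq x 0; first by move=> _; rewrite dotv0l enorm0 mul0r.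
have nx : 0 < enorm x by rewrite lt_def enorm_eq0 x0 enorm_ge0.
move=> h; rewrite -(ler_pM2l (mulr_gt0 nx ny)); nra.
Qed.

Lemma continuous_coord (i : 'I_n) : continuous (fun x : 'rV[R]_n => x 0 i).
Proof. exact: coord_continuous. Qed.

Lemma continuous_dotv2 (a b : 'rV[R]_n -> 'rV[R]_n) :
  continuous a -> continuous b -> continuous (fun x => dotv (a x) (b x)).
Proof.
move=> ca cb; rewrite /dotv.
suff H (s : seq 'I_n) : continuous (fun x => \sum_(i <- s) a x 0 i * b x 0 i) by exact: H.
elim: s => [|i s IH] x.
  by under eq_fun do rewrite big_nil; exact: cst_continuous.
rewrite (_ : (fun x => _) = (fun x => a x 0 i * b x 0 i) \+
    (fun x => \sum_(i <- s) a x 0 i * b x 0 i)); last first.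
  by apply/funext => z /=; rewrite big_cons.
apply: (@continuousD R _ _ _ _ x); last exact: IH.
apply: continuousM.
  exact: (continuous_comp (ca x) (@continuous_coord i _)).
exact: (continuous_comp (cb x) (@continuous_coord i _)).
Qed.

Lemma continuous_dotv g : continuous (dotv g).
Proof. by apply: continuous_dotv2 => x; [exact: cst_continuous|exact: cvg_id]. Qed.

Lemma continuous_enormB y : continuous (fun x => enorm (y - x)).
Proof.
have cd : continuous (fun x => y - x).
  by move=> x; apply: continuousB; [exact: cst_continuous|by []].
move=> x.
apply: (@continuous_comp _ _ _ (fun x => dotv (y - x) (y - x)) (@Num.sqrt R) x).
  exact: continuous_dotv2.
exact: sqrt_continuous.
Qed.

Lemma coord_le_enorm x (i : 'I_n) : `|x 0 i| <= enorm x.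
Proof.
rewrite -(@ler_pXn2r _ 2)// ?nnegrE ?enorm_ge0// enorm_sqr.
rewrite real_normK ?num_real// /dotv (bigD1 i)//= expr2 lerDl.
by apply: sumr_ge0 => j _; rewrite -expr2 sqr_ge0.
Qed.

Lemma norm_le_enorm x : `|x| <= enorm x.
Proof.
rewrite [leLHS]/Num.norm /= mx_normrE; apply/bigmax_leP; split; first exact: enorm_ge0.
by move=> [i j] _ /=; rewrite ord1 coord_le_enorm.
Qed.

(** Supplies the compactness of the domain X, on which projections and minimizers depend; the
    topology is that of the sup norm, hence the detour through [norm_le_enorm]. *)
Lemma diameter_compact (S : set 'rV[R]_n) (d : R) :
  closed S -> diameter_at_most S d -> compact S.
Proof.
move=> cS dS; have [->|/set0P[x Sx]] := eqVneq S set0; first exact: compact0.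
apply: bounded_closed_compact => //.
exists (d + `|x|); split; first exact: num_real.
move=> M dM y Sy; apply: le_trans (ltW dM).
rewrite -[y](subrK x); apply: (le_trans (ler_normD _ _)).
by rewrite lerD2r; apply: (le_trans (norm_le_enorm _)); exact: dS.
Qed.

Lemma compact_argmin (S : set 'rV[R]_n) (F : 'rV[R]_n -> R) : S !=set0 ->
  compact S -> {within S, continuous F} ->
  exists2 x, S x & forall y, S y -> F x <= F y.
Proof.
move=> S0 cS cF; have [x Sx H] := @EVT_min_rV R n F S S0 cS cF.
by exists x; [exact: set_mem|move=> y Sy; apply: H; exact: mem_set].
Qed.

(** Convexity with plain real weights instead of the interval-typed ones of [convex_set], so that
    weights can be computed by [ring] and [lra]. *)
Definition vconvex (S : set 'rV[R]_n) :=
  forall x y t, S x -> S y -> 0 <= t <= 1 -> S (t *: x + (1 - t) *: y).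

Lemma convex_set_vconvex (S : set 'rV[R]_n) : convex_set S -> vconvex S.
Proof.
move=> cS x y t Sx Sy t01.
exact: set_mem (cS x y (Itv01 (proj1 (andP t01)) (proj2 (andP t01))) (mem_set Sx) (mem_set Sy)).
Qed.

Lemma proj_spec (S : set 'rV[R]_n) x : S !=set0 -> compact S -> vconvex S ->
  S (proj S x) /\ forall y, S y -> dotv (x - proj S x) (y - proj S x) <= 0.
Proof.
move=> S0 cS vS.
have [p Sp pm] := compact_argmin S0 cS (continuous_subspaceT (@continuous_enormB x)).
have : exists q, [set p | S p /\ forall q, S q -> enorm (x - p) <= enorm (x - q)] q by exists p.
move=> /(xgetPex 0); rewrite -/(proj S x) => -[Sq qm]; split => //.
move=> y Sy; set q := proj S x in Sq qm *.
rewrite leNgt; apply/negP => c0.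
have d0 : 0 <= dotv (y - q) (y - q) := dotv_ge0 _.
set c := dotv (x - q) (y - q) in c0; set d := dotv (y - q) (y - q) in d0.
(* Any t in ]0, 1] with t * d < 2 * c yields a point of S closer to x than q; this one also covers d
   = 0. *)
pose t := c / (c + d).
have cd : 0 < c + d by lra.
have t01 : 0 <= t <= 1 by rewrite /t divr_ge0 ?ler_pdivrMr ?mul1r ?(ltW c0) ?(ltW cd)//= lerDl.
have t0 : 0 < t by rewrite /t divr_gt0.
have := qm _ (vS _ _ _ Sy Sq t01).
rewrite -(@ler_pXn2r _ 2)// ?nnegrE ?enorm_ge0// !enorm_sqr.
have -> : x - (t *: y + (1 - t) *: q) = (x - q) - t *: (y - q).
  by apply/rowP => i; rewrite !mxE; ring.
rewrite dotv_subZ -/c -/d.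
have tE : t * (c + d) = c by rewrite /t divfK// gt_eqF.
nra.
Qed.

(** The separating direction is the residual of the projection, and the margin is its squared
    length. *)
Lemma min_dist_dotv (S : set 'rV[R]_n) x : S !=set0 -> compact S -> vconvex S -> ~ S x ->
  exists g, exists2 e, 0 < e & forall y, S y -> dotv g (y - x) <= - e.
Proof.
move=> S0 cS vS nSx; have [Sp H] := proj_spec x S0 cS vS.
set p := proj S x in Sp H; exists (x - p), (dotv (x - p) (x - p)).
  rewrite lt_def dotv_ge0 andbT dotv_eq0 subr_eq0; apply/eqP => xp.
  by apply: nSx; rewrite xp.
move=> y Sy; have := H y Sy.
have -> : y - x = (y - p) - (x - p) by rewrite opprB addrA subrK.
by rewrite (dotvDr (y - p)) dotvNr; lra.
Qed.

End euclidean.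

(** * Lebesgue measure on row vectors *)

Definition rV_display : measure_display.
Proof. by []. Qed.

Section measurable_rV.
Context {R : realType}.
Variable n : nat.

Let coord (i : 'I_n) (x : 'rV[R]_n) : R := x 0 i.

Let rV_set0 : g_sigma_preimage coord set0.
Proof. exact: sigma_algebra0. Qed.

Let rV_setC A : g_sigma_preimage coord A -> g_sigma_preimage coord (~` A).
Proof. exact: sigma_algebraC. Qed.

Let rV_bigcup (F : (set 'rV[R]_n)^nat) : (forall i, g_sigma_preimage coord (F i)) ->
  g_sigma_preimage coord (\bigcup_i (F i)).
Proof. exact: sigma_algebra_bigcup. Qed.

(** Generating the sigma-algebra by the coordinates makes measurability of vector-valued maps a
    coordinatewise matter; open and closed sets are recovered in [open_measurable_rV] and
    [closed_measurable_rV]. *)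
HB.instance Definition _ := @isMeasurable.Build rV_display
  ('rV[R]_n) (g_sigma_preimage coord) rV_set0 rV_setC rV_bigcup.

Lemma measurable_coord (i : 'I_n) :
  measurable_fun [set: 'rV[R]_n] (fun x : 'rV[R]_n => x 0 i).
Proof.
move=> _ Y mY; rewrite setTI; apply: sub_sigma_algebra => /=.
rewrite -bigcup_seq/=; exists i => /=; first by rewrite mem_index_enum.
by exists Y => //; rewrite setTI.
Qed.

Lemma measurable_rVP d (T : measurableType d) (f : T -> 'rV[R]_n) :
  (forall i, measurable_fun [set: T] (fun t => f t 0 i)) ->
  measurable_fun [set: T] f.
Proof.
move=> mf.
suff : g_sigma_preimage (fun i => coord i \o f) `<=` @measurable _ T.
  rewrite (_ : g_sigma_preimage _ = preimage_set_system [set: T] f (g_sigma_preimage coord)).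
    by move=> prefS _ A mA; apply: prefS; exists A.
  exact: (@g_sigma_preimage_comp _ _ n _ coord _ f).
apply: smallest_sub; first exact: sigma_algebra_measurable.
rewrite -bigcup_seq => A [i _ [B mB <-]]; exact: mf.
Qed.

Lemma measurable_dotv (g : 'rV[R]_n) :
  measurable_fun [set: 'rV[R]_n] (fun x => dotv g x).
Proof.
apply: measurable_sum => i; apply: measurable_funM => //; exact: measurable_coord.
Qed.

(** An open set is the union of the rational cubes of radius 1 / (k + 1) that it contains: a
    countable union of finite intersections of coordinate preimages. *)
Lemma open_measurable_rV (O : set 'rV[R]_n) : open O -> measurable O.
Proof.
move=> oO.
pose B (q : 'rV[rat]_n) (k : nat) : set 'rV[R]_n :=
  [set y | forall i, `|ratr (q 0 i) - y 0 i| < k.+1%:R^-1].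
have mB q k : measurable (B q k).
  rewrite (_ : B q k = \big[setI/setT]_(i < n)
      ((fun y : 'rV[R]_n => y 0 i) @^-1` ball (ratr (q 0 i) : R) k.+1%:R^-1)).
    apply: bigsetI_measurable => i _; rewrite -[X in measurable X]setTI.
    apply: measurable_coord => //; apply: open_measurable; exact: ball_open.
  rewrite -bigcap_seq; apply/seteqP; split => y.
    by move=> H i _; exact: H.
  by move=> H i; apply: (H i); rewrite /= mem_index_enum.
rewrite (_ : O = \bigcup_(qk in [set qk : 'rV[rat]_n * nat | B qk.1 qk.2 `<=` O]) B qk.1 qk.2).
  rewrite bigcup_mkcond; apply: countable_bigcupT_measurable.
    exact: countableP.
  by move=> q; case: ifP => _.
apply/seteqP; split; last by move=> y [q qO]; exact: qO.
move=> x Ox.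
have /nbhs_ballP[e /= e0 xe] : nbhs x O by exact: open_nbhs_nbhs.
have [k ke] : exists k : nat, (k.+1%:R^-1 : R) < e / 2.
  have e20 : 0 < e / 2 by rewrite divr_gt0.
  have [k _ kP] := near_infty_natSinv_lt (PosNum e20).
  by exists k; apply: kP => /=.
have kk : (0 : R) < k.+1%:R^-1 by rewrite invr_gt0.
have [q qx] : exists q : 'rV[rat]_n, forall i, `|ratr (q 0 i) - x 0 i| < k.+1%:R^-1.
  have H i : exists q : rat, `|ratr q - x 0 i| < k.+1%:R^-1.
    have [] := @dense_rat R (ball (x 0 i) k.+1%:R^-1).
    - by exists (x 0 i); exact: ballxx.
    - exact: ball_open.
    - by move=> _ [/[swap] -[q _ <-]] qb; exists q; rewrite distrC.
  have [q qP] := boolp.choice H.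
  by exists (\row_i q i) => i; rewrite mxE.
exists (q, k) => //= y qy; apply: xe; split => // i j; rewrite ord1.
rewrite /ball/= (splitr e) -(subrKA (ratr (q 0 j))).
apply: (le_lt_trans (ler_normD _ _)); apply: ltrD; apply: lt_trans ke => //.
by rewrite distrC.
Qed.

Lemma closed_measurable_rV (A : set 'rV[R]_n) : closed A -> measurable A.
Proof.
by move=> cA; rewrite -(setCK A); apply: measurableC; apply: open_measurable_rV; exact: closed_openC.
Qed.

End measurable_rV.

Section cons_rV.
Context {R : realType}.
Variable m : nat.

(** The same [row_mx] as in [rV_integral], so that iterated integrals and the recursive volume
    match. *)
Definition cons_rV (p : measurableTypeR R * 'rV[R]_m) : 'rV[R]_m.+1 :=
  row_mx (p.1%:M : 'rV[R]_1) p.2.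

Lemma cons_rV0 p : cons_rV p 0 0 = p.1.
Proof.
rewrite /cons_rV mxE; case: splitP => [j _|k]; first by rewrite !mxE !ord1.
by move=> /eqP; rewrite eqn_leq.
Qed.

Lemma cons_rVS p (i : 'I_m) : cons_rV p 0 (lift ord0 i) = p.2 0 i.
Proof.
rewrite /cons_rV mxE; case: splitP => [[j j1]|k] /=; rewrite /bump /= add1n => E.
  by move: j1; rewrite -E.
by congr (_ _ _); apply/val_inj; case: E.
Qed.

Definition behead_rV (v : 'rV[R]_m.+1) : 'rV[R]_m := \row_i v 0 (lift ord0 i).

Definition uncons_rV (v : 'rV[R]_m.+1) : measurableTypeR R * 'rV[R]_m :=
  (v 0 0, behead_rV v).

Lemma uncons_rVK v : cons_rV (uncons_rV v) = v.
Proof.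
apply/rowP => i; case: (unliftP ord0 i) => [j ->|->]; last by rewrite cons_rV0.
by rewrite cons_rVS mxE.
Qed.

Lemma behead_cons_rV t (v : 'rV[R]_m) : behead_rV (cons_rV (t, v)) = v.
Proof. by apply/rowP => i; rewrite mxE cons_rVS. Qed.

Lemma cons_rVD t s (u v : 'rV[R]_m) :
  cons_rV (t, u) + cons_rV (s, v) = cons_rV (t + s, u + v).
Proof.
apply/rowP => i; rewrite mxE; case: (unliftP ord0 i) => [j ->|->]; last by rewrite !cons_rV0.
by rewrite !cons_rVS mxE.
Qed.

Lemma cons_rVZ a t (u : 'rV[R]_m) :
  a *: cons_rV (t, u) = cons_rV (a * t, a *: u).
Proof.
apply/rowP => i; rewrite mxE; case: (unliftP ord0 i) => [j ->|->]; last by rewrite !cons_rV0.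
by rewrite !cons_rVS mxE.
Qed.

Lemma dotv_cons_rV t s (u v : 'rV[R]_m) :
  dotv (cons_rV (t, u)) (cons_rV (s, v)) = t * s + dotv u v.
Proof.
rewrite /dotv big_ord_recl !cons_rV0; congr (_ + _).
by apply: eq_bigr => i _; rewrite !cons_rVS.
Qed.

Lemma measurable_cons_rV :
  measurable_fun [set: measurableTypeR R * 'rV[R]_m] cons_rV.
Proof.
apply: measurable_rVP => i; case: (unliftP ord0 i) => [j ->|->]; last first.
  by under eq_fun do rewrite cons_rV0; exact: measurable_fst.
under eq_fun do rewrite cons_rVS.
exact: (measurableT_comp (measurable_coord j) measurable_snd).
Qed.

Lemma measurable_uncons_rV : measurable_fun [set: 'rV[R]_m.+1] uncons_rV.
Proof.
apply: measurable_fun_pair; first exact: measurable_coord.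
apply: measurable_rVP => i; under eq_fun do rewrite mxE.
exact: measurable_coord.
Qed.

Lemma measurable_cons_rV1 t : measurable_fun [set: 'rV[R]_m] (fun v => cons_rV (t, v)).
Proof. exact: (measurableT_comp measurable_cons_rV (pair1_measurable t)). Qed.

End cons_rV.

(** * Recursive construction of the m-dimensional volume *)

Section volume.
Context {R : realType}.
Local Open Scope ereal_scope.

Section step.
Variables (m : nat) (mu : {sigma_finite_measure set 'rV[R]_m -> \bar R}).
Local Notation leb := (@lebesgue_measure R).

Definition vol_step (A : set 'rV[R]_m.+1) : \bar R :=
  pushforward (leb \x mu) (@cons_rV R m) A.

Let pm : {measure set 'rV[R]_m.+1 -> \bar R} :=
  @measure_function_pushforward__canonical__measure_function_Measure _ _ _ _ _
     (leb \x mu) _ (@measurable_cons_rV R m).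

HB.instance Definition _ := isMeasure.Build _ _ _ vol_step
  (@measure0 _ _ _ pm) (@measure_ge0 _ _ _ pm) (@measure_semi_sigma_additive _ _ _ pm).

(** Products of the two exhausting sequences, transported by [uncons_rV]; both sequences are
    nondecreasing, so a single index serves for the two factors. *)
Let vol_step_sigma_finite : sigma_finite setT vol_step.
Proof.
have /sigma_finiteP[F [TF ndF Foo]] := sigma_finiteT leb.
have /sigma_finiteP[G [TG ndG Goo]] := sigma_finiteT mu.
exists (fun k : nat => @uncons_rV R m @^-1` (F k `*` G k)).
  rewrite -preimage_bigcup -[LHS](@preimage_setT _ _ (@uncons_rV R m)).
  congr (_ @^-1` _); rewrite -setXTT TF TG predeqE => -[x y]; split.
    move=> [/= [k _ Fkx] [l _ Gly]]; exists (maxn k l) => //; split.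
    - by move: x Fkx; exact/subsetPset/ndF/leq_maxl.
    - by move: y Gly; exact/subsetPset/ndG/leq_maxr.
  by move=> [k _ []/= ? ?]; split; exists k.
move=> k; have [mF Fk] := Foo k; have [mG Gk] := Goo k; split.
  by rewrite -[X in measurable X]setTI; apply: measurable_uncons_rV => //; exact: measurableX.
rewrite /vol_step /pushforward -comp_preimage.
rewrite (_ : _ \o _ = idfun).
  by rewrite preimage_id product_measure1E// lte_mul_pinfty// ge0_fin_numE.
by apply/funext => -[t v]; rewrite /= /uncons_rV cons_rV0 behead_cons_rV.
Qed.

HB.instance Definition _ := Measure_isSigmaFinite.Build _ _ _ vol_step
  vol_step_sigma_finite.

End step.

(** Lebesgue measure on R^m, starting from the unit mass on R^0. Sigma-finiteness is carried in the
    type because the next product measure and Fubini's theorem ask for it. *)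
Fixpoint vol (m : nat) : {sigma_finite_measure set 'rV[R]_m -> \bar R} :=
  match m return {sigma_finite_measure set 'rV[R]_m -> \bar R} with
  | 0 => \d_(0%R : 'rV[R]_0)
  | m'.+1 => vol_step (vol m')
  end.

Definition slice m (A : set 'rV[R]_m.+1) (t : R) : set 'rV[R]_m :=
  [set v | A (cons_rV (t, v))].

Lemma measurable_slice m (A : set 'rV[R]_m.+1) t :
  measurable A -> measurable (slice A t).
Proof.
by move=> mA; rewrite -[X in measurable X]setTI; exact: measurable_cons_rV1.
Qed.

Lemma vol0E (A : set 'rV[R]_0) : vol 0 A = (\1_A 0%R)%:E.
Proof. by []. Qed.

Let xsection_slice m (A : set 'rV[R]_m.+1) t :
  xsection (@cons_rV R m @^-1` A) t = slice A t.
Proof. by apply/seteqP; split => v; rewrite /xsection/= inE. Qed.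

Let measurable_preim m (A : set 'rV[R]_m.+1) : measurable A ->
  measurable (@cons_rV R m @^-1` A).
Proof. by move=> mA; rewrite -[X in measurable X]setTI; exact: measurable_cons_rV. Qed.

Lemma volS m (A : set 'rV[R]_m.+1) : measurable A ->
  vol m.+1 A = \int[lebesgue_measure]_t vol m (slice A t).
Proof.
move=> mA; rewrite /= /vol_step /pushforward /product_measure1.
by apply: eq_integral => t _ /=; rewrite xsection_slice.
Qed.

Lemma measurable_vol_slice m (A : set 'rV[R]_m.+1) : measurable A ->
  measurable_fun [set: R] (fun t => vol m (slice A t)).
Proof.
move=> mA; have := @measurable_fun_xsection _ _ _ _ R (vol m) _ (measurable_preim mA).
by apply: eq_measurable_fun => t _; rewrite /= xsection_slice.
Qed.

End volume.

Section volume_integral.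
Context {R : realType}.
Local Open Scope ereal_scope.
Variable m : nat.
Implicit Type F : 'rV[R]_m.+1 -> R.

Lemma integral_vol_pushforward F : (vol m.+1).-integrable setT (EFin \o F) ->
  (lebesgue_measure \x (vol m)).-integrable setT (fun p => (F (cons_rV p))%:E).
Proof.
move=> /integrableP[mF iF]; apply/integrableP; split.
  exact: (measurableT_comp mF (@measurable_cons_rV R m)).
have := @ge0_integral_pushforward _ _ _ _ R (@cons_rV R m) (@measurable_cons_rV R m) (lebesgue_measure \x (vol m)) setT (fun y => `|(F y)%:E|).
rewrite preimage_setT => <- //.
exact: measurableT_comp mF.
Qed.

Lemma integral_volS F : (vol m.+1).-integrable setT (EFin \o F) ->
  \int[vol m.+1]_v (F v)%:E = \int[lebesgue_measure]_t \int[vol m]_v (F (cons_rV (t, v)))%:E.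
Proof.
move=> iF; have iF' := integral_vol_pushforward iF.
have := integral12_prod_meas1 iF'; rewrite /fubini_F /= => ->.
have := @integral_pushforward _ _ _ _ R (@cons_rV R m) (@measurable_cons_rV R m) (lebesgue_measure \x (vol m)) setT (EFin \o F).
rewrite preimage_setT => <- //.
by case/integrableP : iF.
Qed.

End volume_integral.

(** * Behavior of volume under scaling and translation *)

Section affine.
Context {R : realType}.
Local Open Scope ereal_scope.
Local Notation leb := (@lebesgue_measure R).

Lemma measurable_affine (s c : R) :
  measurable_fun [set: measurableTypeR R] (fun t => s * t + c : measurableTypeR R)%R.
Proof. by apply: measurable_funD => //; exact: measurable_funM. Qed.

(** The pushforward multiplied by s agrees with Lebesgue measure on half-open intervals, hence on
    all measurable sets by uniqueness. *)
Lemma lebesgue_measure_affine (s c : R) (A : set (measurableTypeR R)) :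
  (0 < s)%R -> measurable A ->
  leb ((fun t => s * t + c)%R @^-1` A) = (s^-1)%:E * leb A.
Proof.
move=> s0 mA.
pose phi (t : measurableTypeR R) : measurableTypeR R := (s * t + c)%R.
pose pm : {measure set (measurableTypeR R) -> \bar R} :=
  @measure_function_pushforward__canonical__measure_function_Measure _ _ _ _ _
     leb phi (measurable_affine s c).
have s0' : (0 <= s)%R by exact: ltW.
pose mu : {measure set (measurableTypeR R) -> \bar R} := mscale (NngNum s0') pm.
have := @lebesgue_measure_unique R mu _ A mA => ->; last first.
  move=> _ [[a b]] _ <-.
  rewrite /mu /= /mscale /= /pushforward.
  have -> : phi @^-1` (`]a, b])%classic = (`]((a - c) / s)%R, ((b - c) / s)%R])%classic.
    apply/seteqP; split => t; rewrite /phi /= !in_itv /= ltr_pdivrMr// ler_pdivlMr//; lra.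
  rewrite !lebesgue_measure_itv /= !lte_fin ltr_pM2r ?invr_gt0// ltrD2r.
  case: ifP => ab; last by rewrite mule0.
  rewrite -!EFinB -EFinM; congr EFin; field; exact: lt0r_neq0.
rewrite /mu /= /mscale /= /pushforward muleA -EFinM mulVf ?mul1e//.
exact: lt0r_neq0.
Qed.

Lemma ge0_integral_affine (s c : R) (f : R -> \bar R) : (0 < s)%R ->
  measurable_fun [set: R] f -> (forall t, 0 <= f t) ->
  \int[leb]_t f (s * t + c)%R = (s^-1)%:E * \int[leb]_t f t.
Proof.
move=> s0 mf f0.
have := @ge0_integral_pushforward _ _ _ _ R _ (measurable_affine s c) leb setT f.
rewrite preimage_setT => /(_ measurableT mf) <-; last by move=> *.
have s0' : (0 <= s^-1)%R by rewrite invr_ge0; exact: ltW.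
rewrite -(@ge0_integral_mscale _ _ R leb setT measurableT (NngNum s0') f mf (fun t _ => f0 t)).
apply: eq_measure_integral; first exact: measurable_affine.
move=> ? A mA _ /=; by rewrite /pushforward lebesgue_measure_affine.
Qed.

Lemma measurable_affine_rV m (s : R) (c : 'rV[R]_m) :
  measurable_fun [set: 'rV[R]_m] (fun y : 'rV[R]_m => s *: y + c)%R.
Proof.
apply: measurable_rVP => i; under eq_fun do rewrite !mxE.
apply: measurable_funD => //; apply: measurable_funM => //; exact: measurable_coord.
Qed.

Lemma vol_affine m (s : R) (c : 'rV[R]_m) (A : set 'rV[R]_m) :
  (0 < s)%R -> measurable A ->
  vol m ((fun y => s *: y + c)%R @^-1` A) = (s ^- m)%:E * vol m A.
Proof.
move=> s0; elim: m c A => [|m IH] c A mA.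
  rewrite !vol0E expr0 invr1 mul1e; congr (_%:E).
  by congr (\1_ _ _); apply/seteqP; split => y; rewrite /= [(_ + _)%R]thinmx0 [y]thinmx0.
have mP : measurable ((fun y => s *: y + c)%R @^-1` A).
  by rewrite -[X in measurable X]setTI; exact: measurable_affine_rV.
rewrite !volS//.
transitivity (\int[leb]_t ((s ^- m)%:E * vol m (slice A (s * t + c 0%R 0%R)%R))).
  apply: eq_integral => t _; rewrite -(IH (behead_rV c)); last exact: measurable_slice.
  congr (vol m _); apply/seteqP.
  have E v : (s *: cons_rV (t, v) + c = cons_rV (s * t + c 0 0, s *: v + behead_rV c))%R.
    by rewrite -[in LHS](uncons_rVK c) /uncons_rV cons_rVZ cons_rVD.
  by split => v; rewrite /slice /= E.
have sm0 : (0 <= s ^- m)%R by rewrite invr_ge0 exprn_ge0// ltW.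
rewrite (ge0_integralZl_EFin _ measurableT)//; last first.
  apply: (measurableT_comp (measurable_vol_slice mA)).
  exact: measurable_affine.
rewrite (@ge0_integral_affine s (c 0%R 0%R) (fun t => vol m (slice A t)))//; last exact: measurable_vol_slice.
by rewrite muleA -EFinM exprS invfM mulrC.
Qed.

End affine.

Section cube.
Context {R : realType}.
Local Open Scope ereal_scope.
Local Notation leb := (@lebesgue_measure R).

(** Boundedness is expressed by inclusion in such a sup-norm ball because its nonempty slices are
    again cubes of the same radius. *)
Definition cube m (x : 'rV[R]_m) (e : R) : set 'rV[R]_m :=
  [set v | forall i, (`|v 0 i - x 0 i| <= e)%R].

Lemma measurable_cube m (x : 'rV[R]_m) e : measurable (cube x e).
Proof.
rewrite (_ : cube x e = \big[setI/setT]_(i < m)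
    ((fun y : 'rV[R]_m => y 0 i)%R @^-1` `[(x 0 i - e)%R, (x 0 i + e)%R]%classic)).
  apply: bigsetI_measurable => i _; rewrite -[X in measurable X]setTI.
  by apply: measurable_coord.
rewrite -bigcap_seq; apply/seteqP; split => y.
  by move=> H i _; rewrite /= in_itv /=; move: (H i); rewrite ler_distl.
move=> H i; have := (H i); rewrite /= in_itv /= ler_distl; apply.
by rewrite /= mem_index_enum.
Qed.

Lemma slice_cube m (x : 'rV[R]_m.+1) e t :
  slice (cube x e) t = if (`|t - x 0 0| <= e)%R then cube (behead_rV x) e else set0.
Proof.
apply/seteqP; split => v; rewrite /slice /=.
  move=> H; have := H ord0; rewrite cons_rV0 /= => ->.
  by move=> i; have := H (lift ord0 i); rewrite cons_rVS mxE.
case: ifP => //= te H i; case: (unliftP ord0 i) => [j ->|->].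
  by rewrite cons_rVS; have := H j; rewrite mxE.
by rewrite cons_rV0.
Qed.

Lemma vol_cube m (x : 'rV[R]_m) e : (0 <= e)%R ->
  vol m (cube x e) = (((2 * e) ^+ m)%R)%:E.
Proof.
move=> e0; elim: m x => [|m IH] x.
  by rewrite vol0E expr0 indicE mem_set// => -[].
rewrite volS; last exact: measurable_cube.
transitivity (\int[leb]_(t in `[(x 0 0 - e)%R, (x 0 0 + e)%R]%classic) (((2 * e) ^+ m)%R)%:E).
  rewrite [RHS]integral_mkcond; apply: eq_integral => t _.
  rewrite slice_cube patchE mem_setE in_itv /= ler_distl.
  by case: ifP => // _; rewrite measure0.
rewrite integral_cst//= lebesgue_measure_itv /= lte_fin.
case: ltP => [_|h]; last first.
  have -> : e = 0%R by lra.
  by rewrite mulr0 mule0 exprS mul0r.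
by rewrite -EFinB -EFinM exprS; congr EFin; ring.
Qed.

End cube.

Section hyperplane.
Context {R : realType}.
Local Open Scope ereal_scope.
Local Notation leb := (@lebesgue_measure R).

(** The slices are hyperplanes one dimension lower, unless g is supported on the first coordinate,
    in which case at most one slice is nonempty. This allows trading strict for weak inequalities in
    half-spaces. *)
Lemma vol_hyperplane m (g : 'rV[R]_m) (c : R) : (g != 0)%R ->
  vol m [set v | dotv g v = c] = 0.
Proof.
elim: m g c => [|m IH] g c g0; first by rewrite thinmx0 eqxx in g0.
have mH k (h : 'rV[R]_k) d : measurable [set v | dotv h v = d].
  rewrite (_ : mkset _ = (fun v => dotv h v) @^-1` [set d]); last by apply/seteqP; split.
  by rewrite -[X in measurable X]setTI; exact: measurable_dotv.
rewrite volS//.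
have E t : slice [set v | dotv g v = c] t = [set v | dotv (behead_rV g) v = (c - g 0 0 * t)%R].
  have D v : (dotv g (cons_rV (t, v)) = g 0 0 * t + dotv (behead_rV g) v)%R.
    by rewrite -[in LHS](uncons_rVK g) dotv_cons_rV.
  by apply/seteqP; split => v; rewrite /slice /= D; lra.
have [bg0|bg0] := eqVneq (behead_rV g) 0%R; last first.
  by apply: integral0_eq => t _; rewrite E IH.
have gg : (g 0 0 != 0)%R.
  apply: contra_neq g0 => gg; rewrite -(uncons_rVK g) /uncons_rV gg bg0.
  by apply/rowP => i; case: (unliftP ord0 i) => [j ->|->]; rewrite ?cons_rVS ?cons_rV0 !mxE.
rewrite (ae_eq_integral (cst 0)) ?integral0//.
  exact: measurable_vol_slice.
exists [set (c / g 0%R 0%R)%R]; split => //; first exact: lebesgue_measure_set1.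
move=> t /=; apply: contra_notP => tc _; rewrite E bg0.
rewrite (_ : mkset _ = set0) ?measure0//; apply/seteqP; split => // v /=.
rewrite /dotv big1 => [|i _]; last by rewrite mxE mul0r.
move=> h; apply: tc; apply: (mulfI gg); rewrite [RHS]mulrC divfK//; lra.
Qed.

End hyperplane.

(** * Iterated integrals as integrals against the volume *)

Section bridge.
Context {R : realType}.
Local Open Scope ereal_scope.
Local Notation leb := (@lebesgue_measure R).

Lemma integrable_bounded m (F : 'rV[R]_m -> R) (C M : R) :
  measurable_fun setT F -> (forall v, `|F v| <= C)%R ->
  (forall v, F v != 0 -> cube 0 M v)%R -> (vol m).-integrable setT (EFin \o F).
Proof.
move=> mF FC FM; apply/integrableP; split; first exact/measurable_EFinP.
have M0 : (0 <= Num.max 0 M)%R by rewrite le_max lexx.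
have C0 : (0 <= C)%R := le_trans (normr_ge0 _) (FC 0%R).
suff le : \int[vol m]_x `|(EFin \o F) x| <=
    \int[vol m]_(x in cube 0%R (Num.max 0%R M)) C%:E.
  apply: (le_lt_trans le); rewrite integral_cst; last exact: measurable_cube.
  by rewrite /= vol_cube// ltry.
rewrite [leRHS]integral_mkcond; apply: ge0_le_integral => //.
  - by apply: measurableT_comp => //; exact/measurable_EFinP.
  - by apply/(measurable_restrictT _ (measurable_cube _ _)); exact: measurable_cst.
  - move=> x _ /=; rewrite patchE; case: ifPn => [_|]; first by rewrite lee_fin.
    move=> /negP xM; rewrite lee_fin normr_le0; apply/negPn/negP => /FM xM'.
    by apply: xM; rewrite inE => i; apply: (le_trans (xM' i)); rewrite le_max lexx orbT.
Qed.

(** Each level of [rV_integral] takes the finite part of an integral. Being bounded by C with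
    support in a cube is inherited by slices, which keeps all the inner integrals finite. *)
Lemma rV_integralE m (F : 'rV[R]_m -> R) (C M : R) :
  measurable_fun setT F -> (forall v, `|F v| <= C)%R ->
  (forall v, F v != 0 -> cube 0 M v)%R ->
  (rV_integral F)%:E = \int[vol m]_v (F v)%:E.
Proof.
elim: m F => [|m IH] F mF FC FM.
  rewrite /= (@integral_dirac _ _ _ R setT measurableT (EFin \o F)).
    by rewrite diracT mul1e.
  exact/measurable_EFinP.
have iF := integrable_bounded mF FC FM.
rewrite (integral_volS iF) /= /Rintegral.
have E t : (rV_integral (fun v => F (row_mx t%:M v)))%:E =
    \int[vol m]_v (F (cons_rV (t, v)))%:E.
  rewrite -(IH (fun v => F (cons_rV (t, v))))//.
    exact: (measurableT_comp mF (measurable_cons_rV1 t)).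
  by move=> v /FM H i; have := H (lift ord0 i); rewrite cons_rVS !mxE.
under eq_integral do rewrite E.
rewrite fineK// -(integral_volS iF).
exact: integrable_fin_num.
Qed.

End bridge.

(** * The Prekopa-Leindler inequality on the line *)

Section prekopa_leindler.
Context {R : realType}.
Local Notation leb := (@lebesgue_measure R).

(** The condition [0 < r] lets the layer-cake integral run over the whole line. *)
Definition upper_tail (f : R -> R) (r : R) : \bar R :=
  leb [set t | 0 < r < f t].

Let hypograph (f : R -> R) : set (measurableTypeR R * measurableTypeR R) :=
  [set p | 0 < p.2 < f p.1].

Let measurable_hypograph f : measurable_fun setT f -> measurable (hypograph f).
Proof.
move=> mf.
have -> : hypograph f = (fun p => 0 < p.2) @^-1` [set true] `&`
   (fun p => p.2 < f p.1) @^-1` [set true].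
  by apply/seteqP; split => p; rewrite /hypograph /=; [move=> /andP[-> ->]|move=> [-> ->]].
apply: measurableI.
  have : measurable_fun [set: measurableTypeR R * measurableTypeR R] (fun p => 0 < p.2).
    by apply: measurable_fun_ltr.
  by move=> /(_ measurableT [set true]); rewrite setTI; exact.
have : measurable_fun [set: measurableTypeR R * measurableTypeR R] (fun p => p.2 < f p.1).
  apply: measurable_fun_ltr => //.
  exact: (measurableT_comp mf measurable_fst).
by move=> /(_ measurableT [set true]); rewrite setTI; exact.
Qed.

Let upper_tailE f : measurable_fun setT f ->
  upper_tail f = fun r => (\int[leb]_t (\1_(hypograph f) (t, r) : R)%:E)%E.
Proof.
move=> mf; apply/funext => r; rewrite /upper_tail.
have mA : measurable [set t : measurableTypeR R | 0 < r < f t].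
  have := @measurable_ysection _ _ _ _ _ r (measurable_hypograph mf).
  by rewrite (_ : ysection _ _ = [set t | 0 < r < f t])//; apply/seteqP; split => t; rewrite /ysection/= inE.
rewrite -(setIT [set _ | _]) -(@integral_indic _ _ R leb setT)//.
Qed.

Let measurable_hypo1 f : measurable_fun setT f ->
   measurable_fun [set: measurableTypeR R * measurableTypeR R] (fun p => (\1_(hypograph f) p : R)%:E).
Proof.
move=> mf; apply/measurable_EFinP; apply: measurable_indic; exact: measurable_hypograph.
Qed.

Lemma measurable_upper_tail (f : R -> R) : measurable_fun setT f ->
  measurable_fun [set: measurableTypeR R] (upper_tail f).
Proof.
move=> mf; rewrite upper_tailE//.
exact: (measurable_fun_fubini_tonelli_G (m1 := leb) _ (measurable_hypo1 mf)).
Qed.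

(** Tonelli's theorem for the indicator of the region under the graph. *)
Lemma layer_cake (f : R -> R) : measurable_fun setT f -> (forall t, 0 <= f t) ->
  (\int[leb]_t (f t)%:E = \int[leb]_r upper_tail f r)%E.
Proof.
move=> mf f0; rewrite upper_tailE//.
rewrite -(fubini_tonelli (m1 := leb) (m2 := leb) _ (measurable_hypo1 mf)); last first.
  by move=> p; rewrite lee_fin indicE ler0n.
apply: eq_integral => t _.
transitivity (\int[leb]_r (\1_(`]0%R, f t[%classic : set (measurableTypeR R)) r)%:E)%E.
  rewrite integral_indic// setIT /=.
  have -> := @lebesgue_measure_itv R (`]0%R, f t[); rewrite /= lte_fin.
  case: ltP => ft; first by rewrite oppr0 adde0.
  by congr EFin; apply/eqP; rewrite eq_le ft f0.
by apply: eq_integral => r _; rewrite !indicE; congr (_%:R%:E); congr nat_of_bool; apply/idP/idP; rewrite !inE /= in_itv.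
Qed.

Definition convex_line (A : set R) :=
  forall s t th, A s -> A t -> 0 <= th <= 1 -> A (th * s + (1 - th) * t).

(** One-dimensional Brunn-Minkowski: A and B are no longer than the intervals between their infimum
    and supremum, while convexity forces C to contain the whole open interval between the combined
    infima and suprema. *)
Lemma lebesgue_convex_comb (A B C : set (measurableTypeR R)) (l M : R) :
  0 < l < 1 -> A !=set0 -> B !=set0 ->
  measurable A -> measurable B -> measurable C ->
  convex_line A -> convex_line B ->
  (forall t, A t -> `|t| <= M) -> (forall t, B t -> `|t| <= M) ->
  (forall s t, A s -> B t -> C (l * s + (1 - l) * t)) ->
  (l%:E * leb A + (1 - l)%:E * leb B <= leb C)%E.
Proof.
move=> /andP[l0 l1] A0 B0 mA mB mC cA cB AM BM ABC.
have hb (D : set R) : D !=set0 -> (forall t, D t -> `|t| <= M) -> has_sup D /\ has_inf D.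
  move=> D0 DM; split; split => //.
    by exists M => t /DM; rewrite ler_norml => /andP[].
  by exists (- M) => t /DM; rewrite ler_norml => /andP[].
have [sA iA] := hb A A0 AM; have [sB iB] := hb B B0 BM.
have bd (D : set R) : has_sup D -> has_inf D -> measurable (D : set (measurableTypeR R)) ->
    (leb D <= (sup D - inf D)%:E)%E.
  move=> sD iD mD.
  pose i : interval R := `[inf D, sup D].
  have sub : D `<=` [set` i].
    move=> t Dt; rewrite /= in_itv /=; apply/andP; split.
      by apply: inf_lbound => //; case: iD.
    by apply: sup_upper_bound.
  have := @le_measure _ _ _ leb D [set` i].
  rewrite !inE => /(_ mD (measurable_itv _) sub) => /le_trans; apply.
  rewrite /=; have -> := lebesgue_measure_itv i; rewrite /= lte_fin; case: ltP => //.
  move=> h; rewrite lee_fin subr_ge0.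
  by have [t Dt] := sD.1; have := sub _ Dt; rewrite /= in_itv /= => /andP[]; exact: le_trans.
set lo := l * inf A + (1 - l) * inf B.
set hi := l * sup A + (1 - l) * sup B.
have l1' : 0 < 1 - l by lra.
pose i : interval R := `]lo, hi[.
have sub : [set` i] `<=` C.
  move=> x; rewrite /= in_itv /= => /andP[lox xhi].
  have lo0 : 0 < x - lo by rewrite subr_gt0.
  have hi0 : 0 < hi - x by rewrite subr_gt0.
  have [a Aa alt] := inf_adherent lo0 iA.
  have [b Bb blt] := inf_adherent lo0 iB.
  have [a' Aa' alt'] := sup_adherent hi0 sA.
  have [b' Bb' blt'] := sup_adherent hi0 sB.
  set p := l * a + (1 - l) * b; set q := l * a' + (1 - l) * b'.
  have px : p < x.
    have H1 : l * a < l * (inf A + (x - lo)) by rewrite ltr_pM2l.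
    have H2 : (1 - l) * b < (1 - l) * (inf B + (x - lo)) by rewrite ltr_pM2l.
    rewrite /p; rewrite [x in _ < x](_ : _ = l * (inf A + (x - lo)) + (1 - l) * (inf B + (x - lo))); last by rewrite /lo; ring.
    exact: ltrD.
  have xq : x < q.
    have H1 : l * (sup A - (hi - x)) < l * a' by rewrite ltr_pM2l.
    have H2 : (1 - l) * (sup B - (hi - x)) < (1 - l) * b' by rewrite ltr_pM2l.
    rewrite /q; rewrite [x in x < _](_ : _ = l * (sup A - (hi - x)) + (1 - l) * (sup B - (hi - x))); last by rewrite /hi; ring.
    exact: ltrD.
  have qp : 0 < q - p by lra.
  (* One ratio is used in both sets, so x is a combination of a point of A and a point of B. *)
  pose th := (q - x) / (q - p).
  have th01 : 0 <= th <= 1.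
    by rewrite /th divr_ge0 ?ler_pdivrMr//=; lra.
  have -> : x = l * (th * a + (1 - th) * a') + (1 - l) * (th * b + (1 - th) * b').
    have thE : th * (q - p) = q - x by rewrite /th divfK// gt_eqF.
    transitivity (q - th * (q - p)); first by rewrite thE; ring.
    by rewrite /p /q; ring.
  by apply: ABC; [exact: cA|exact: cB].
apply: (@le_trans _ _ (hi - lo)%:E).
- have -> : hi - lo = l * (sup A - inf A) + (1 - l) * (sup B - inf B) by rewrite /hi /lo; ring.
  apply: (@le_trans _ _ (l%:E * (sup A - inf A)%:E + (1 - l)%:E * (sup B - inf B)%:E)%E); last by [].
  by apply: leeD; (apply: lee_wpmul2l; [rewrite lee_fin ltW|exact: bd]).
- have := @le_measure _ _ _ leb [set` i] C.
  rewrite !inE => /(_ (measurable_itv _) mC sub); apply: le_trans.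
  rewrite /=; have -> := lebesgue_measure_itv i; rewrite /= lte_fin; case: ltP => //.
  by move=> h; rewrite lee_fin subr_le0.
Qed.

Lemma powR_amgm (x y l : R) : 0 < l < 1 -> 0 <= x -> 0 <= y ->
  x `^ l * y `^ (1 - l) <= l * x + (1 - l) * y.
Proof.
move=> /andP[l0 l1] x0 y0.
have l1' : 0 < 1 - l by lra.
have := @conjugate_powR R (x `^ l) (y `^ (1 - l)) l^-1 (1 - l)^-1.
rewrite !powR_ge0 !invr_gt0 !invrK l0 l1'.
move=> /(_ isT isT isT isT (subrKC _ _)).
rewrite -!powRrM !divff ?gt_eqF// !powRr1//.
by rewrite [l * x]mulrC [(1 - l) * y]mulrC.
Qed.

Lemma upper_tail_ge1 (f : R -> R) r : (forall t, f t <= 1) -> 1 <= r ->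
  upper_tail f r = 0%E.
Proof.
move=> f1 r1; rewrite /upper_tail (_ : mkset _ = set0) ?measure0//.
apply/seteqP; split => // t /= /andP[_ rf].
by have := f1 t; rewrite leNgt (le_lt_trans r1 rf).
Qed.

Definition quasiconcave (f : R -> R) := forall s t th, 0 <= th <= 1 ->
  Num.min (f s) (f t) <= f (th * s + (1 - th) * t).

Let measurable_tail (f : R -> R) r : measurable_fun setT f ->
  measurable [set t : measurableTypeR R | r < f t].
Proof.
move=> mf; rewrite (_ : mkset _ = f @^-1` `]r, +oo[%classic).
  by rewrite -[X in measurable X]setTI; exact: mf.
by apply/seteqP; split => t; rewrite /= in_itv /= andbT.
Qed.

(* With suprema equal to 1, every superlevel set at a height in ]0, 1[ is
   nonempty, so the one-dimensional Brunn-Minkowski inequality applies at each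
   height and gives the additive form. *)
Lemma prekopa_leindler1_normalized (f g h : R -> R) (l M : R) : 0 < l < 1 ->
  measurable_fun setT f -> measurable_fun setT g -> measurable_fun setT h ->
  (forall t, 0 <= f t <= 1) -> (forall t, 0 <= g t <= 1) -> (forall t, 0 <= h t) ->
  (forall r, r < 1 -> exists t, r < f t) -> (forall r, r < 1 -> exists t, r < g t) ->
  (forall t, f t != 0 -> `|t| <= M) -> (forall t, g t != 0 -> `|t| <= M) ->
  quasiconcave f -> quasiconcave g ->
  (forall s t, f s `^ l * g t `^ (1 - l) <= h (l * s + (1 - l) * t)) ->
  (l%:E * \int[leb]_t (f t)%:E + (1 - l)%:E * \int[leb]_t (g t)%:E
     <= \int[leb]_t (h t)%:E)%E.
Proof.
move=> l01 mf mg mh f01 g01 h0 fs gs fM gM qf qg H.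
have /andP[l0 l1] := l01.
have [f0 f1] : (forall t, 0 <= f t) /\ (forall t, f t <= 1) by split => t; case/andP: (f01 t).
have [g0 g1] : (forall t, 0 <= g t) /\ (forall t, g t <= 1) by split => t; case/andP: (g01 t).
rewrite !layer_cake//.
have mT := measurable_upper_tail.
have l0' : (0 <= l%:E)%E by rewrite lee_fin ltW.
have l1' : (0 <= (1 - l)%:E)%E by rewrite lee_fin; lra.
have t0 u r : (0 <= upper_tail u r)%E by exact: measure_ge0.
rewrite -!ge0_integralZl//; try exact: mT.
rewrite -ge0_integralD//; first last.
- by apply: emeasurable_funM => //; exact: mT.
- by move=> r _; exact: mule_ge0.
- by apply: emeasurable_funM => //; exact: mT.
- by move=> r _; exact: mule_ge0.
apply: ge0_le_integral => //.
- by move=> r _; apply: adde_ge0; exact: mule_ge0.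
- by apply: emeasurable_funD; apply: emeasurable_funM => //; exact: mT.
- exact: mT.
move=> r _.
have [r1|r1] := leP 1 r.
  by rewrite (upper_tail_ge1 f1 r1) (upper_tail_ge1 g1 r1) !mule0 adde0.
have [r0|r0] := leP r 0.
  have z u : upper_tail u r = 0%E.
    rewrite /upper_tail (_ : mkset _ = set0) ?measure0//.
    by apply/seteqP; split => // t /= /andP[]; rewrite ltNge r0.
  by rewrite !z !mule0 adde0.
have E u : upper_tail u r = leb [set t | r < u t].
  rewrite /upper_tail; congr (leb _).
  by apply/seteqP; split => t /=; rewrite r0.
have cq u : quasiconcave u -> convex_line [set t | r < u t].
  move=> qu s t th /= us ut th01; apply: lt_le_trans (qu s t th th01).
  by rewrite lt_min us ut.
rewrite !E; apply: (@lebesgue_convex_comb _ _ _ l M) => //.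
- by have [t] := fs r r1; exists t.
- by have [t] := gs r r1; exists t.
- exact: measurable_tail.
- exact: measurable_tail.
- exact: measurable_tail.
- exact: cq.
- exact: cq.
- by move=> t /= rf; apply: fM; rewrite gt_eqF// (lt_trans r0 rf).
- by move=> t /= rf; apply: gM; rewrite gt_eqF// (lt_trans r0 rf).
- move=> s t /= fr gr; apply: lt_le_trans (H s t).
  have -> : r = r `^ l * r `^ (1 - l).
    rewrite -powRD; last by rewrite (gt_eqF r0) implybT.
    by rewrite subrKC powRr1 // ltW.
  apply: ltr_pM; rewrite ?powR_ge0//.
    by apply: gt0_ltr_powR; rewrite ?nnegrE ?(ltW r0).
  by apply: gt0_ltr_powR; rewrite ?nnegrE ?(ltW r0)// subr_gt0.
Qed.

Lemma integral_bounded_fin (f : R -> R) (M D : R) : measurable_fun setT f ->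
  (forall t, 0 <= f t <= D) -> (forall t, f t != 0 -> `|t| <= M) ->
  ((\int[leb]_t (f t)%:E)%E \is a fin_num).
Proof.
move=> mf fD fM; rewrite ge0_fin_numE; last first.
  by apply: integral_ge0 => t _; rewrite lee_fin; case/andP: (fD t).
have D0 : 0 <= D by have /andP[] := fD 0; exact: le_trans.
have le : (\int[leb]_t (f t)%:E <= \int[leb]_(t in `[(- M)%R, M]%classic) D%:E)%E.
  rewrite [leRHS]integral_mkcond; apply: ge0_le_integral => //.
  - by move=> t _; rewrite lee_fin; case/andP: (fD t).
  - exact/measurable_EFinP.
  - by apply/(measurable_restrictT _ (measurable_itv _)); exact: measurable_cst.
  - move=> t _; rewrite patchE; case: ifPn; first by rewrite lee_fin; case/andP: (fD t).
    move=> /negP tM; rewrite lee_fin le_eqVlt; apply/orP; left; apply/negPn/negP => /fM tM'.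
    by apply: tM; rewrite inE /= in_itv /= -ler_norml.
apply: (le_lt_trans le); rewrite integral_cst//= lebesgue_measure_itv /=.
by case: ifP => _; rewrite ?mule0 ?ltry// -EFinN -EFinD -EFinM ltry.
Qed.

(** Dividing f and g by their suprema, and h by the geometric mean N of these suprema, leads to the
    normalized case; weighted AM-GM then turns its additive conclusion into the multiplicative
    one. *)
Lemma prekopa_leindler1 (f g h : R -> R) (l M D : R) : 0 < l < 1 ->
  measurable_fun setT f -> measurable_fun setT g -> measurable_fun setT h ->
  (forall t, 0 <= f t <= D) -> (forall t, 0 <= g t <= D) -> (forall t, 0 <= h t <= D) ->
  (forall t, f t != 0 -> `|t| <= M) -> (forall t, g t != 0 -> `|t| <= M) ->
  (forall t, h t != 0 -> `|t| <= M) ->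
  quasiconcave f -> quasiconcave g ->
  (forall s t, f s `^ l * g t `^ (1 - l) <= h (l * s + (1 - l) * t)) ->
  fine (\int[leb]_t (f t)%:E)%E `^ l * fine (\int[leb]_t (g t)%:E)%E `^ (1 - l)
     <= fine (\int[leb]_t (h t)%:E)%E.
Proof.
move=> l01 mf mg mh fD gD hD fM gM hM qf qg H.
have /andP[l0 l1] := l01.
have l1' : 0 < 1 - l by lra.
have ge0 (u : R -> R) : (forall t, 0 <= u t <= D) -> forall t, 0 <= u t by move=> uD t; case/andP: (uD t).
have Ih0 : 0 <= fine (\int[leb]_t (h t)%:E)%E.
  by apply: fine_ge0; apply: integral_ge0 => t _; rewrite lee_fin; exact: ge0.
have zero (u : R -> R) : (forall t, 0 <= u t <= D) -> ~ (exists t, 0 < u t) ->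
    (\int[leb]_t (u t)%:E)%E = 0%E.
  move=> uD nu; apply: integral0_eq => t _; congr EFin; apply/eqP.
  rewrite eq_le ge0// andbT leNgt; apply/negP => ut; apply: nu; by exists t.
have [[tf ftf]|/(zero _ fD) ->] := pselect (exists t, 0 < f t); last first.
  by rewrite /= powR0 ?gt_eqF// mul0r.
have [[tg gtg]|/(zero _ gD) ->] := pselect (exists t, 0 < g t); last first.
  by rewrite /= powR0 ?gt_eqF// mulr0.
have hs (u : R -> R) t0 : (forall t, 0 <= u t <= D) -> 0 < u t0 ->
    [/\ 0 < sup (range u), forall t, u t <= sup (range u) &
      forall r, r < sup (range u) -> exists t, r < u t].
  move=> uD ut0.
  have su : has_sup (range u).
    split; first by exists (u t0), t0.
    by exists D => _ [t _ <-]; case/andP: (uD t).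
  have ub t : u t <= sup (range u) by apply: sup_upper_bound => //; exists t.
  split => //; first exact: lt_le_trans (ub t0).
  move=> r rs; have e0 : 0 < sup (range u) - r by rewrite subr_gt0.
  have [_ [t _ <-]] := sup_adherent e0 su; rewrite subKr => rt; by exists t.
have [F0 Fub Fs] := hs f tf fD ftf; have [G0 Gub Gs] := hs g tg gD gtg.
set F := sup (range f) in F0 Fub Fs; set G := sup (range g) in G0 Gub Gs.
have FG0 : 0 < F `^ l * G `^ (1 - l) by rewrite mulr_gt0 ?powR_gt0.
set N := F `^ l * G `^ (1 - l) in FG0.
have mZ (u : R -> R) c : measurable_fun setT u -> measurable_fun setT (fun t => c * u t).
  by move=> mu; exact: measurable_funM.
have nrm (u : R -> R) c : 0 < c -> measurable_fun setT u -> (forall t, 0 <= u t <= D) ->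
    (forall t, u t != 0 -> `|t| <= M) ->
    (\int[leb]_t (c^-1 * u t)%:E)%E = (c^-1 * fine (\int[leb]_t (u t)%:E))%:E.
  move=> c0 mu uD uM; rewrite EFinM fineK; last exact: integral_bounded_fin uM.
  under eq_integral do rewrite EFinM.
  rewrite ge0_integralZl//; first exact/measurable_EFinP.
    by move=> t _; rewrite lee_fin ge0.
  by rewrite lee_fin invr_ge0 ltW.
have qZ (u : R -> R) c : 0 < c -> quasiconcave u -> quasiconcave (fun t => c^-1 * u t).
  move=> c0 qu s t th /qu h'; rewrite -minr_pMr ?invr_ge0 ?(ltW c0)//.
  by rewrite ler_pM2l ?invr_gt0.
have nz (u : R -> R) c : (forall t, u t != 0 -> `|t| <= M) -> forall t, c^-1 * u t != 0 -> `|t| <= M.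
  by move=> uM t; rewrite mulf_eq0 negb_or => /andP[_]; exact: uM.
have := @prekopa_leindler1_normalized (fun t => F^-1 * f t) (fun t => G^-1 * g t)
  (fun t => N^-1 * h t) l M l01 (mZ _ _ mf) (mZ _ _ mg) (mZ _ _ mh).
have P1 (u : R -> R) c : 0 < c -> (forall t, 0 <= u t) -> (forall t, u t <= c) ->
     forall t, 0 <= c^-1 * u t <= 1.
  move=> c0 u0 uc t; rewrite mulr_ge0 ?u0 ?invr_ge0 ?(ltW c0)//=.
  by rewrite mulrC ler_pdivrMr// mul1r.
move=> /(_ (P1 _ _ F0 (ge0 _ fD) Fub) (P1 _ _ G0 (ge0 _ gD) Gub)).
have P2 t : 0 <= N^-1 * h t by apply: mulr_ge0; [rewrite invr_ge0 ltW|exact: ge0].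
move=> /(_ P2).
have P3 (u : R -> R) c : 0 < c -> (forall r, r < c -> exists t, r < u t) ->
     forall r, r < 1 -> exists t, r < c^-1 * u t.
  move=> c0 cu r r1; have [|t rt] := cu (r * c); first by rewrite gtr_pMl.
  by exists t; rewrite mulrC ltr_pdivlMr.
move=> /(_ (P3 _ _ F0 Fs) (P3 _ _ G0 Gs) (nz _ _ fM) (nz _ _ gM) (qZ _ _ F0 qf) (qZ _ _ G0 qg)).
have P4 s t : (F^-1 * f s) `^ l * (G^-1 * g t) `^ (1 - l) <= N^-1 * h (l * s + (1 - l) * t).
  rewrite !powRM ?invr_ge0 ?(ltW F0) ?(ltW G0) ?(ge0 _ fD) ?(ge0 _ gD)//.
  have iv c x : 0 < c -> (c^-1) `^ x = (c `^ x)^-1.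
    by move=> c0; rewrite -[c^-1]powR_inv1 ?(ltW c0)// powRAC powR_inv1// powR_ge0.
  rewrite !iv// mulrACA -invfM ler_pM2l ?invr_gt0//.
move=> /(_ P4); rewrite (nrm _ _ F0)// (nrm _ _ G0)// (nrm _ _ FG0)//.
rewrite -!EFinM -EFinD lee_fin => A.
set If := fine _ in A *; set Ig := fine _ in A *; set Ih := fine _ in A *.
have If0 : 0 <= If by apply: fine_ge0; apply: integral_ge0 => t _; rewrite lee_fin; exact: ge0.
have Ig0 : 0 <= Ig by apply: fine_ge0; apply: integral_ge0 => t _; rewrite lee_fin; exact: ge0.
have := powR_amgm l01 (_ : 0 <= F^-1 * If) (_ : 0 <= G^-1 * Ig).
rewrite !mulr_ge0 ?invr_ge0 ?(ltW F0) ?(ltW G0)// => /(_ isT isT) B.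
have := le_trans B A; rewrite -(ler_pM2l FG0) mulVKf ?gt_eqF// => E.
apply: le_trans E.
have {1}-> : If = F * (F^-1 * If) by rewrite mulVKf ?gt_eqF.
have {1}-> : Ig = G * (G^-1 * Ig) by rewrite mulVKf ?gt_eqF.
rewrite !(powRM _ (ltW F0)) ?(powRM _ (ltW G0)) ?mulr_ge0 ?invr_ge0 ?(ltW F0) ?(ltW G0)//.
by rewrite mulrACA.
Qed.

End prekopa_leindler.

(** * The Brunn-Minkowski inequality *)

Section brunn_minkowski.
Context {R : realType}.
Local Notation leb := (@lebesgue_measure R).

Definition rvol m (A : set 'rV[R]_m) : R := fine (vol m A).

Lemma le_vol m (A B : set 'rV[R]_m) : measurable A -> measurable B ->
  A `<=` B -> (vol m A <= vol m B)%E.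
Proof. by move=> mA mB AB; apply: le_measure => //; rewrite inE. Qed.

Lemma cube_max m (M : R) (A : set 'rV[R]_m) : A `<=` cube 0 M -> A `<=` cube 0 (Num.max 0 M).
Proof. by move=> AM v /AM H i; apply: le_trans (H i) _; rewrite le_max lexx orbT. Qed.

Lemma vol_bounded m (A : set 'rV[R]_m) (M : R) : measurable A -> A `<=` cube 0 M ->
  vol m A = (rvol A)%:E /\ 0 <= rvol A <= (2 * Num.max 0 M) ^+ m.
Proof.
move=> mA /cube_max AM.
have le := le_vol mA (measurable_cube _ _) AM.
have M0 : 0 <= Num.max 0 M by rewrite le_max lexx.
rewrite vol_cube// in le.
have fA : vol m A \is a fin_num by rewrite ge0_fin_numE// (le_lt_trans le)// ltry.
split; first by rewrite /rvol fineK.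
by rewrite fine_ge0//= -lee_fin fineK.
Qed.

Lemma rvol_ge0 m (A : set 'rV[R]_m) : 0 <= rvol A.
Proof. exact: fine_ge0. Qed.

Lemma le_rvol m (A B : set 'rV[R]_m) (M : R) : measurable A -> measurable B ->
  B `<=` cube 0 M -> A `<=` B -> rvol A <= rvol B.
Proof.
move=> mA mB BM AB.
have [EA _] := vol_bounded mA (subset_trans AB BM).
have [EB _] := vol_bounded mB BM.
by rewrite -lee_fin -EA -EB; exact: le_vol.
Qed.

Lemma slice_sub m (A : set 'rV[R]_m.+1) M t : A `<=` cube 0 M -> slice A t `<=` cube 0 M.
Proof. by move=> AM v /AM H i; have := H (lift ord0 i); rewrite cons_rVS !mxE. Qed.

Lemma rvolS m (A : set 'rV[R]_m.+1) M : measurable A -> A `<=` cube 0 M ->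
  rvol A = fine (\int[leb]_t (rvol (slice A t))%:E)%E.
Proof.
move=> mA AM; rewrite {1}/rvol volS//; congr fine; apply: eq_integral => t _.
by have [-> _] := vol_bounded (measurable_slice t mA) (slice_sub (t := t) AM).
Qed.

Lemma convex_slice m (A : set 'rV[R]_m.+1) t : vconvex A -> vconvex (slice A t).
Proof.
move=> cA x y th Ax Ay th01; rewrite /slice /=.
have := cA _ _ th Ax Ay th01; rewrite !cons_rVZ cons_rVD.
by rewrite (_ : th * t + (1 - th) * t = t)//; ring.
Qed.

(** The one-dimensional functional inequality is applied to slice volumes. Its pointwise hypothesis
    is the present inequality one dimension lower, and so is the quasiconcavity of the slice
    volumes, by comparing slices of a single convex body. *)
Lemma brunn_minkowski m (A B C : set 'rV[R]_m) (l M : R) : 0 < l < 1 ->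
  measurable A -> measurable B -> measurable C ->
  A `<=` cube 0 M -> B `<=` cube 0 M -> C `<=` cube 0 M ->
  vconvex A -> vconvex B ->
  (forall a b, A a -> B b -> C (l *: a + (1 - l) *: b)) ->
  rvol A `^ l * rvol B `^ (1 - l) <= rvol C.
Proof.
elim: m A B C l => [|m IH] A B C l l01 mA mB mC AM BM CM cA cB ABC.
  have /andP[l0 l1] := l01.
  rewrite /rvol !vol0E /= !indicE.
  have l1' : 1 - l != 0 by rewrite gt_eqF// subr_gt0.
  case: (boolP (0 \in A)) => [|_]; last by rewrite powR0 ?mul0r// gt_eqF.
  rewrite inE => A0.
  case: (boolP (0 \in B)) => [|_]; last by rewrite mulrC powR0 ?mul0r// gt_eqF.
  rewrite inE => B0.
  by rewrite mem_set ?powR1 ?mulr1//; have := ABC _ _ A0 B0; rewrite !scaler0 addr0.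
have l01' := l01; have /andP[l0 l1] := l01'.
rewrite (rvolS mA AM) (rvolS mB BM) (rvolS mC CM).
have rS (D : set 'rV[R]_m.+1) : measurable D -> D `<=` cube 0 M ->
    [/\ measurable_fun setT (fun t => rvol (slice D t)),
     forall t, 0 <= rvol (slice D t) <= (2 * Num.max 0 M) ^+ m &
     forall t, rvol (slice D t) != 0 -> `|t| <= M].
  move=> mD DM; split.
  - apply/measurable_EFinP; apply: eq_measurable_fun (measurable_vol_slice mD) => t _ /=.
    by have [] := vol_bounded (measurable_slice t mD) (slice_sub (t := t) DM).
  - by move=> t; have [_] := vol_bounded (measurable_slice t mD) (slice_sub (t := t) DM).
  - move=> t; apply: contraNT; rewrite -ltNge => Mt.
    rewrite (_ : slice D t = set0) ?/rvol ?measure0//.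
    apply/seteqP; split => // v /DM /(_ 0); rewrite cons_rV0 mxE subr0 /=.
    by rewrite leNgt Mt.
have qS (D : set 'rV[R]_m.+1) : measurable D -> D `<=` cube 0 M -> vconvex D ->
     quasiconcave (fun t => rvol (slice D t)).
  move=> mD DM cD s t th /andP[th0 th1].
  move: th0; rewrite le_eqVlt => /orP[/eqP<-|th0].
    by rewrite mul0r add0r subr0 mul1r ge_min lexx orbT.
  move: th1; rewrite le_eqVlt => /orP[/eqP->|th1].
    by rewrite subrr mul0r addr0 mul1r ge_min lexx.
  have th01 : 0 < th < 1 by rewrite th0.
  have := IH (slice D s) (slice D t) (slice D (th * s + (1 - th) * t)) th th01
    (measurable_slice _ mD) (measurable_slice _ mD) (measurable_slice _ mD)
    (slice_sub DM) (slice_sub DM) (slice_sub DM) (convex_slice cD) (convex_slice cD).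
  have H a b : slice D s a -> slice D t b -> slice D (th * s + (1 - th) * t) (th *: a + (1 - th) *: b).
    move=> Da Db; have := cD _ _ th Da Db; rewrite !cons_rVZ cons_rVD; apply.
    by rewrite !ltW.
  move=> /(_ H); apply: le_trans.
  (* A weighted geometric mean of u and w is at least their minimum. *)
  set u := rvol _; set w := rvol _.
  have u0 : 0 <= u := rvol_ge0 _; have w0 : 0 <= w := rvol_ge0 _.
  have m0 : 0 <= Num.min u w by rewrite le_min u0.
  have {1}-> : Num.min u w = Num.min u w `^ th * Num.min u w `^ (1 - th).
    rewrite -powRD ?subrKC ?powRr1//; by rewrite oner_eq0.
  apply: ler_pM; rewrite ?powR_ge0//.
    by apply: ge0_ler_powR; rewrite ?nnegrE ?(ltW th0)// ge_min lexx.
  by apply: ge0_ler_powR; rewrite ?nnegrE ?subr_ge0 ?(ltW th1)// ge_min lexx orbT.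
have [mfA AD AM'] := rS A mA AM; have [mfB BD BM'] := rS B mB BM; have [mfC CD CM'] := rS C mC CM.
apply: (@prekopa_leindler1 _ _ _ _ l M ((2 * Num.max 0 M) ^+ m)) => //; try exact: qS.
move=> s t.
apply: IH => //; try exact: measurable_slice; try exact: slice_sub; try exact: convex_slice.
by move=> a b Aa Bb; have := ABC _ _ Aa Bb; rewrite !cons_rVZ cons_rVD.
Qed.

(** Squaring removes the real powers; this midpoint form is the log-concavity used for
    half-spaces. *)
Lemma rvol_midpoint m (A B C : set 'rV[R]_m) (M : R) :
  measurable A -> measurable B -> measurable C ->
  A `<=` cube 0 M -> B `<=` cube 0 M -> C `<=` cube 0 M ->
  vconvex A -> vconvex B ->
  (forall a b, A a -> B b -> C (2^-1 *: (a + b))) ->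
  rvol A * rvol B <= rvol C ^+ 2.
Proof.
move=> mA mB mC AM BM CM cA cB ABC.
have h01 : 0 < (2^-1 : R) < 1 by rewrite invr_gt0 ltr0n invf_lt1// ltr1n.
have hh : 1 - (2^-1 : R) = 2^-1 by lra.
have := @brunn_minkowski m A B C 2^-1 M h01 mA mB mC AM BM CM cA cB.
have ABC' a b : A a -> B b -> C (2^-1 *: a + (1 - 2^-1) *: b).
  by rewrite hh -scalerDr; exact: ABC.
move=> /(_ ABC'); rewrite hh => H.
rewrite -[rvol A * _]powRr1 ?mulr_ge0 ?rvol_ge0//.
have {1}-> : (1 : R) = 2^-1 * 2%:R by rewrite mulVf.
rewrite powRrM powR_mulrn ?powR_ge0// powRM ?rvol_ge0//.
by rewrite lerXn2r ?nnegrE ?mulr_ge0 ?powR_ge0 ?rvol_ge0.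
Qed.

End brunn_minkowski.

(** * The center of gravity *)

Section centroid.
Context {R : realType}.
Variable m : nat.
Implicit Types (S A : set 'rV[R]_m) (F : 'rV[R]_m -> R).

Lemma dotv_cube_bound (g : 'rV[R]_m) (M : R) :
  exists K, forall v, cube 0 M v -> `|dotv g v| <= K.
Proof.
exists (\sum_i `|g 0 i| * M) => v vM; apply: (le_trans (ler_norm_sum _ _ _)).
apply: ler_sum => i _; rewrite normrM; apply: ler_wpM2l => //.
by have := vM i; rewrite mxE subr0.
Qed.

Lemma integrable_on_bounded S F (M C : R) : measurable S -> S `<=` cube 0 M ->
  measurable_fun setT F -> (forall v, S v -> `|F v| <= C) ->
  (vol m).-integrable S (EFin \o F).
Proof.
move=> mS SM mF FC; apply/integrable_mkcond => //.
rewrite (_ : _ \_ S = EFin \o (fun v => \1_S v * F v)); last first.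
  apply/funext => v; rewrite patchE /= indicE; case: ifP => vS /=.
    by rewrite mul1r.
  by rewrite mul0r.
apply: (@integrable_bounded _ _ _ (Num.max 0 C) M).
- by apply: measurable_funM => //; exact: measurable_indic.
- move=> v; rewrite indicE; case: (boolP (v \in S)) => vS /=.
    by rewrite mul1r le_max FC ?orbT//; exact: set_mem.
  by rewrite mul0r normr0 le_max lexx.
- move=> v; rewrite indicE; case: (boolP (v \in S)) => vS /=.
    by move=> _; apply: SM; exact: set_mem.
  by rewrite mul0r eqxx.
Qed.

Lemma rV_integral_indicM S F (M C : R) : measurable S -> S `<=` cube 0 M ->
  measurable_fun setT F -> (forall v, S v -> `|F v| <= C) ->
  rV_integral (fun y => \1_S y * F y) = \int[vol m]_(y in S) F y.
Proof.
move=> mS SM mF FC.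
have := @rV_integralE R m (fun y => \1_S y * F y) (Num.max 0 C) M.
have H1 : measurable_fun [set: 'rV[R]_m] (fun y => \1_S y * F y).
  by apply: measurable_funM => //; exact: measurable_indic.
have H2 v : `|\1_S v * F v| <= Num.max 0 C.
  rewrite indicE; case: (boolP (v \in S)) => vS /=.
    by rewrite mul1r le_max FC ?orbT//; exact: set_mem.
  by rewrite mul0r normr0 le_max lexx.
have H3 v : \1_S v * F v != 0 -> cube 0 M v.
  rewrite indicE; case: (boolP (v \in S)) => vS /=.
    by move=> _; apply: SM; exact: set_mem.
  by rewrite mul0r eqxx.
move=> /(_ H1 H2 H3) E; rewrite -[LHS]/(fine _%:E) E /Rintegral; congr fine.
rewrite [RHS]integral_mkcond; apply: eq_integral => v _.
rewrite patchE indicE; case: ifP => vS /=; by rewrite ?mul1r ?mul0r.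
Qed.

Lemma Rintegral_indic S A : measurable S -> measurable A ->
  \int[vol m]_(y in S) \1_A y = rvol (S `&` A).
Proof. by move=> mS mA; rewrite /Rintegral integral_indic// setIC. Qed.

(** The two conclusions go together because additivity at each stage needs the integrability of the
    partial sum. *)
Lemma Rintegral_sum S (I : Type) (s : seq I) (F : I -> 'rV[R]_m -> R) : measurable S ->
  (forall i, (vol m).-integrable S (EFin \o F i)) ->
  \int[vol m]_(y in S) (\sum_(i <- s) F i y) = \sum_(i <- s) \int[vol m]_(y in S) F i y
  /\ (vol m).-integrable S (EFin \o (fun y => \sum_(i <- s) F i y)).
Proof.
move=> mS iF; elim: s => [|i s [IH iS]].
  rewrite big_nil; under eq_Rintegral do rewrite big_nil.
  split; first by rewrite Rintegral_cst// mul0r.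
  under [X in _.-integrable _ X]funext do rewrite /= big_nil.
  exact: integrable0.
have E : EFin \o (fun y => \sum_(j <- i :: s) F j y) =
    (EFin \o F i) \+ (EFin \o (fun y => \sum_(j <- s) F j y)).
  by apply/funext => y; rewrite /= big_cons.
split; last by rewrite E; exact: integrableD.
rewrite big_cons -IH -RintegralD//.
by apply: eq_Rintegral => y _; rewrite big_cons.
Qed.

Lemma rvol_gt0_nonempty S : 0 < rvol S -> S !=set0.
Proof.
by move=> V0; apply/set0P; apply: contraTneq V0 => ->; rewrite /rvol measure0 ltxx.
Qed.

Variables (S : set 'rV[R]_m) (M : R).
Hypotheses (mS : measurable S) (SM : S `<=` cube 0 M) (V0 : 0 < rvol S).
Local Notation yc := (center_of_gravity S).

Lemma integrable_affine (g : 'rV[R]_m) (c : R) :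
  (vol m).-integrable S (EFin \o (fun y => dotv g y + c)).
Proof.
have [K HK] := dotv_cube_bound g M.
apply: (@integrable_on_bounded _ _ M (K + `|c|)) => //.
  by apply: measurable_funD => //; exact: measurable_dotv.
move=> v /SM /HK H; apply: (le_trans (ler_normD _ _)); exact: lerD.
Qed.

Lemma Rintegral_dotv (g : 'rV[R]_m) :
  \int[vol m]_(y in S) dotv g y = rvol S * dotv g yc.
Proof.
have ic i : (vol m).-integrable S (EFin \o (fun y : 'rV[R]_m => y 0 i)).
  apply: (@integrable_on_bounded _ _ M M) => //; first exact: measurable_coord.
  by move=> v /SM /(_ i); rewrite mxE subr0.
have vE : rV_integral (\1_S : 'rV[R]_m -> R) = rvol S.
  have := @rV_integral_indicM S (fun=> 1) M 1 mS SM (measurable_cst _) (fun _ _ => (ltac:(by rewrite normr1))).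
  rewrite Rintegral_cst// mul1r -/(rvol S) => <-; congr rV_integral; apply/funext => y.
  by rewrite mulr1.
have cE i : yc 0 i = (rvol S)^-1 * \int[vol m]_(y in S) y 0 i.
  rewrite !mxE vE; congr (_ * _).
  apply: (@rV_integral_indicM S _ M M) => //; first exact: measurable_coord.
  by move=> v /SM /(_ i); rewrite mxE subr0.
rewrite /dotv (proj1 (@Rintegral_sum S _ _ (fun i y => g 0 i * y 0 i) mS _)); last first.
  move=> i; rewrite (_ : _ \o _ = (fun y => (g 0 i)%:E * (EFin \o (fun y : 'rV[R]_m => (y 0 i)%R)) y)%E)//.
  exact: integrableZl.
rewrite mulr_sumr; apply: eq_bigr => i _; rewrite RintegralZl//.
by rewrite cE [RHS]mulrCA (mulrA (rvol S)) divff ?gt_eqF// mul1r.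
Qed.

Lemma Rintegral_centered (g : 'rV[R]_m) :
  \int[vol m]_(y in S) dotv g (y - yc) = 0.
Proof.
under eq_Rintegral do rewrite dotvDr.
rewrite RintegralD//; last first.
- apply: (@integrable_on_bounded _ _ M (`|dotv g (- yc)|)) => //.
- have := integrable_affine g 0; rewrite (_ : EFin \o _ = EFin \o dotv g)//.
  by apply/funext => y; rewrite /= addr0.
by rewrite Rintegral_cst// Rintegral_dotv dotvNr mulNr mulrC subrr.
Qed.

(** The form in which the centroid property is used: membership in S and the half-space bound are
    both obtained by contradicting it. *)
Lemma Rintegral_le_centered (g : 'rV[R]_m) (F : 'rV[R]_m -> R) :
  (vol m).-integrable S (EFin \o F) ->
  (forall y, S y -> dotv g (y - yc) <= F y) -> 0 <= \int[vol m]_(y in S) F y.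
Proof.
move=> iF gF; rewrite -(Rintegral_centered g); apply: le_Rintegral => //.
have := integrable_affine g (- dotv g yc).
rewrite (_ : EFin \o _ = EFin \o (fun y => dotv g (y - yc)))//.
by apply/funext => y; rewrite /= dotvDr dotvNr.
Qed.

(** Otherwise a separating linear function, centered at [yc], is at most - e throughout S although
    its integral vanishes. *)
Lemma center_of_gravity_in : compact S -> vconvex S -> S yc.
Proof.
move=> cS vS; have [//|nS] := pselect (S yc).
have [g [e e0 H]] := min_dist_dotv (rvol_gt0_nonempty V0) cS vS nS.
have : 0 <= \int[vol m]_(y in S) (- e).
  apply: (Rintegral_le_centered (g := g)) => //.
  exact: (@integrable_on_bounded _ _ M `|- e|).
by rewrite Rintegral_cst// nmulr_rge0 ?oppr_lt0// leNgt V0.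
Qed.

Section halfspace.
Hypothesis cS : vconvex S.
Variable g : 'rV[R]_m.
Hypothesis g0 : g != 0.

Let Y y := dotv g (y - yc).
Let cut s := S `&` [set y | s < Y y].

Let measurable_Y : measurable_fun [set: 'rV[R]_m] Y.
Proof.
rewrite (_ : Y = fun y => dotv g y - dotv g yc).
  by apply: measurable_funB => //; exact: measurable_dotv.
by apply/funext => y; rewrite /Y dotvDr dotvNr.
Qed.

Let measurable_gt s : measurable [set y | s < Y y].
Proof.
rewrite (_ : mkset _ = Y @^-1` `]s, +oo[%classic).
  by rewrite -[X in measurable X]setTI; exact: measurable_Y.
by apply/seteqP; split => y; rewrite /= in_itv /= andbT.
Qed.

Let measurable_cut s : measurable (cut s).
Proof. exact: measurableI. Qed.

Let cutM s : cut s `<=` cube 0 M.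
Proof. by move=> y [/SM]. Qed.

Let t s := rvol (cut s).

Let t_ge0 s : 0 <= t s.
Proof. exact: rvol_ge0. Qed.

Let t_decr s s' : s <= s' -> t s' <= t s.
Proof.
by move=> ss'; apply: (@le_rvol _ _ _ _ M) => // y [Sy h]; split => //; apply: le_lt_trans h.
Qed.

Let t_logconcave s s' : t s * t s' <= t (2^-1 * (s + s')) ^+ 2.
Proof.
have Yc x y th : Y (th *: x + (1 - th) *: y) = th * Y x + (1 - th) * Y y.
  rewrite /Y (_ : _ - yc = th *: (x - yc) + (1 - th) *: (y - yc)).
    by rewrite dotvDr !dotvZr.
  by apply/rowP => i; rewrite !mxE; ring.
have cc u : vconvex (cut u).
  move=> x y th [Sx ux] [Sy uy] th01; split; first exact: cS.
  rewrite /= Yc; move/andP: th01 => [th0 th1].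
  have [->|th0'] := eqVneq th 0; first by rewrite subr0 mul0r mul1r add0r.
  have A : th * u < th * Y x by rewrite ltr_pM2l// lt_def th0'.
  have B : (1 - th) * u <= (1 - th) * Y y by rewrite ler_wpM2l ?subr_ge0// ltW.
  lra.
apply: (@rvol_midpoint _ _ _ _ _ M) => // a b [Sa sa] [Sb sb].
have -> : 2^-1 *: (a + b) = 2^-1 *: a + (1 - 2^-1) *: b.
  by rewrite (_ : 1 - 2^-1 = 2^-1) ?scalerDr//; lra.
have h01 : 0 <= (2^-1 : R) <= 1 by rewrite invr_ge0 ler0n invf_le1// ler1n.
split; first exact: cS.
by rewrite /= Yc (_ : 1 - 2^-1 = 2^-1) -?mulrDr ?ltr_pM2l ?invr_gt0// ?ltrD//; lra.
Qed.

Let V := rvol S.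

Let rvol_Y_ge0 : rvol (S `&` [set y | 0 <= Y y]) = t 0.
Proof.
have H : vol m [set y | Y y = 0] = 0%E.
  rewrite -(vol_hyperplane (dotv g yc) g0); congr (vol m _).
  by apply/seteqP; split => y; rewrite /= /Y dotvDr dotvNr; lra.
rewrite /t /rvol; congr fine.
have mH : measurable [set y | Y y = 0].
  rewrite (_ : mkset _ = Y @^-1` [set 0]); last by apply/seteqP; split.
  by rewrite -[X in measurable X]setTI; exact: measurable_Y.
have E : S `&` [set y | 0 <= Y y] = cut 0 `|` (S `&` [set y | Y y = 0]).
  apply/seteqP; split => y /=.
    by move=> [Sy]; rewrite le_eqVlt => /orP[/eqP <-|h]; [right|left].
  by move=> [[Sy /ltW]|[Sy ->]].
rewrite E measureU0//; first exact: measurableI.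
by apply: subset_measure0 H => //; exact: measurableI.
Qed.

(** Left continuity at 0: the cuts at heights - 1 / (k + 1) decrease to the closed half-space, which
    has the same volume in S as the open one. It provides the initial length for the doubling
    below. *)
Let t_left : t 0 < V / 2 -> exists2 d, 0 < d & t (- d) <= V / 2.
Proof.
move=> tV.
pose B k := S `&` [set y | - (k.+1%:R^-1 : R) < Y y].
have BE : \bigcap_k B k = S `&` [set y | 0 <= Y y].
  apply/seteqP; split => y.
    move=> H; have Sy := (H 0%N I).1; split => //=.
    rewrite leNgt; apply/negP => Yy.
    have Yy' : 0 < - Y y by rewrite oppr_gt0.
    have [k _ kP] := near_infty_natSinv_lt (PosNum Yy').
    have h1 : (k.+1%:R^-1 : R) < - Y y := kP k (leqnn _).
    by have [_ /= h2] := H k I; move: h1; rewrite ltrNr => /(lt_trans h2); rewrite ltxx.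
  move=> [Sy Yy] k _; split => //=; apply: lt_le_trans Yy.
  by rewrite oppr_lt0 invr_gt0.
have mB k : measurable (B k) by exact: measurable_cut.
have cv : vol m (B k) @[k --> \oo] --> vol m (\bigcap_k B k).
  apply: nonincreasing_cvg_mu => //.
  - by have [E _] := vol_bounded (mB 0%N) (@cutM _); move: (ltry (rvol (B 0%N))); rewrite -E.
  - by apply: bigcapT_measurable.
  - apply/nonincreasing_seqP => k; apply/subsetPset => y [Sy /= h]; split => //=.
    by apply: le_lt_trans h; rewrite lerN2 lef_pV2 ?posrE// ler_nat.
rewrite BE in cv.
have mY0 : measurable (S `&` [set y | 0 <= Y y]).
  by rewrite -BE; exact: bigcapT_measurable.
have [E0 _] := vol_bounded mY0 (fun y (h : (S `&` [set y | 0 <= Y y]) y) => SM h.1).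
rewrite E0 rvol_Y_ge0 in cv.
have cv' : rvol (B k) @[k --> \oo] --> t 0.
  exact: (fine_cvg cv).
have [k _ kP] : \forall k \near \oo, rvol (B k) < V / 2.
  by apply: (cvgr_lt (t 0)).
exists (k.+1%:R^-1); first by rewrite invr_gt0.
by apply: ltW; exact: (kP k (leqnn _)).
Qed.

(* A weak form of Gruenbaum's inequality.  If t 0 < V / 6, there is d > 0 with
   t (- d) > V / 2 >= t (- (d / 2)).  By log-concavity t drops by a factor 3 on
   each further interval of length d, and integrating the step function
   G >= Y over S then contradicts the vanishing of the integral of Y. *)
Lemma rvol_halfspace : V <= 6 * t 0.
Proof.
rewrite leNgt; apply/negP => q6.
have V0' : 0 < V := V0.
have [|d0 d0p td0] := t_left; first by lra.
have [K HK] : exists K, forall y, S y -> `|Y y| <= K.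
  have [K HK] := dotv_cube_bound g M.
  exists (K + `|dotv g yc|) => y /SM /HK H; rewrite /Y dotvDr dotvNr.
  by apply: (le_trans (ler_normB _ _)); exact: lerD.
have big : exists k : nat, K < 2 ^+ k * d0.
  have [k Hk] : exists k : nat, K / d0 < k%:R.
    by exists (Num.truncn (K / d0)).+1; exact: truncnS_gt.
  exists k; rewrite -ltr_pdivrMr//; apply: (lt_le_trans Hk).
  by rewrite -natrX ler_nat ltnW// ltn_expl.
(* The length d0 is doubled until the tail exceeds V / 2. The least exponent gives a d for which
   this holds at - d but not yet at - (d / 2). *)
have ex : exists k : nat, V / 2 < t (- (2 ^+ k * d0)).
  have [k Hk] := big; exists k.
  have -> : t (- (2 ^+ k * d0)) = V.
    rewrite /t (_ : cut _ = S)//; apply/seteqP; split => y; first by case.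
    move=> Sy; split => //=; have := HK y Sy; rewrite ler_norml => /andP[h _].
    by apply: lt_le_trans h; rewrite ltrN2.
  lra.
have [k0 k0P k0min] := ex_minnP ex.
have k00 : (0 < k0)%N.
  by rewrite lt0n; apply: contraTneq k0P => ->; rewrite expr0 mul1r -leNgt.
pose d := 2 ^+ k0 * d0.
have dp : 0 < d by rewrite mulr_gt0// exprn_gt0.
have td : V / 2 < t (- d) by [].
have td2 : t (- (d / 2)) <= V / 2.
  rewrite leNgt; apply/negP => h.
  have E : d / 2 = 2 ^+ k0.-1 * d0 by rewrite /d -{1}(prednK k00) exprS; field.
  have := k0min k0.-1; rewrite -E => /(_ h).
  by rewrite leqNgt -ltnS prednK// ltnSn.
(* For k = 0 the ratio 1/3 comes from t 0 < V / 6 and t (- d) > V / 2; log-concavity makes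
   successive ratios nonincreasing. A vanishing tail stays zero by monotonicity. *)
have step (k : nat) : t (k%:R * d) <= 3^-1 * t ((k%:R - 1) * d).
  elim: k => [|k IH]; first by rewrite mul0r sub0r mulN1r; lra.
  have L := t_logconcave ((k%:R - 1) * d) (k.+1%:R * d).
  have E : 2^-1 * ((k%:R - 1) * d + k.+1%:R * d) = k%:R * d by rewrite -natr1; field.
  have E2 : (k.+1%:R - 1) * d = k%:R * d by rewrite -natr1; ring.
  rewrite E in L; rewrite E2.
  have [a0|a0] := eqVneq (t ((k%:R - 1) * d)) 0.
    have D1 : t (k%:R * d) <= t ((k%:R - 1) * d) by apply: t_decr; rewrite ler_wpM2r ?(ltW dp)//; lra.
    have D2 : t (k.+1%:R * d) <= t (k%:R * d) by apply: t_decr; rewrite ler_wpM2r ?(ltW dp)// ler_nat.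
    have := t_ge0 (k%:R * d); lra.
  have a0' : 0 < t ((k%:R - 1) * d) by rewrite lt_def a0 t_ge0.
  rewrite -(ler_pM2l a0'); apply: (le_trans L).
  have := t_ge0 (k%:R * d); nra.
(* Geometric series of ratio 1/3 and sum 3/2; the remainder on the left closes the induction. *)
have sum (N : nat) : \sum_(k < N) t (k%:R * d) + 3 / 2 * t (N%:R * d) <= 3 / 2 * t 0.
  elim: N => [|N IH]; first by rewrite big_ord0 mul0r add0r.
  rewrite big_ord_recr /=; have := step N.+1.
  have -> : (N.+1%:R - 1) * d = N%:R * d by rewrite -natr1; ring.
  lra.
have [N HN] : exists N : nat, K <= N%:R * d.
  exists (Num.truncn (K / d)).+1; rewrite -ler_pdivrMr//; apply: ltW; exact: truncnS_gt.
have count (n : nat) (y : R) : y <= n%:R * d -> 0 < y ->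
    y <= d * \sum_(k < n) (k%:R * d < y)%R%:R.
  elim: n => [|n IH]; first by rewrite mul0r => h /lt_le_trans/(_ h); rewrite ltxx.
  move=> yn y0; rewrite big_ord_recr /=; have [h|h] := ltP (n%:R * d) y.
    rewrite (eq_bigr (fun=> 1)) => [|i _].
      by rewrite sumr_const card_ord -[_ *+ n]/(n%:R) natr1 mulrC.
    by rewrite (le_lt_trans _ h)// ler_wpM2r ?(ltW dp)// ler_nat ltnW.
  by rewrite addr0; exact: IH.
pose D := [set y | Y y <= - (d / 2)].
have mD : measurable D.
  rewrite (_ : D = ~` [set y | - (d / 2) < Y y]); first exact: measurableC.
  by apply/seteqP; split => y; rewrite /D /= leNgt => /negP.
(* On S, G is Y rounded up to a multiple of d where Y > 0, - d / 2 where Y <= - d / 2, and 0 in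
   between. *)
pose G y := d * (\sum_(k < N) \1_[set y | k%:R * d < Y y] y) - d / 2 * \1_D y.
have YG y : S y -> Y y <= G y.
  move=> Sy; rewrite /G.
  have E (k : nat) : (\1_[set y | k%:R * d < Y y] y : R) = (k%:R * d < Y y)%R%:R.
    by rewrite indicE; congr (_%:R); congr nat_of_bool; apply/idP/idP; rewrite inE.
  under eq_bigr do rewrite E.
  have ED : (\1_D y : R) = (Y y <= - (d / 2))%R%:R.
    by rewrite indicE; congr (_%:R); congr nat_of_bool; apply/idP/idP; rewrite inE.
  rewrite ED; have [Y0|Y0] := ltP 0 (Y y).
    have /negbTE -> : ~~ (Y y <= - (d / 2)) by rewrite -ltNge; lra.
    rewrite mulr0 subr0; apply: count => //.
    by apply: le_trans HN; have := HK y Sy; rewrite ler_norml => /andP[].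
  rewrite big1 => [|k _]; last first.
    have /negbTE -> // : ~~ (k%:R * d < Y y).
    by rewrite -leNgt; apply: (le_trans Y0); rewrite mulr_ge0// ltW.
  rewrite mulr0 sub0r; case: (leP (Y y) (- (d / 2))) => h; rewrite ?mulr1 ?mulr0; lra.
have iI (A : set 'rV[R]_m) : measurable A -> (vol m).-integrable S (EFin \o (\1_A : 'rV[R]_m -> R)).
  move=> mA; apply: (@integrable_on_bounded _ _ M 1) => //.
  by move=> v _; rewrite indicE ger0_norm// lern1 leq_b1.
have [EI II] := @Rintegral_sum S _ (index_enum 'I_N)
   (fun k => \1_[set y | k%:R * d < Y y]) mS (fun k => iI _ (measurable_gt _)).
have iZ (c : R) F : (vol m).-integrable S (EFin \o F) -> (vol m).-integrable S (EFin \o (fun y => c * F y)).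
  by move=> iF; exact: (integrableZl mS c iF).
have iG1 := iZ d _ II; have iG2 := iZ (d / 2) _ (iI _ mD).
have iG : (vol m).-integrable S (EFin \o G) by exact: (integrableB mS iG1 iG2).
have := Rintegral_le_centered iG YG.
rewrite RintegralB// RintegralZl// RintegralZl//; last exact: iI.
rewrite EI (eq_bigr (fun k : 'I_N => t (k%:R * d))) => [|k _]; last first.
  by rewrite Rintegral_indic.
rewrite Rintegral_indic//.
have VD : V - V / 2 <= rvol (S `&` D).
  have : V = t (- (d / 2)) + rvol (S `&` D).
    have [E1 _] := vol_bounded mS SM.
    have [E2 _] := vol_bounded (measurable_cut (- (d / 2))) (@cutM _).
    have mSD : measurable (S `&` D) by exact: measurableI.
    have [E3 _] := vol_bounded mSD (fun y h => SM h.1).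
    apply: EFin_inj; rewrite EFinD -E1 -E2 -E3 -measureU//.
      congr (vol m _); apply/seteqP; split => y.
        by move=> Sy; rewrite /D /=; case: (leP (Y y) (- (d / 2))) => h; [right|left].
      by move=> [[]|[]].
    apply/seteqP; split => // y [[_ /= h1] [_]]; by rewrite /D /= leNgt h1.
  by move=> EV; have := td2; lra.
have := sum N; have := t_ge0 (N%:R * d).
(* The integral of G is at most d * (3/2 * t 0 - V / 4), which is negative exactly because t 0 < V /
   6. *)
set sg := \sum_(k < N) _ => h1 h2 h3.
have h4 : d * sg <= d * (3 / 2 * t 0) by rewrite ler_pM2l//; lra.
have h5 : d / 2 * (V - V / 2) <= d / 2 * rvol (S `&` D) by rewrite ler_pM2l ?divr_gt0.
have h6 : d * (3 / 2 * t 0) < d * (V / 4) by rewrite ltr_pM2l//; lra.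
lra.
Qed.

End halfspace.

(** The half-space bound for - g says that at least a sixth of S is discarded. *)
Lemma rvol_cut (g : 'rV[R]_m) : vconvex S -> g != 0 ->
  rvol (S `&` [set y | 0 <= dotv g (y - yc)]) <= 5 / 6 * rvol S.
Proof.
move=> cS g0; have := rvol_halfspace cS (g := - g); rewrite oppr_eq0 => /(_ g0).
set P := S `&` _ => H.
set Q := S `&` _.
have mg : measurable [set y | 0 <= dotv g (y - yc)].
  rewrite (_ : mkset _ = (fun y => dotv g y) @^-1` `[dotv g yc, +oo[%classic).
    by rewrite -[X in measurable X]setTI; exact: measurable_dotv.
  by apply/seteqP; split => y; rewrite /= in_itv /= andbT dotvDr dotvNr subr_ge0.
have QE : Q = S `&` [set y | 0 <= dotv g (y - yc)] by [].
have PE : P = S `&` ~` [set y | 0 <= dotv g (y - yc)].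
  apply/seteqP; split => y /= [Sy h]; split => //; move: h.
    by rewrite /= dotvNl oppr_gt0 ltNge => /negP.
  by move=> /negP; rewrite -ltNge /= dotvNl oppr_gt0.
have mP : measurable P by rewrite PE; apply: measurableI => //; exact: measurableC.
have mQ : measurable Q by exact: measurableI.
have [E1 _] := vol_bounded mS SM.
have [E2 _] := vol_bounded mP (fun y h => SM h.1).
have [E3 _] := vol_bounded mQ (fun y h => SM h.1).
have : rvol S = rvol P + rvol Q.
  apply: EFin_inj; rewrite EFinD -E1 -E2 -E3 -measureU//.
    by congr (vol m _); rewrite PE QE -setIUr setUC setUCr setIT.
  by rewrite PE QE setIACA setIid setICl setI0.
lra.
Qed.

End centroid.

(** * The accelerated block *)

Section smooth_convex.
Context {R : realType} {n : nat}.
Variables (X : set 'rV[R]_n) (F : 'rV[R]_n -> R) (G : 'rV[R]_n -> 'rV[R]_n).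
Variables (mu L : R).
Hypotheses (vX : vconvex X) (mu0 : 0 < mu) (muL : mu <= L).
Hypotheses (scF : strongly_convex_on X mu F) (smF : smooth_on X L F G).

Lemma le_add_eps_mul (x y c : R) : 0 <= c -> (forall e, 0 < e -> x <= y + e * c) -> x <= y.
Proof.
move=> c0 H; rewrite leNgt; apply/negP => yx.
have c1 : 0 < c + 1 by lra.
have e0 : 0 < (x - y) / (2 * (c + 1)) by rewrite divr_gt0 ?mulr_gt0 ?subr_gt0.
have := H _ e0; set e := _ / _ in e0 *.
have E : e * (2 * (c + 1)) = x - y by rewrite /e divfK// gt_eqF ?mulr_gt0.
nra.
Qed.

Lemma strong_gradient x y : X x -> X y ->
  F x + dotv (G x) (y - x) + mu / 2 * dotv (y - x) (y - x) <= F y.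
Proof.
move=> Xx Xy; set D := enorm (y - x).
have D0 : 0 <= D := enorm_ge0 _.
apply: (@le_add_eps_mul _ _ (D + mu / 2 * D ^+ 2)).
  by rewrite addr_ge0// mulr_ge0 ?sqr_ge0// ltW// divr_gt0.
move=> e e0.
have [d d0 Hd] := (proj1 smF) x Xx e e0.
(* The bound on t * D makes the first-order expansion at x valid with error e; t <= e absorbs the
   factor 1 - t of strong convexity. *)
have [t [t0 t1 te td]] : exists t, [/\ 0 < t, t <= 1, t <= e & t * D < d].
  have D1 : 0 < D + 1 by lra.
  exists (Num.min 1 (Num.min e (d / (D + 1)))).
  rewrite !lt_min !ge_min lexx lexx !orbT ltr01 e0 divr_gt0//; split => //.
  apply: (@le_lt_trans _ _ (d / (D + 1) * D)).
    by apply: ler_wpM2r => //; rewrite !ge_min lexx !orbT.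
  by rewrite mulrAC ltr_pdivrMr// ltr_pM2l//; lra.
have t01 : 0 <= t <= 1 by rewrite (ltW t0).
have Xz := vX Xy Xx t01.
set z := t *: y + (1 - t) *: x in Xz.
have zx : z - x = t *: (y - x) by apply/rowP => i; rewrite !mxE; ring.
have := Hd z Xz; rewrite zx enormZ (ger0_norm (ltW t0)) -/D => /(_ td).
rewrite ler_norml => /andP[h1 _].
have := scF Xy Xx t01; rewrite -/z -/D => h2.
rewrite dotvZr in h1; rewrite -enorm_sqr -/D.
rewrite -(ler_pM2l t0).
have h3 : t * (mu / 2 * t * D ^+ 2) <= t * (mu / 2 * e * D ^+ 2).
  rewrite ler_pM2l// ler_wpM2r ?sqr_ge0// ler_wpM2l// ltW// divr_gt0//.
set P := dotv _ _ in h1 *.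
have E2 : mu / 2 * t * (1 - t) * D ^+ 2 = t * (mu / 2 * D ^+ 2) - t * (mu / 2 * t * D ^+ 2) by ring.
lra.
Qed.

Lemma convex_gradient x y : X x -> X y -> F x + dotv (G x) (y - x) <= F y.
Proof.
move=> Xx Xy; apply: le_trans (strong_gradient Xx Xy).
by rewrite lerDl mulr_ge0 ?dotv_ge0// ltW// divr_gt0.
Qed.

(* Telescoping the gradient inequality along a subdivision of [x, u]. *)
Lemma descent x u : X x -> X u ->
  F u <= F x + dotv (G x) (u - x) + L / 2 * dotv (u - x) (u - x).
Proof.
move=> Xx Xu; set d := u - x; set D := dotv d d.
have D0 : 0 <= D := dotv_ge0 _.
have L0 : 0 < L := lt_le_trans mu0 muL.
have c0 : 0 <= L / 2 * D by rewrite mulr_ge0// ltW// divr_gt0.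
apply: (le_add_eps_mul c0) => e e0.
have [N N0 Ne] : exists2 N : nat, (0 < N)%N & N%:R^-1 <= e.
  exists (Num.truncn e^-1).+1 => //.
  by rewrite invf_ple ?posrE//; apply: ltW; exact: truncnS_gt.
have N0' : 0 < N%:R :> R by rewrite ltr0n.
pose p (k : nat) := x + (k%:R / N%:R) *: d.
have Xp k : (k <= N)%N -> X (p k).
  move=> kN.
  have -> : p k = (k%:R / N%:R) *: u + (1 - k%:R / N%:R) *: x.
    by rewrite /p /d; apply/rowP => i; rewrite !mxE; ring.
  by apply: vX => //; rewrite divr_ge0 ?ler0n//= ler_pdivrMr// mul1r ler_nat.
(* Each increment is bounded with the gradient at its right endpoint, so the Lipschitz errors add up
   to k (k + 1) / 2 units; the excess over k ^ 2 / 2 vanishes as N grows. *)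
have H k : (k <= N)%N ->
    F (p k) <= F x + k%:R / N%:R * dotv (G x) d + L * D * (k%:R * k.+1%:R) / (2 * N%:R ^+ 2).
  elim: k => [|k IH] kN.
    by rewrite /p !mul0r scale0r !addr0 mulr0 mul0r addr0.
  have Xk := Xp _ (ltnW kN); have Xk1 := Xp _ kN.
  have := convex_gradient Xk1 Xk.
  have -> : p k - p k.+1 = - (N%:R^-1 *: d).
    rewrite /p -natr1; apply/rowP => i; rewrite !mxE; ring.
  rewrite dotvNr dotvZr => h1.
  have h2 : dotv (G (p k.+1) - G x) d <= L * (k.+1%:R / N%:R) * D.
    apply: (le_trans (dotv_cauchy _ _)).
    have h3 := (proj2 smF) _ _ Xk1 Xx.
    have E : enorm (p k.+1 - x) = k.+1%:R / N%:R * enorm d.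
      by rewrite /p addrAC subrr add0r enormZ ger0_norm// divr_ge0 ?ler0n.
    rewrite E in h3; apply: (le_trans (ler_wpM2r (enorm_ge0 d) h3)).
    by rewrite /D -enorm_sqr expr2 !mulrA.
  rewrite dotvDl dotvNl in h2.
  have h4 : N%:R^-1 * dotv (G (p k.+1)) d <=
      N%:R^-1 * (dotv (G x) d + L * (k.+1%:R / N%:R) * D).
    by rewrite ler_pM2l ?invr_gt0//; lra.
  have {}IH := IH (ltnW kN).
  have E1 : k.+1%:R / N%:R * dotv (G x) d =
     k%:R / N%:R * dotv (G x) d + N%:R^-1 * dotv (G x) d.
    by rewrite -natr1; ring.
  have E2 : L * D * (k.+1%:R * k.+2%:R) / (2 * N%:R ^+ 2) =
     L * D * (k%:R * k.+1%:R) / (2 * N%:R ^+ 2) + N%:R^-1 * (L * (k.+1%:R / N%:R) * D).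
    by rewrite -!natr1; field; rewrite gt_eqF.
  rewrite E1 E2; lra.
have := H N (leqnn _); have -> : p N = u.
  by rewrite /p divff ?gt_eqF// scale1r /d addrC subrK.
rewrite divff ?gt_eqF// mul1r => h.
have E : L * D * (N%:R * N.+1%:R) / (2 * N%:R ^+ 2) = L / 2 * D + N%:R^-1 * (L / 2 * D).
  by rewrite -natr1; field; rewrite gt_eqF.
have := ler_wpM2r c0 Ne; lra.
Qed.

End smooth_convex.

Section block_analysis.
Context {R : realType} {n : nat}.
Variables (X : set 'rV[R]_n) (F : 'rV[R]_n -> R) (G : 'rV[R]_n -> 'rV[R]_n).
Variables (mu L gamma : R) (xbar : 'rV[R]_n).
Hypotheses (X0 : X !=set0) (cX : compact X) (vX : vconvex X).
Hypotheses (mu0 : 0 < mu) (muL : mu <= L) (gamma0 : 0 < gamma) (Xxbar : X xbar).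
Hypotheses (scF : strongly_convex_on X mu F) (smF : smooth_on X L F G).

Local Notation st := (block X G mu L gamma xbar).

(** Closed form of A_K, the sum of (i + 1) gamma / (2 L) for i from 1 to K; it is at least gamma K ^
    2 / (4 L). *)
Definition block_weight (K : nat) : R := gamma * (K%:R * (K%:R + 3)) / (4 * L).

Let L0 : 0 < L. Proof. exact: lt_le_trans mu0 muL. Qed.

Lemma block_A K : b_A (st K) = block_weight K.
Proof.
rewrite /block_weight; elim: K => [|K IH] /=; first by rewrite mul0r mulr0 mul0r.
by rewrite IH -!natr1; field; rewrite gt_eqF.
Qed.

Lemma block_Gamma K : b_Gamma (st K) = gamma + mu * b_A (st K).
Proof. by elim: K => [|K IH] /=; [rewrite mulr0 addr0|rewrite IH; ring]. Qed.

Lemma block_calls K : b_calls (st K) = K.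
Proof. by elim: K => [|K IH] //=; rewrite IH. Qed.

Lemma block_weight_ge0 K : 0 <= block_weight K.
Proof. by rewrite /block_weight divr_ge0 ?mulr_ge0 ?addr_ge0 ?ler0n ?ltW. Qed.

Lemma block_inX K : X (b_u (st K)) /\ X (b_z (st K)).
Proof.
elim: K => [|K [Xu Xz]] //=.
have A0 : 0 <= b_A (st K) by rewrite block_A block_weight_ge0.
set a := K.+2%:R * gamma / (2 * L).
have a0 : 0 < a by rewrite /a divr_gt0 ?mulr_gt0.
have cc x y : X x -> X y -> X ((b_A (st K) + a)^-1 *: (b_A (st K) *: x + a *: y)).
  move=> Xx Xy; have Aa : 0 < b_A (st K) + a by lra.
  have -> : (b_A (st K) + a)^-1 *: (b_A (st K) *: x + a *: y) =
     (b_A (st K) / (b_A (st K) + a)) *: x + (1 - b_A (st K) / (b_A (st K) + a)) *: y.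
    by apply/rowP => i; rewrite !mxE; field; rewrite gt_eqF.
  by apply: vX => //; rewrite divr_ge0 ?(ltW Aa)//= ler_pdivrMr// mul1r lerDl ltW.
set w := proj X _.
have Xw : X w by exact: (proj1 (proj_spec _ X0 cX vX)).
by split => //; exact: cc.
Qed.

(** Optimality of z_K as the minimizer over X of the quadratic [estimate], read off the variational
    inequality of the projection. At K = 0 the vector on the left is zero. *)
Lemma block_opt K x : X x ->
  dotv (b_r (st K) - b_Gamma (st K) *: b_z (st K)) (x - b_z (st K)) <= 0.
Proof.
case: K => [|K] Xx; first by rewrite /= subrr dotv0l.
have G0 : 0 < b_Gamma (st K.+1).
  rewrite block_Gamma block_A.
  by rewrite ltr_pwDl// mulr_ge0 ?block_weight_ge0// ltW.
set Gm := b_Gamma (st K.+1) in G0 *; set r := b_r (st K.+1).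
have -> : b_z (st K.+1) = proj X (Gm^-1 *: r) by [].
have [_ /(_ x Xx)] := proj_spec (Gm^-1 *: r) X0 cX vX.
set z := proj X _ => h.
have -> : r - Gm *: z = Gm *: (Gm^-1 *: r - z).
  by rewrite scalerBr scalerA divff ?scale1r// gt_eqF.
by rewrite dotvZl pmulr_rle0.
Qed.

(* The estimate sequence, kept in the expanded form
   x |-> c - <r, x> + Gamma/2 |x|^2. *)
Let estimate K c x := c - dotv (b_r (st K)) x + b_Gamma (st K) / 2 * dotv x x.

(** Nesterov's invariant: the quadratic minorizes gamma/2 |x - xbar|^2 + A F on X, while its minimum
    over X, reached at z, dominates A F(u). Its constant term is existential because the algorithm
    never stores it. *)
Lemma block_estimate K : exists c,
  (forall x, X x -> estimate K c x <=
     gamma / 2 * dotv (x - xbar) (x - xbar) + b_A (st K) * F x) /\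
  b_A (st K) * F (b_u (st K)) <= estimate K c (b_z (st K)).
Proof.
have subE (x y : 'rV[R]_n) : dotv (x - y) (x - y) = dotv x x - 2 * dotv x y + dotv y y.
  by rewrite -[in LHS](scale1r y) dotv_subZ; ring.
(* Updating r and Gamma amounts to adding a times the strongly convex lower model of F at y. *)
have newE (c a Fi Gm : R) (r g y x : 'rV[R]_n) :
    c + a * (Fi - dotv g y + mu / 2 * dotv y y) -
    dotv (r + a *: (mu *: y - g)) x + (Gm + mu * a) / 2 * dotv x x =
    (c - dotv r x + Gm / 2 * dotv x x) +
    a * (Fi + dotv g (x - y) + mu / 2 * dotv (x - y) (x - y)).
  by rewrite subE !dotvE [dotv y x]dotvC; field.
have optE (Gm : R) (r z z' : 'rV[R]_n) : dotv (r - Gm *: z) (z' - z) =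
    dotv r z' - dotv r z - Gm * dotv z' z + Gm * dotv z z.
  by rewrite !dotvE [dotv z z']dotvC; ring.
elim: K => [|K [c [H1 H2]]].
  exists (gamma / 2 * dotv xbar xbar); rewrite /estimate /=; split.
    by move=> x Xx; rewrite subE !dotvE [dotv xbar x]dotvC; lra.
  by rewrite !dotvE; lra.
have opt := @block_opt K; have [Xu Xz] := block_inX K.
have [Xu' Xz'] := block_inX K.+1.
have A0 : 0 <= b_A (st K) by rewrite block_A block_weight_ge0.
have GmE := block_Gamma K.
(* The step sizes are tuned for L a_i ^ 2 <= gamma A_i, here (K + 2) ^ 2 <= K (K + 3) + 2 (K + 2).
   Since Gamma >= gamma, the curvature of the estimate then pays for the descent error. *)
have aA : L * (K.+2%:R * gamma / (2 * L)) ^+ 2 <=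
   gamma * (b_A (st K) + K.+2%:R * gamma / (2 * L)).
  rewrite block_A /block_weight.
  have -> : L * (K.+2%:R * gamma / (2 * L)) ^+ 2 = gamma ^+ 2 / (4 * L) * K.+2%:R ^+ 2.
    by field; rewrite gt_eqF.
  have -> : gamma * (gamma * (K%:R * (K%:R + 3)) / (4 * L) + K.+2%:R * gamma / (2 * L)) =
     gamma ^+ 2 / (4 * L) * (K%:R * (K%:R + 3) + 2 * K.+2%:R).
    by field; rewrite gt_eqF.
  rewrite ler_wpM2l ?divr_ge0 ?mulr_ge0 ?(ltW L0) ?exprn_ge0 ?(ltW gamma0)//.
  by rewrite -!natr1; have := ler0n R K; nra.
move: Xu' Xz'; rewrite /estimate /=.
set A := b_A (st K) in H1 H2 GmE A0 aA *; set Gm := b_Gamma (st K) in opt GmE *.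
set u := b_u (st K) in H2 Xu *; set z := b_z (st K) in H2 opt Xz *.
set r := b_r (st K) in opt *.
set a := K.+2%:R * gamma / (2 * L) in aA *.
have a0 : 0 < a by rewrite /a divr_gt0 ?mulr_gt0.
set xi := _^-1 *: (_ *: u + a *: z).
set z' := proj X _; set u' := _^-1 *: (_ *: u + a *: z') => Xu' Xz'.
have Aa : 0 < A + a by lra.
have Xxi : X xi.
  have -> : xi = (A / (A + a)) *: u + (1 - A / (A + a)) *: z.
    by apply/rowP => i; rewrite !mxE; field; rewrite gt_eqF.
  by apply: vX => //; rewrite divr_ge0 ?(ltW Aa)//= ler_pdivrMr// mul1r lerDl ltW.
set g := G xi.
exists (c + a * (F xi - dotv g xi + mu / 2 * dotv xi xi)).
have new x := newE c a (F xi) Gm r g xi x.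
split.
  move=> x Xx; rewrite new.
  have := H1 x Xx; rewrite /estimate -/r -/Gm => h1.
  have := strong_gradient vX mu0 scF smF Xxi Xx; rewrite -/g => h2.
  have := ler_wpM2l (ltW a0) h2; lra.
rewrite new.
have o := opt _ Xz'.
have h1 : A * F u + Gm / 2 * dotv (z' - z) (z' - z) <= c - dotv r z' + Gm / 2 * dotv z' z'.
  move: H2; rewrite /estimate -/r -/Gm => H2.
  move: o; rewrite subE optE; lra.
have h2 : a * (F xi + dotv g (z' - xi)) <=
   a * (F xi + dotv g (z' - xi) + mu / 2 * dotv (z' - xi) (z' - xi)).
  by rewrite ler_pM2l// lerDl mulr_ge0 ?dotv_ge0// ltW// divr_gt0.
have h3 := convex_gradient vX mu0 scF smF Xxi Xu.
have h3' := ler_wpM2l A0 h3.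
have h4 := descent vX mu0 muL scF smF Xxi Xu'.
have h4' := ler_wpM2l (ltW Aa) h4.
(* [u'] and [xi] mix the same [u] with [z'] and [z] respectively, so the descent error is quadratic
   in [z' - z]. *)
have ux : u' - xi = (a / (A + a)) *: (z' - z).
  by apply/rowP => i; rewrite !mxE; field; rewrite gt_eqF.
have lin : A * dotv g (u - xi) + a * dotv g (z' - xi) = (A + a) * dotv g (u' - xi).
  rewrite -!dotvZr -dotvDr; congr dotv.
  by apply/rowP => i; rewrite !mxE; field; rewrite gt_eqF.
set D := dotv (z' - z) (z' - z) in h1.
have D0 : 0 <= D := dotv_ge0 _.
have quad : (A + a) * (L / 2 * dotv (u' - xi) (u' - xi)) <= Gm / 2 * D.
  rewrite ux dotvZl dotvZr -/D.
  have -> : (A + a) * (L / 2 * (a / (A + a) * (a / (A + a) * D))) =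
     (L * a ^+ 2) / (2 * (A + a)) * D by field; rewrite gt_eqF.
  apply: ler_wpM2r => //; rewrite ler_pdivrMr ?mulr_gt0//.
  rewrite GmE; have := mulr_ge0 (mulr_ge0 (ltW mu0) A0) (ltW Aa); nra.
rewrite -/g in h3 h3' h4 h4'.
lra.
Qed.

(** The estimate has curvature [b_Gamma] and its constrained minimum at z, so at x it exceeds that
    minimum by at least the quadratic term on the left. *)
Lemma block_bound K x : X x ->
  b_A (st K) * F (b_u (st K)) +
    (gamma + mu * b_A (st K)) / 2 * dotv (x - b_z (st K)) (x - b_z (st K)) <=
  gamma / 2 * dotv (x - xbar) (x - xbar) + b_A (st K) * F x.
Proof.
move=> Xx; have [c [/(_ x Xx) H1 H2]] := block_estimate K.
have := block_opt K Xx; rewrite -block_Gamma.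
move: H1 H2; rewrite /estimate.
set z := b_z _; set r := b_r _; set Gm := b_Gamma _ => H1 H2 o.
have E : dotv (x - z) (x - z) = dotv x x - 2 * dotv x z + dotv z z.
  by rewrite -[in LHS](scale1r z) dotv_subZ; ring.
have o' : dotv r x - dotv r z - Gm * dotv x z + Gm * dotv z z <= 0.
  by move: o; rewrite !dotvE [dotv z x]dotvC; lra.
rewrite E; lra.
Qed.

End block_analysis.

(** * The initialization runs *)

Section reals.
Context {R : realType}.
Implicit Types t : R.

Lemma ceil_nat_ge t : 0 <= t -> t <= (ceil_nat t)%:R.
Proof.
move=> t0; rewrite /ceil_nat; have c0 : 0 <= Num.ceil t by rewrite ceil_ge0 (lt_le_trans _ t0)// ltrN10.
by rewrite natr_absz ger0_norm// ceil_ge.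
Qed.

Lemma ceil_nat_lt t : 0 <= t -> (ceil_nat t)%:R < t + 1.
Proof.
move=> t0; rewrite /ceil_nat; have c0 : 0 <= Num.ceil t by rewrite ceil_ge0 (lt_le_trans _ t0)// ltrN10.
rewrite natr_absz ger0_norm// -ltrBlDr (_ : (Num.ceil t)%:~R - 1 = (Num.ceil t - 1)%:~R); last by rewrite rmorphB.
by rewrite real_ceilB1_lt// num_real.
Qed.

Lemma ln_ge_1BV t : 0 < t -> 1 - t^-1 <= ln t.
Proof.
move=> t0; have := @le_ln1Dx R (t^-1 - 1).
rewrite subrKC lnV ?posrE// => h.
have : - 1 < t^-1 - 1 by rewrite -[ltLHS]add0r ltrD2r invr_gt0.
by move=> /h; lra.
Qed.

Lemma ln2_ge : 2^-1 <= ln (2 : R).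
Proof. by have := @ln_ge_1BV 2 (ltr0n _ 2); lra. Qed.

Lemma pow2_ceil_log2 t : t <= 2 ^+ ceil_nat (log2_plus t).
Proof.
have [t1|t1] := leP t 1; first by apply: (le_trans t1); rewrite exprn_ege1// ler1n.
have t0 : 0 < t by lra.
have l2 : 0 < ln (2 : R) by have := ln2_ge; lra.
have lp0 : 0 <= log2_plus t by rewrite /log2_plus le_max lexx.
have := ceil_nat_ge lp0; rewrite {1}/log2_plus ge_max => /andP[_].
rewrite ler_pdivrMr// mulr_natl -lnXn// ler_ln ?posrE ?exprn_gt0//.
Qed.

End reals.

Section lipschitz.
Context {R : realType} {n : nat}.

Lemma lipschitz_within (X : set 'rV[R]_n) (F : 'rV[R]_n -> R) (C : R) :
  (forall x y, X x -> X y -> `|F x - F y| <= C * enorm (x - y)) ->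
  {within X, continuous F}.
Proof.
move=> H; apply/subspace_continuousP => x Xx.
apply/cvgrPdist_lt => e e0.
have C1 : 0 < `|C| + 1 by rewrite ltr_wpDl.
have d0 : 0 < e / (`|C| + 1) by rewrite divr_gt0.
rewrite near_withinE; near=> y => Xy.
apply: (le_lt_trans (H _ _ Xx Xy)).
apply: (@le_lt_trans _ _ ((`|C| + 1) * enorm (x - y))).
  by apply: ler_wpM2r; [exact: enorm_ge0|rewrite (le_trans (ler_norm _))// lerDl].
rewrite mulrC -ltr_pdivlMr//; near: y.
have := @continuous_enormB R n x x; rewrite /continuous_at subrr enorm0.
by move/cvgr_lt; apply.
Unshelve. all: by end_near. Qed.

Variables (X : set 'rV[R]_n) (F : 'rV[R]_n -> R) (G : 'rV[R]_n -> 'rV[R]_n).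
Variables (mu L d : R).
Hypotheses (X0 : X !=set0) (cX : compact X) (vX : vconvex X) (dX : diameter_at_most X d).
Hypotheses (mu0 : 0 < mu) (muL : mu <= L).
Hypotheses (scF : strongly_convex_on X mu F) (smF : smooth_on X L F G).

(** Lipschitz gradients on a bounded set are bounded, so F is Lipschitz on X; continuity and a
    minimizer follow although F is only controlled on X. *)
Lemma smooth_argmin : exists2 xs, X xs & forall x, X x -> F xs + mu / 2 * dotv (x - xs) (x - xs) <= F x.
Proof.
have [x0 Xx0] := X0.
have L0 : 0 < L := lt_le_trans mu0 muL.
have d0 : 0 <= d by have := dX Xx0 Xx0; exact: le_trans (enorm_ge0 _).
pose C := enorm (G x0) + L * d.
have GC x : X x -> enorm (G x) <= C.
  move=> Xx; have h1 := (proj2 smF) _ _ Xx Xx0.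
  have h2 : L * enorm (x - x0) <= L * d by rewrite ler_wpM2l ?(ltW L0)//; exact: dX.
  have tri (a b : 'rV[R]_n) : enorm (a + b) <= enorm a + enorm b.
    rewrite -(@ler_pXn2r _ 2)// ?nnegrE ?addr_ge0 ?enorm_ge0// enorm_sqr sqrrD !enorm_sqr.
    by have := dotv_cauchy a b; rewrite !dotvE [dotv b a]dotvC; lra.
  have := tri (G x - G x0) (G x0); rewrite subrK /C; lra.
have one x y : X x -> X y -> F x - F y <= C * enorm (x - y).
  move=> Xx Xy; have := convex_gradient vX mu0 scF smF Xx Xy => h.
  have h2 := dotv_cauchy (- G x) (y - x).
  have h3 := ler_wpM2r (enorm_ge0 (y - x)) (GC x Xx).
  by move: h2; rewrite enormN dotvNl [enorm (x - y)]enormC; lra.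
have cF : {within X, continuous F}.
  apply: (@lipschitz_within _ _ C) => x y Xx Xy.
  rewrite ler_norml; have := one x y Xx Xy; have := one y x Xy Xx.
  by rewrite [enorm (y - x)]enormC => h1 h2; apply/andP; split; lra.
have [xs Xxs H] := compact_argmin X0 cX cF.
exists xs => // x Xx.
(* first-order optimality is replaced by strong convexity along [xs, x] *)
set D := dotv (x - xs) (x - xs).
have D0 : 0 <= D := dotv_ge0 _.
have c0 : 0 <= mu / 2 * D by rewrite mulr_ge0// ltW// divr_gt0.
apply: (le_add_eps_mul c0) => e e0.
have [t [t0 t1 te]] : exists t : R, [/\ 0 < t, t <= 1 & t <= e].
  by exists (Num.min 1 e); rewrite lt_min !ge_min !lexx !orbT ltr01 e0.
have t01 : 0 <= t <= 1 by rewrite (ltW t0).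
have := H _ (vX Xx Xxs t01); have := scF Xx Xxs t01; rewrite enorm_sqr -/D => h1 h2.
have h3 : mu / 2 * t * (1 - t) * D <= t * (F x - F xs) by lra.
have h4 : t * (mu / 2 * D) <= e * (mu / 2 * D) by rewrite ler_wpM2r.
have h5 : t * ((1 - t) * (mu / 2 * D)) <= t * (F x - F xs) by lra.
rewrite ler_pM2l// in h5; lra.
Qed.

Let k := ceil_nat (Num.sqrt (8 * (L / mu))).
Local Notation run := (init_run X G mu L).

(** Origin of the 8 in the run length: with gamma = mu / 2 the weight is at least k ^ 2 / (8 L /
    mu). *)
Lemma run_weight : 1 <= block_weight L (mu / 2) k.
Proof.
have L0 : 0 < L := lt_le_trans mu0 muL.
have kp : 0 <= L / mu by rewrite divr_ge0// ltW.
have h0 : Num.sqrt (8 * (L / mu)) <= k%:R := ceil_nat_ge (sqrtr_ge0 _).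
have h : 8 * (L / mu) <= k%:R ^+ 2.
  have E : 8 * (L / mu) = Num.sqrt (8 * (L / mu)) ^+ 2 by rewrite sqr_sqrtr// mulr_ge0.
  by rewrite E ler_pXn2r ?nnegrE ?sqrtr_ge0 ?ler0n.
rewrite /block_weight ler_pdivlMr ?mulr_gt0// mul1r.
have h1 : mu * (8 * (L / mu)) <= mu * k%:R ^+ 2 by rewrite ler_pM2l.
have E : mu * (8 * (L / mu)) = 8 * L by field; rewrite gt_eqF.
rewrite E in h1.
have : 0 <= mu * k%:R by rewrite mulr_ge0 ?ler0n// ltW.
by have := mu0; nra.
Qed.

Section runs.
Variables (xs v : 'rV[R]_n).
Hypotheses (Xxs : X xs) (Hxs : forall x, X x -> F xs + mu / 2 * dotv (x - xs) (x - xs) <= F x).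
Hypothesis Xv : X v.

Lemma run_decrease (w : 'rV[R]_n) : X w ->
  F (b_u (block X G mu L (mu / 2) w k)) - F xs <= mu / 4 * dotv (xs - w) (xs - w).
Proof.
move=> Xw; have g0 : 0 < mu / 2 by rewrite divr_gt0.
have := block_bound X0 cX vX mu0 muL g0 Xw scF smF k Xxs.
have := run_weight; rewrite block_A//.
have [Xu Xz] := @block_inX _ _ X G _ _ _ _ X0 cX vX mu0 muL g0 Xw k.
set A := block_weight _ _ _; set u := b_u _ in Xu *; set z := b_z _.
move=> A1 h; have hu := Hxs Xu.
have d1 := dotv_ge0 (xs - z); have d2 := dotv_ge0 (u - xs).
have h1 : F xs <= F u.
  by apply: le_trans hu; rewrite lerDl mulr_ge0// ltW.
have h2 : 0 <= (mu / 2 + mu * A) / 2 * dotv (xs - z) (xs - z).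
  have A0 : 0 <= A by lra.
  apply: mulr_ge0 => //; apply: divr_ge0 => //; apply: addr_ge0; first exact: ltW.
  by apply: mulr_ge0 => //; exact: ltW.
have h3 : 0 <= (A - 1) * (F u - F xs) by rewrite mulr_ge0//; lra.
lra.
Qed.

Let p j := iter j run (block_init (mu / 2) v, 0%N).

Lemma init_runs_count j : (p j).2 = (j * k)%N.
Proof.
elim: j => [|j IH] //; rewrite /p iterS -/(p j) /init_run /= IH block_calls//.
by rewrite mulSn addnC.
Qed.

Lemma init_runs_inX j : X (b_u (p j).1).
Proof.
elim: j => [|j IH] //; rewrite /p iterS -/(p j) /init_run /=.
have g0 : 0 < mu / 2 by rewrite divr_gt0.
by have [] := @block_inX _ _ X G _ _ _ _ X0 cX vX mu0 muL g0 IH k.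
Qed.

(** By strong convexity mu/4 times the squared distance to the minimizer is at most half the current
    excess, so a run with weight at least 1 halves the excess. The first run is charged to the
    diameter. *)
Lemma init_runs_halving j : F (b_u (p j.+1).1) - F xs <= mu / 4 * d ^+ 2 / 2 ^+ j.
Proof.
elim: j => [|j IH].
  rewrite expr0 divr1; apply: (le_trans (run_decrease Xv)).
  rewrite ler_wpM2l ?divr_ge0 ?(ltW mu0)// -enorm_sqr.
  by rewrite ler_pXn2r ?nnegrE ?enorm_ge0// ?(le_trans (enorm_ge0 _) (dX Xxs Xv))//; exact: dX.
have Xu := init_runs_inX j.+1.
have := run_decrease Xu; rewrite -/(p j.+2).
have -> : block X G mu L (mu / 2) (b_u (p j.+1).1) k = (p j.+2).1 by rewrite /p (iterS j.+1).
have := Hxs Xu.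
have -> : dotv (xs - b_u (p j.+1).1) (xs - b_u (p j.+1).1) =
  dotv (b_u (p j.+1).1 - xs) (b_u (p j.+1).1 - xs).
  by rewrite -opprB dotvNl dotvNr opprK.
have -> : mu / 4 * d ^+ 2 / 2 ^+ j.+1 = (mu / 4 * d ^+ 2 / 2 ^+ j) / 2.
  by rewrite (exprS (2 : R) j) invfM; ring.
lra.
Qed.

(** The term mu/4 |x - w|^2 is split at the minimizer xs and costs at most F x - F xs + E, which
    combines with the block bound. The total loss is at most [3 * E]; this is why E = B / 3 goes
    with b = v_0 - B. *)
Lemma init_runs_certificate (E : R) (j : nat) : 0 <= E -> F (b_u (p j).1) - F xs <= E ->
  X (b_z (p j.+1).1) /\
  forall x, X x -> F (b_u (p j.+1).1) - 3 * E + mu / 4 * dotv (x - b_z (p j.+1).1) (x - b_z (p j.+1).1) <= F x.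
Proof.
move=> E0 hE; have Xw := init_runs_inX j.
have g0 : 0 < mu / 2 by rewrite divr_gt0.
have -> : (p j.+1).1 = block X G mu L (mu / 2) (b_u (p j).1) k by rewrite /p iterS.
set w := b_u (p j).1 in hE Xw *.
have [Xu Xz] := @block_inX _ _ X G _ _ _ _ X0 cX vX mu0 muL g0 Xw k.
split => // x Xx.
have := block_bound X0 cX vX mu0 muL g0 Xw scF smF k Xx.
have := run_decrease Xw; have := run_weight; rewrite block_A//.
set A := block_weight _ _ _; set u := b_u (block _ _ _ _ _ _ _) in Xu *; set z := b_z _ in Xz *.
move=> A1 h1 h2.
have hx := Hxs Xx; have hw := Hxs Xw.
have par (a b : 'rV[R]_n) : dotv (a + b) (a + b) <= 2 * dotv a a + 2 * dotv b b.
  by have := dotv_ge0 (a - b); rewrite !dotvE; lra.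
have := par (x - xs) (xs - w); rewrite addrA subrK.
have sw : dotv (xs - w) (xs - w) = dotv (w - xs) (w - xs).
  by rewrite -opprB dotvNl dotvNr opprK.
rewrite sw in h1 *.
set dxs := dotv (x - xs) (x - xs) in hx *; set dw := dotv (w - xs) _ in hw h1 *.
set dx := dotv (x - w) (x - w) in h2 *; set dz := dotv (x - z) (x - z) in h2 *.
have dz0 : 0 <= dz := dotv_ge0 _.
move=> h3.
have h4 : mu / 4 * dx <= mu / 4 * (2 * dxs + 2 * dw) by rewrite ler_pM2l ?divr_gt0.
have m0 := mu0.
have h5 : mu / 4 * dx <= F x - F xs + E by lra.
have h6 : A * F u + (mu / 2 + mu * A) / 2 * dz <= F x - F xs + E + A * F x by lra.
have h7 : (1 + A) * (mu / 4 * dz) <= (mu / 2 + mu * A) / 2 * dz.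
  have A0 : 0 <= A by lra.
  have : 0 <= mu * A * dz by apply: mulr_ge0 => //; apply: mulr_ge0 => //; exact: ltW.
  lra.
have h8 : (1 + A) * (F u - 3 * E + mu / 4 * dz) <= (1 + A) * F x.
  have A0 : 0 <= A by lra.
  have : 0 <= A * E by rewrite mulr_ge0.
  lra.
by rewrite ler_pM2l in h8; lra.
Qed.

End runs.
End lipschitz.

(** * Minimax and the gap *)

Section minimax.
Context {R : realType} {n m : nat}.
Implicit Types (D Y : set 'rV[R]_m) (P Q : 'rV[R]_m -> R).

Definition affine_fun P :=
  forall (x y : 'rV[R]_m) (t : R), P (t *: x + (1 - t) *: y) = t * P x + (1 - t) * P y.

(* The slope s / (1 - s) is read off the infimum of - P / Q over {Q > 0}. *)
Lemma affine_alternative D P Q : vconvex D -> affine_fun P -> affine_fun Q ->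
  (forall y, D y -> 0 < Q y -> P y <= 0) ->
  exists2 s : R, 0 <= s <= 1 & forall y, D y -> s * P y + (1 - s) * Q y <= 0.
Proof.
move=> vD aP aQ PQ.
have [[y0 [Dy0 Qy0]]|nQ] := pselect (exists y, D y /\ 0 < Q y); last first.
  exists 0 => [|y Dy]; first by rewrite lexx ler01.
  rewrite mul0r add0r subr0 mul1r leNgt; apply/negP => Qy; apply: nQ; by exists y.
have zero y : D y -> Q y = 0 -> P y <= 0.
  move=> Dy Qy; rewrite leNgt; apply/negP => Py.
  have P0 := PQ _ Dy0 Qy0.
  have d0 : 0 < 2 * (P y - P y0) by lra.
  (* Moving from y towards y0 with this weight only halves [P y], while Q becomes positive. *)
  pose t := P y / (2 * (P y - P y0)).
  have tE : t * (2 * (P y - P y0)) = P y by rewrite /t divfK// gt_eqF.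
  have t0 : 0 < t by rewrite /t divr_gt0.
  have t1 : t <= 1 by rewrite /t ler_pdivrMr// mul1r; lra.
  have t01 : 0 <= t <= 1 by rewrite (ltW t0).
  have := PQ _ (vD _ _ _ Dy0 Dy t01); rewrite aP aQ Qy mulr0 addr0 mulr_gt0// => /(_ isT).
  lra.
pose S := [set - P y / Q y | y in [set y | D y /\ 0 < Q y]].
have S0 : S !=set0 by exists (- P y0 / Q y0), y0.
have Slb : lbound S 0.
  by move=> _ [y [Dy Qy] <-]; rewrite divr_ge0 ?oppr_ge0 ?(ltW Qy)//; exact: PQ.
pose r := inf S.
have r0 : 0 <= r by exact: lb_le_inf.
have H y : D y -> P y + r * Q y <= 0.
  move=> Dy; have [Qy|Qy|Qy] := ltgtP (Q y) 0.
  - have : P y / - Q y <= r.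
      apply: lb_le_inf => // _ [y' [Dy' Qy'] <-].
      rewrite ler_pdivrMr ?oppr_gt0// mulrAC ler_pdivlMr// mulrNN.
      (* The weight at which the segment from y' to y crosses Q = 0, where [zero] applies. *)
      pose t := Q y' / (Q y' - Q y).
      have dp : 0 < Q y' - Q y by lra.
      have t01 : 0 <= t <= 1.
        by rewrite /t divr_ge0 ?(ltW Qy') ?(ltW dp)//= ler_pdivrMr// mul1r; lra.
      have tE : t * (Q y' - Q y) = Q y' by rewrite /t divfK// gt_eqF.
      have := zero _ (vD _ _ _ Dy Dy' t01); rewrite aP aQ.
      have -> : t * Q y + (1 - t) * Q y' = Q y' - t * (Q y' - Q y) by ring.
      rewrite tE subrr => /(_ erefl) h.
      have := ler_wpM2r (ltW dp) h; rewrite mul0r.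
      have -> : (t * P y + (1 - t) * P y') * (Q y' - Q y) =
        t * (Q y' - Q y) * P y + ((Q y' - Q y) - t * (Q y' - Q y)) * P y' by ring.
      rewrite tE; lra.
    by rewrite ler_pdivrMr ?oppr_gt0//; lra.
  - have : r <= - P y / Q y.
      by apply: inf_lbound; [exists 0|exists y].
    by rewrite ler_pdivlMr//; lra.
  - by rewrite Qy mulr0 addr0; exact: zero.
have r1 : 0 < 1 + r by lra.
exists (1 + r)^-1 => [|y Dy].
  by rewrite invr_ge0 (ltW r1)/= invf_le1// lerDl.
have -> : (1 + r)^-1 * P y + (1 - (1 + r)^-1) * Q y = (1 + r)^-1 * (P y + r * Q y).
  by field; rewrite gt_eqF.
by rewrite pmulr_rle0 ?invr_gt0//; exact: H.
Qed.

Implicit Types (p : plane R n m) (ps : seq (plane R n m)).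

Lemma affine_plane p : affine_fun (plane_val p).
Proof.
move=> x y t; rewrite /plane_val.
have -> : t *: x + (1 - t) *: y - pl_y p = t *: (x - pl_y p) + (1 - t) *: (y - pl_y p).
  by apply/rowP => i; rewrite !mxE; ring.
have lin (u v : 'rV[R]_m) :
    dotv (pl_g p) (t *: u + (1 - t) *: v) = t * dotv (pl_g p) u + (1 - t) * dotv (pl_g p) v.
  by rewrite dotvDr !dotvZr.
by rewrite lin; ring.
Qed.

Lemma affine_mixed ps (lam : 'I_(size ps) -> R) : affine_fun (mixed_plane lam).
Proof.
move=> x y t; rewrite /mixed_plane !mulr_sumr -big_split; apply: eq_bigr => i _ /=.
by rewrite affine_plane; ring.
Qed.

Lemma mixed_plane_cons p ps (lam : 'I_(size ps) -> R) (s : R) y :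
  mixed_plane (ps := p :: ps)
    (fun i => if unlift ord0 i is Some j then s * lam j else 1 - s) y =
  s * mixed_plane lam y + (1 - s) * plane_val p y.
Proof.
rewrite /mixed_plane big_ord_recl unlift_none addrC; congr (_ + _).
  rewrite mulr_sumr; apply: eq_bigr => i _; rewrite liftK -mulrA.
  by rewrite !(tnth_nth p) /= add0n.
Qed.

(** One plane p is peeled off: where p exceeds a the other planes must do the work and are mixed by
    induction, then [affine_alternative] weighs that mixture against p. The convex set D shrinks
    along the induction, and no closedness is asked of it. *)
Lemma minimax_planes D p ps (a : R) : vconvex D ->
  (forall y, D y -> exists2 q, List.In q (p :: ps) & plane_val q y <= a) ->
  exists lam : 'I_(size (p :: ps)) -> R,
    in_simplex lam /\ forall y, D y -> mixed_plane lam y <= a.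
Proof.
elim: ps p D => [|q ps IH] p D vD H.
  exists (fun=> 1); split; first by split => [i|]; rewrite ?ler01// big_ord1.
  by move=> y /H [q [<-|[]]]; rewrite /mixed_plane big_ord1 mul1r.
have vD' : vconvex (D `&` [set y | a < plane_val p y]).
  move=> x y t [Dx px] [Dy py] t01; split; first exact: vD.
  rewrite /= affine_plane; move: t01 px py => /andP[t0 t1] /= px py.
  have [->|t0'] := eqVneq t 0; first by rewrite subr0 mul0r mul1r add0r.
  have A : t * a < t * plane_val p x by rewrite ltr_pM2l// lt_def t0'.
  have B : (1 - t) * a <= (1 - t) * plane_val p y by rewrite ler_wpM2l ?subr_ge0// ltW.
  lra.
have [|lam [[lam0 lam1] Hlam]] := IH q _ vD'.
  move=> y [Dy /= py]; have [r [<-|rps] ra] := H y Dy; last by exists r.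
  by move: py; rewrite ltNge ra.
have aff (u : 'rV[R]_m -> R) : affine_fun u -> affine_fun (fun y => u y - a).
  by move=> au x y t; rewrite au; ring.
have [s s01 Hs] := affine_alternative vD (aff _ (affine_mixed lam)) (aff _ (affine_plane p))
  (fun y Dy py => ltac:(by rewrite subr_le0; apply: Hlam; split => //=; rewrite -subr_gt0)).
exists (fun i => if unlift ord0 i is Some j then s * lam j else 1 - s); split.
  split.
    move=> i; case: unlift => [j|]; last by rewrite subr_ge0; case/andP: s01.
    by rewrite mulr_ge0//; case/andP: s01.
  rewrite big_ord_recl unlift_none.
  under eq_bigr do rewrite liftK; by rewrite -mulr_sumr lam1 mulr1 subrK.
move=> y Dy; rewrite mixed_plane_cons; have := Hs y Dy; lra.
Qed.

(** Membership is [List.In] because no equality structure is declared on [plane]. *)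
Lemma model_geP p ps (c : R) y :
  (c <= model (p :: ps) y) <-> (forall q, List.In q (p :: ps) -> c <= plane_val q y).
Proof.
rewrite /=; elim: ps => [|q ps IH].
  by rewrite big_nil; split => [h r [<-|[]]|]//; apply; left.
rewrite big_cons le_min; split.
  move=> /andP[cq /IH H] r [<-|[<-|rps]] //; apply: H; by [left|right].
move=> H; apply/andP; split; first by apply: H; right; left.
by apply/IH => r [<-|rps]; apply: H; [left|right; right].
Qed.

Lemma model_le p ps y q : List.In q (p :: ps) -> model (p :: ps) y <= plane_val q y.
Proof. exact: (proj1 (model_geP p ps _ y) (lexx _)). Qed.

Lemma model_attained p ps y : exists2 q, List.In q (p :: ps) & plane_val q y = model (p :: ps) y.
Proof.
rewrite /=; elim: ps => [|q ps [r rps rE]].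
  by exists p; [left|rewrite big_nil].
rewrite big_cons minEle; case: ifP => _; first by exists q => //; right; left.
by exists r => //; move: rps => [->|]; [left|right; right].
Qed.

End minimax.

Section simplex_points.
Context {R : realType} {n : nat}.

Lemma vconvex_sum (X : set 'rV[R]_n) (k : nat) (lam : 'I_k -> R) (x : 'I_k -> 'rV[R]_n) :
  vconvex X -> in_simplex lam -> (forall i, X (x i)) -> X (\sum_i lam i *: x i).
Proof.
move=> vX; elim: k lam x => [|k IH] lam x [l0 l1] Xx.
  by move: l1; rewrite big_ord0 => /esym/eqP; rewrite oner_eq0.
rewrite big_ord_recl; rewrite big_ord_recl in l1.
set t := lam ord0 in l1 *.
have [t1|t1] := eqVneq t 1.
  have z i : lam (lift ord0 i) = 0.
    have s0 : \sum_(i < k) lam (lift ord0 i) = 0 by lra.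
    by apply: (psumr_eq0P _ s0).
  rewrite t1 scale1r big1 ?addr0// => i _; by rewrite z scale0r.
have tl1 : t < 1.
  rewrite lt_neqAle t1 /=; have : 0 <= \sum_(i < k) lam (lift ord0 i) by exact: sumr_ge0.
  lra.
have t1' : 0 < 1 - t by lra.
have -> : \sum_(i < k) lam (lift ord0 i) *: x (lift ord0 i) =
   (1 - t) *: \sum_(i < k) (lam (lift ord0 i) / (1 - t)) *: x (lift ord0 i).
  rewrite scaler_sumr; apply: eq_bigr => i _; rewrite scalerA; congr (_ *: _).
  by rewrite mulrC divfK// gt_eqF.
apply: vX => //; last by rewrite l0 ltW.
apply: (IH (fun i => lam (lift ord0 i) / (1 - t)) (fun i => x (lift ord0 i))) => //.
split => [i|]; first by rewrite divr_ge0// ltW.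
by rewrite -mulr_suml; have -> : \sum_(i < k) lam (lift ord0 i) = 1 - t by [lra]; rewrite divff// gt_eqF.
Qed.

Lemma max_over_le (Y : set 'rV[R]_n) (F : 'rV[R]_n -> R) c : Y !=set0 ->
  (forall y, Y y -> F y <= c) -> max_over Y F <= c.
Proof.
move=> [y0 Yy0] H; apply: ge_sup; first by exists (F y0), y0.
by move=> _ [y Yy <-]; exact: H.
Qed.

Lemma max_over_ge (Y : set 'rV[R]_n) (F : 'rV[R]_n -> R) c y :
  (forall y, Y y -> F y <= c) -> Y y -> F y <= max_over Y F.
Proof.
move=> H Yy; apply: sup_upper_bound; last by exists y.
by split; [exists (F y), y|exists c => _ [z Yz <-]; exact: H].
Qed.

Lemma min_over_ge (X : set 'rV[R]_n) (F : 'rV[R]_n -> R) c : X !=set0 ->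
  (forall x, X x -> c <= F x) -> c <= min_over X F.
Proof.
move=> [y0 Yy0] H; apply: lb_le_inf; first by exists (F y0), y0.
by move=> _ [y Yy <-]; exact: H.
Qed.

End simplex_points.

(** * From optimal weights to the duality gap *)

Section gap.
Context {R : realType} {n m : nat}.
Variables (X : set 'rV[R]_n) (Y : set 'rV[R]_m) (f : 'rV[R]_n -> 'rV[R]_m -> R).
Variables (Ox : 'rV[R]_n -> 'rV[R]_m -> 'rV[R]_n) (mu L My Ry : R).
Hypotheses (X0 : X !=set0) (vX : vconvex X).
Hypotheses (Y0 : Y !=set0) (cY : compact Y) (vY : vconvex Y) (dY : diameter_at_most Y Ry).
Hypotheses (mu0 : 0 < mu) (muL : mu <= L).
Hypothesis scf : forall y, Y y -> strongly_convex_on X mu (f^~ y).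
Hypothesis smf : forall y, Y y -> smooth_on X L (f^~ y) (Ox^~ y).

Definition valid_plane (p : plane R n m) :=
  [/\ X (pl_u p), Y (pl_y p), enorm (pl_g p) <= My &
      forall y, Y y -> f (pl_u p) y <= plane_val p y].

Lemma plane_lipschitz p y y' : valid_plane p ->
  plane_val p y - plane_val p y' <= My * enorm (y - y').
Proof.
move=> [_ _ gM _]; rewrite /plane_val.
have -> : pl_v p + dotv (pl_g p) (y - pl_y p) - (pl_v p + dotv (pl_g p) (y' - pl_y p)) =
   dotv (pl_g p) (y - y') by rewrite !dotvDr !dotvNr; ring.
apply: (le_trans (dotv_cauchy _ _)); apply: ler_wpM2r => //; exact: enorm_ge0.
Qed.

Variables (p0 : plane R n m) (ps : seq (plane R n m)).
Hypothesis valid : forall q, List.In q (p0 :: ps) -> valid_plane q.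
Local Notation U := (model (p0 :: ps)).

Let My0 : 0 <= My.
Proof. by have [_ _ + _] := valid (or_introl erefl); exact/le_trans/enorm_ge0. Qed.

Lemma model_lipschitz y y' : U y - U y' <= My * enorm (y - y').
Proof.
have [q qps qE] := model_attained p0 ps y'.
have := plane_lipschitz y y' (valid qps); have := model_le y qps.
rewrite qE; lra.
Qed.

Lemma model_argmax : exists2 ys, Y ys & U ys = max_over Y U /\ forall y, Y y -> U y <= U ys.
Proof.
have cU : {within Y, continuous (fun y => - U y)}.
  apply: (@lipschitz_within _ _ _ _ My) => x y _ _.
  rewrite ler_norml; have := model_lipschitz x y; have := model_lipschitz y x.
  by rewrite [enorm (y - x)]enormC => h1 h2; apply/andP; split; lra.
have [ys Yys H] := compact_argmin Y0 cY cU.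
have H' y : Y y -> U y <= U ys by move=> /H; rewrite lerN2.
exists ys => //; split => //; apply/eqP; rewrite eq_le.
by rewrite (max_over_ge H' Yys) (max_over_le Y0 H').
Qed.

Lemma model_range y y' : Y y -> Y y' -> U y - U y' <= My * Ry.
Proof.
move=> Yy Yy'; apply: (le_trans (model_lipschitz y y')).
by apply: ler_wpM2l => //; exact: dY.
Qed.

Section mixture.
Variable lam : 'I_(size (p0 :: ps)) -> R.
Hypothesis slam : in_simplex lam.

Lemma nth_In (T : Type) (x0 : T) (s : seq T) k : (k < size s)%N -> List.In (nth x0 s k) s.
Proof. by elim: s k => [|q qs IH] [|k] //= h; [left|right; exact: IH]. Qed.

Lemma tnth_In (i : 'I_(size (p0 :: ps))) : List.In (tnth (in_tuple (p0 :: ps)) i) (p0 :: ps).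
Proof.
by rewrite (tnth_nth p0); apply: nth_In; exact: ltn_ord.
Qed.

Lemma mixed_point_inX : X (mixed_point lam).
Proof.
apply: (vconvex_sum vX slam) => i.
by have [] := valid (tnth_In i).
Qed.

(** Jensen's inequality for f(., y), through the gradient inequality at the mixture, where the
    linear terms cancel. *)
Lemma mixed_plane_upper y : Y y -> f (mixed_point lam) y <= mixed_plane lam y.
Proof.
move=> Yy; have Xm := mixed_point_inX; have [l0 l1] := slam.
set xm := mixed_point lam in Xm *.
have H i : lam i * (f xm y + dotv (Ox xm y) (pl_u (tnth (in_tuple (p0 :: ps)) i) - xm)) <=
   lam i * plane_val (tnth (in_tuple (p0 :: ps)) i) y.
  apply: ler_wpM2l => //.
  have [Xu _ _ /(_ y Yy)] := valid (tnth_In i); apply: le_trans.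
  exact: (convex_gradient vX mu0 (scf Yy) (smf Yy) Xm Xu).
apply: le_trans (ler_sum _ (fun i _ => H i)).
rewrite (eq_bigr (fun i => lam i * (f xm y - dotv (Ox xm y) xm) +
    dotv (Ox xm y) (lam i *: pl_u (tnth (in_tuple (p0 :: ps)) i)))); last first.
  by move=> i _; rewrite dotvDr dotvNr dotvZr; ring.
rewrite big_split /= -mulr_suml l1 mul1r.
have -> : \sum_i dotv (Ox xm y) (lam i *: pl_u (tnth (in_tuple (p0 :: ps)) i)) = dotv (Ox xm y) xm.
  have gen g : dotv g xm = \sum_i dotv g (lam i *: pl_u (tnth (in_tuple (p0 :: ps)) i)).
    rewrite /xm /mixed_point; move: (index_enum _) => s.
    elim: s => [|i s IH]; first by rewrite !big_nil dotv0r.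
    by rewrite !big_cons dotvDr IH.
  by rewrite gen.
by rewrite subrK.
Qed.

Lemma mixed_plane_lower y : U y <= mixed_plane lam y.
Proof.
have [l0 l1] := slam; rewrite -[leLHS]mul1r -l1 mulr_suml; apply: ler_sum => i _.
by apply: ler_wpM2l => //; apply: model_le; exact: tnth_In.
Qed.

Lemma mixed_plane_bounded : exists c, forall y, Y y -> mixed_plane lam y <= c.
Proof.
have [y0 Yy0] := Y0; exists (mixed_plane lam y0 + My * Ry) => y Yy.
have [l0 l1] := slam; rewrite -lerBlDl /mixed_plane -sumrB -[leRHS]mul1r -l1 mulr_suml.
apply: ler_sum => i _; rewrite -mulrBr; apply: ler_wpM2l => //.
apply: (le_trans (plane_lipschitz _ _ (valid (tnth_In i)))).
by apply: ler_wpM2l => //; exact: dY.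
Qed.

Lemma max_mixed_ge : max_over Y U <= max_over Y (mixed_plane lam).
Proof.
have [ys Yys [<- _]] := model_argmax; have [c Hc] := mixed_plane_bounded.
exact: le_trans (mixed_plane_lower ys) (max_over_ge Hc Yys).
Qed.

End mixture.

(** Every mixture dominates U, so its maximum cannot fall below max U; the minimax weights reach
    that value and are therefore optimal. *)
Lemma optimal_weights_exist : exists lam, optimal_weights Y (ps := p0 :: ps) lam /\
  max_over Y (mixed_plane lam) <= max_over Y U.
Proof.
have [ys Yys [UE Uys]] := model_argmax.
have [|lam [slam Hlam]] := @minimax_planes R n m Y p0 ps (max_over Y U) vY.
  move=> y Yy; have [q qps qE] := model_attained p0 ps y.
  by exists q => //; rewrite qE -UE; exact: Uys.
have h := max_over_le Y0 Hlam.
exists lam; split => //; split => // lam' slam'.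
exact: le_trans h (max_mixed_ge slam').
Qed.

Lemma optimal_gap (b : R) (yb : 'rV[R]_m) lam : optimal_weights Y (ps := p0 :: ps) lam ->
  (forall x, X x -> b <= f x yb) ->
  X (mixed_point lam) /\ Gap X Y f (mixed_point lam) yb <= max_over Y U - b.
Proof.
move=> [slam olam] Hb; split; first exact: mixed_point_inX.
have [lam' [[slam' _] h]] := optimal_weights_exist.
have h' := le_trans (olam _ slam') h.
have [c Hc] := mixed_plane_bounded slam.
apply: lerB; last exact: min_over_ge.
apply: max_over_le => // y Yy; apply: le_trans h'.
exact: le_trans (mixed_plane_upper slam Yy) (max_over_ge Hc Yy).
Qed.

End gap.

(** * Volumes of contracted sets and level sets of the model *)

Section volume_scaling.
Context {R : realType}.
Variable m : nat.
Implicit Types (A B Y : set 'rV[R]_m).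

Lemma rvol_scale_sub A B (z : 'rV[R]_m) (th M : R) : 0 < th ->
  measurable A -> measurable B -> A `<=` cube 0 M -> B `<=` cube 0 M ->
  (forall y, B y -> A (th *: y + (1 - th) *: z)) -> th ^+ m * rvol B <= rvol A.
Proof.
move=> th0 mA mB AM BM H.
have mP : measurable ((fun y : 'rV[R]_m => th *: y + (1 - th) *: z) @^-1` A).
  by rewrite -[X in measurable X]setTI; exact: measurable_affine_rV.
have := le_vol mB mP H; rewrite vol_affine//.
have [-> _] := vol_bounded mA AM; have [-> _] := vol_bounded mB BM.
by rewrite -EFinM lee_fin mulrC ler_pdivlMr ?exprn_gt0// mulrC.
Qed.

Lemma bounded_cube Y (d : R) (y0 : 'rV[R]_m) : Y y0 -> diameter_at_most Y d ->
  Y `<=` cube 0 (d + enorm y0).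
Proof.
move=> Yy0 dY y Yy i; rewrite mxE subr0 -[y 0 i](subrK (y0 0 i)).
apply: (le_trans (ler_normD _ _)); apply: lerD; last exact: coord_le_enorm.
have := coord_le_enorm (y - y0) i; rewrite !mxE => /le_trans; apply; exact: dY.
Qed.

Lemma rvol_interior Y (M : R) : measurable Y -> Y `<=` cube 0 M -> interior Y !=set0 ->
  0 < rvol Y.
Proof.
move=> mY YM [x /nbhs_ballP[e /= e0 xe]].
have e20 : 0 < e / 2 by rewrite divr_gt0.
have sub : cube x (e / 2) `<=` Y.
  move=> y H; apply: xe; split => // i j; rewrite ord1 /ball /=.
  have := H j; rewrite distrC => /le_lt_trans; apply.
  by rewrite gtr_pMr// invf_lt1// ltr1n.
have := le_rvol (measurable_cube x (e / 2)) mY YM sub; apply: lt_le_trans.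
by rewrite /rvol vol_cube ?(ltW e20)//= exprn_gt0// mulr_gt0.
Qed.

End volume_scaling.

Section level_sets.
Context {R : realType} {n m : nat}.
Variables (Y : set 'rV[R]_m) (Ry : R).
Hypotheses (Y0 : Y !=set0) (cY : compact Y) (vY : vconvex Y) (dY : diameter_at_most Y Ry).

Definition level (ps : seq (plane R n m)) (h : R) : set 'rV[R]_m :=
  [set y | Y y /\ h <= model ps y].

Lemma closed_plane (p : plane R n m) h : closed [set y | h <= plane_val p y].
Proof.
have c : continuous (plane_val p).
  rewrite (_ : plane_val p = fun y => pl_v p + (dotv (pl_g p) y - dotv (pl_g p) (pl_y p))).
    move=> y; apply: (@continuousD R _ _ _ _ y); first exact: cst_continuous.
    apply: (@continuousB R _ _ _ _ y); last exact: cst_continuous.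
    exact: continuous_dotv.
  by apply/funext => y; rewrite /plane_val dotvDr dotvNr.
rewrite (_ : mkset _ = plane_val p @^-1` [set x | h <= x]); last by apply/seteqP; split.
by apply: closed_comp => [y _|]; [exact: c|exact: closed_ge].
Qed.

Variables (p : plane R n m) (ps : seq (plane R n m)).

Lemma closed_level h : closed (level (p :: ps) h).
Proof.
have -> : level (p :: ps) h =
    Y `&` \bigcap_(q in [set q | List.In q (p :: ps)]) [set y | h <= plane_val q y].
  apply/seteqP; split => y [Yy H]; split => //; first exact/model_geP.
  by apply/model_geP.
apply: closedI; first by apply: compact_closed => //; exact: norm_hausdorff.
by apply: closed_bigI => q _; exact: closed_plane.
Qed.

Lemma compact_level h : compact (level (p :: ps) h).
Proof. by apply: (subclosed_compact _ cY) => [|y []//]; exact: closed_level. Qed.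

Lemma measurable_level h : measurable (level (p :: ps) h).
Proof. by apply: closed_measurable_rV; exact: closed_level. Qed.

Lemma model_concave y y' (t : R) : 0 <= t <= 1 ->
  t * model (p :: ps) y + (1 - t) * model (p :: ps) y' <= model (p :: ps) (t *: y + (1 - t) *: y').
Proof.
move=> /andP[t0 t1]; apply/model_geP => q qps; rewrite affine_plane.
have := model_le y qps; have := model_le y' qps => h1 h2.
have := ler_wpM2l t0 h2; have := ler_wpM2l (_ : 0 <= 1 - t) h1; rewrite subr_ge0 => /(_ t1).
lra.
Qed.

Lemma vconvex_level h : vconvex (level (p :: ps) h).
Proof.
move=> y y' t [Yy hy] [Yy' hy'] t01; split; first exact: vY.
apply: le_trans (model_concave y y' t01); move/andP: t01 => [t0 t1].
have := ler_wpM2l t0 hy; have := ler_wpM2l (_ : 0 <= 1 - t) hy'; rewrite subr_ge0 => /(_ t1).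
lra.
Qed.

End level_sets.

(** * One iteration *)

Lemma concave_onP {R : realType} n (S : set 'rV[R]_n) (h : 'rV[R]_n -> R) (x y : 'rV[R]_n) (t : R) :
  concave_on S h -> S x -> S y -> 0 <= t <= 1 ->
  t * h x + (1 - t) * h y <= h (t *: x + (1 - t) *: y).
Proof.
move=> ch Sx Sy t01; rewrite -lerN2.
have -> : - (t * h x + (1 - t) * h y) = t * - h x + (1 - t) * - h y by ring.
exact: ch (Itv01 (proj1 (andP t01)) (proj2 (andP t01))) x y (mem_set Sx) (mem_set Sy).
Qed.

Lemma weighted_mean {R : realType} n (A : R) (x y : 'rV[R]_n) : 1 + A != 0 ->
  (1 + A)^-1 *: (x + A *: y) = (1 + A)^-1 *: x + (1 - (1 + A)^-1) *: y.
Proof. by move=> A1; apply/rowP => i; rewrite !mxE; field. Qed.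

Section loop.
Context {R : realType} {n m : nat}.
Variables (X : set 'rV[R]_n) (Y : set 'rV[R]_m) (f : 'rV[R]_n -> 'rV[R]_m -> R).
Variables (Ox : 'rV[R]_n -> 'rV[R]_m -> 'rV[R]_n).
Variables (Oy : 'rV[R]_n -> 'rV[R]_m -> R * 'rV[R]_m).
Variables (mu L My Ry eps : R) (K : nat).
Hypotheses (X0 : X !=set0) (cX : compact X) (vX : vconvex X).
Hypotheses (Y0 : Y !=set0) (cY : compact Y) (vY : vconvex Y) (dY : diameter_at_most Y Ry).
Hypothesis iY : interior Y !=set0.
Hypotheses (mu0 : 0 < mu) (muL : mu <= L).
Hypothesis scf : forall y, Y y -> strongly_convex_on X mu (f^~ y).
Hypothesis smf : forall y, Y y -> smooth_on X L (f^~ y) (Ox^~ y).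
Hypothesis ccf : forall x, X x -> concave_on Y (f x).
Hypothesis Oyf : forall x y, X x -> Y y ->
  [/\ (Oy x y).1 = f x y, supergradient Y (f x) y (Oy x y).2 & enorm (Oy x y).2 <= My].
Local Notation B := (My * Ry).
Hypotheses (B0 : 0 < B) (eps0 : 0 < eps).

Local Notation step := (ct_step X Y Ox Oy mu L K).
Local Notation width := (ct_width Y).
Local Notation valid := (valid_plane X Y f My).
Implicit Types s t : ct_state R n m.

(* The values of W and h that step (1) installs before the cut is made. *)
Definition cur_W s := if width s <= 2 / 3 * ct_W s then width s else ct_W s.
Definition cur_h s := if width s <= 2 / 3 * ct_W s then ct_b s + width s / 2 else ct_h s.
Definition cur_level s := level Y (ct_planes s) (cur_h s).
Local Notation upper s := (max_over Y (model (ct_planes s))).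

(** [inv_lo] and [inv_hi] keep b and max U within W / 2 of h on either side; [inv_cert] keeps the
    curvature that the next block starts from. *)
Record state_inv s : Prop := StateInv {
  inv_planes : exists p ps, ct_planes s = p :: ps /\
    forall q, List.In q (p :: ps) -> valid q;
  inv_xb : X (ct_xb s);
  inv_yb : Y (ct_yb s);
  inv_cert : forall x, X x ->
    ct_b s + mu / 4 * dotv (x - ct_xb s) (x - ct_xb s) <= f x (ct_yb s);
  inv_W : 0 < ct_W s;
  inv_lo : ct_h s - ct_W s / 2 <= ct_b s;
  inv_hi : upper s <= ct_h s + ct_W s / 2 }.

Lemma cur_bounds s : state_inv s -> 0 < width s ->
  [/\ cur_h s - cur_W s / 2 <= ct_b s, upper s <= cur_h s + cur_W s / 2,
      cur_W s / 6 <= upper s - cur_h s, cur_W s / 6 <= cur_h s - ct_b s &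
      width s <= cur_W s].
Proof.
move=> [_ _ _ _ W0 lo hi]; rewrite /cur_W /cur_h /ct_width => w0.
case: ifP => [h|/negbT]; first by split; lra.
by rewrite -ltNge => h; split; lra.
Qed.

Lemma Y_cube : exists M, Y `<=` cube 0 M.
Proof. by have [y0 Yy0] := Y0; exists (Ry + enorm y0); exact: bounded_cube. Qed.

Let mY : measurable Y.
Proof. apply: closed_measurable_rV; apply: compact_closed => //; exact: norm_hausdorff. Qed.

Lemma rvol_Y_gt0 : 0 < rvol Y.
Proof. by have [M YM] := Y_cube; exact: rvol_interior YM iY. Qed.

Lemma cur_level_measurable s : state_inv s -> measurable (cur_level s).
Proof. by move=> [[p [ps [E _]]] _ _ _ _ _ _]; rewrite /cur_level E; exact: measurable_level. Qed.

Lemma cur_level_sub s : cur_level s `<=` Y.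
Proof. by move=> y []. Qed.

(* Contracting Y towards a maximizer of the model by the factor W / (6 B) moves
   it inside the level set, because the model varies by at most B over Y. *)
Lemma cur_level_lower s : state_inv s -> 0 < width s -> cur_W s <= 6 * B ->
  (cur_W s / (6 * B)) ^+ m * rvol Y <= rvol (cur_level s).
Proof.
move=> inv w0 WB; have [_ _ c3 _ c5] := cur_bounds inv w0.
have mS := cur_level_measurable inv.
have [[p [ps [E va]]] _ _ _ _ _ _] := inv.
have [M YM] := Y_cube.
have [ys Yys [UE Umax]] := model_argmax Y0 cY va.
have B6 : 0 < 6 * B by rewrite mulr_gt0.
have th0 : 0 < cur_W s / (6 * B) by rewrite divr_gt0// (lt_le_trans w0).
have th1 : cur_W s / (6 * B) <= 1 by rewrite ler_pdivrMr// mul1r.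
have th01 : 0 <= cur_W s / (6 * B) <= 1 by rewrite (ltW th0).
apply: (@rvol_scale_sub _ _ _ _ ys _ M) => //.
  exact: subset_trans (@cur_level_sub s) YM.
move=> y Yy; split; first exact: vY.
rewrite E; apply: le_trans (model_concave p ps y ys th01).
have := model_range dY va Yys Yy; rewrite UE -E => h.
have thE : cur_W s / (6 * B) * B = cur_W s / 6.
  have aux (w b : R) : b != 0 -> w / (6 * b) * b = w / 6 by move=> b0; field.
  by apply: aux; rewrite gt_eqF.
have := ler_wpM2l (ltW th0) h; rewrite thE.
lra.
Qed.

Lemma cur_level_pos s : state_inv s -> 0 < width s -> cur_W s <= 6 * B -> 0 < rvol (cur_level s).
Proof.
move=> inv w0 WB; have [_ _ _ _ c5] := cur_bounds inv w0.
apply: lt_le_trans (cur_level_lower inv w0 WB).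
apply: mulr_gt0; last exact: rvol_Y_gt0.
apply: exprn_gt0; apply: divr_gt0; first exact: lt_le_trans c5.
exact: mulr_gt0.
Qed.

Lemma cur_center s : state_inv s -> 0 < width s -> cur_W s <= 6 * B ->
  cur_level s (center_of_gravity (cur_level s)).
Proof.
move=> inv w0 WB; have V0 := cur_level_pos inv w0 WB.
have [M YM] := Y_cube; have mS := cur_level_measurable inv.
have [[p [ps [E va]]] _ _ _ _ _ _] := inv.
apply: (@center_of_gravity_in _ _ _ M) => //.
- exact: subset_trans (@cur_level_sub s) YM.
- by rewrite /cur_level E; exact: compact_level.
- by rewrite /cur_level E; exact: vconvex_level.
Qed.

Definition block_gain : R := block_weight L (mu / 2) K.

Section one_step.
Variable s : ct_state R n m.
Hypotheses (inv : state_inv s) (w0 : 0 < width s) (WB : cur_W s <= 6 * B).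

Let yc := center_of_gravity (cur_level s).
Let blk := block X (Ox^~ yc) mu L (mu / 2) (ct_xb s) K.
Let u := b_u blk.
Let z := b_z blk.
Let v := (Oy u yc).1.
Let g := (Oy u yc).2.
Let A := block_gain.

Lemma stepE : step s =
  if cur_h s < v then
    CTState (Plane v g yc u :: ct_planes s) ((ct_b s + A * v) / (1 + A)) z
      ((1 + A)^-1 *: (ct_yb s + A *: yc)) (cur_W s) (cur_h s) (ct_Tx s + K) (ct_Ty s).+1
  else
    CTState (Plane v g yc u :: ct_planes s) (ct_b s) (ct_xb s) (ct_yb s)
      (cur_W s) (cur_h s) (ct_Tx s + K) (ct_Ty s).+1.
Proof.
have AE : b_A blk = A by rewrite /blk block_A.
have CE : b_calls blk = K by rewrite /blk block_calls.
by rewrite /ct_step -/(cur_h s) -/(cur_W s) -/(level Y (ct_planes s) (cur_h s)) -/(cur_level s) -/yc -/blk AE CE.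
Qed.

Let Yyc : Y yc. Proof. by have [] := cur_center inv w0 WB. Qed.
Let g0 : 0 < mu / 2. Proof. by rewrite divr_gt0. Qed.
Let A0 : 0 <= A. Proof. exact: (block_weight_ge0 mu0 muL g0). Qed.
Let Xu : X u.
Proof. by have [] := @block_inX _ _ X (Ox^~ yc) _ _ _ _ X0 cX vX mu0 muL g0 (inv_xb inv) K. Qed.
Let Xz : X z.
Proof. by have [] := @block_inX _ _ X (Ox^~ yc) _ _ _ _ X0 cX vX mu0 muL g0 (inv_xb inv) K. Qed.
Let vE : v = f u yc. Proof. by have [] := Oyf Xu Yyc. Qed.

Let A1 : 0 < 1 + A. Proof. by rewrite (lt_le_trans ltr01)// lerDl. Qed.

Lemma step_planes : ct_planes (step s) = Plane v g yc u :: ct_planes s.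
Proof. by rewrite stepE; case: ifP. Qed.

Lemma step_W : ct_W (step s) = cur_W s.
Proof. by rewrite stepE; case: ifP. Qed.

Lemma step_h : ct_h (step s) = cur_h s.
Proof. by rewrite stepE; case: ifP. Qed.

Lemma step_Tx : ct_Tx (step s) = (ct_Tx s + K)%N.
Proof. by rewrite stepE; case: ifP. Qed.

Lemma step_Ty : ct_Ty (step s) = (ct_Ty s).+1.
Proof. by rewrite stepE; case: ifP. Qed.

Let new_valid : valid (Plane v g yc u).
Proof.
have [_ sg gM] := Oyf Xu Yyc; split => //= y Yy.
by rewrite /plane_val /= vE; exact: sg.
Qed.

Lemma step_valid : exists p ps, ct_planes (step s) = p :: ps /\
  forall q, List.In q (p :: ps) -> valid q.
Proof.
have [[p [ps [E va]]] _ _ _ _ _ _] := inv.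
exists (Plane v g yc u), (ct_planes s); rewrite step_planes; split => // q [<-//|].
by rewrite E; exact: va.
Qed.

Lemma step_model_le y : model (ct_planes (step s)) y <= model (ct_planes s) y.
Proof.
have [[p [ps [E va]]] _ _ _ _ _ _] := inv; rewrite step_planes E.
by apply/model_geP => q qps; apply: model_le; right.
Qed.

Lemma step_model_new y : model (ct_planes (step s)) y <= v + dotv g (y - yc).
Proof. by rewrite step_planes; apply: (@model_le _ _ _ _ _ _ (Plane v g yc u)); left. Qed.

Lemma step_upper_le : upper (step s) <= upper s.
Proof.
have [[p [ps [E va]]] _ _ _ _ _ _] := inv.
have [ys Yys [UE Umax]] := model_argmax Y0 cY va.
apply: max_over_le => // y Yy; apply: (le_trans (step_model_le y)).
by rewrite E -UE; exact: Umax.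
Qed.

Lemma step_b_ge : ct_b s <= ct_b (step s).
Proof.
rewrite stepE; case: ifP => //= hv; rewrite ler_pdivlMr//.
have [_ _ _ c4 c5] := cur_bounds inv w0.
have : A * (ct_b s) <= A * v by rewrite ler_wpM2l//; have := w0; lra.
lra.
Qed.

Lemma step_up : cur_h s < v ->
  cur_h s - ct_b (step s) <= (cur_h s - ct_b s) / (1 + A).
Proof.
rewrite stepE => hv; rewrite hv /= ler_pdivlMr// mulrBl divfK ?gt_eqF//.
have : A * cur_h s <= A * v by rewrite ler_wpM2l// ltW.
lra.
Qed.

(** The old certificate plus the block bound, divided by 1 + A; concavity in y replaces the average
    of the two values by the value at the new [ct_yb]. *)
Lemma step_certificate x : X x ->
  ct_b (step s) + mu / 4 * dotv (x - ct_xb (step s)) (x - ct_xb (step s)) <= f x (ct_yb (step s)).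
Proof.
move=> Xx; have cert := inv_cert inv Xx.
rewrite stepE; case: ifP => //= hv.
have := block_bound X0 cX vX mu0 muL g0 (inv_xb inv) (scf Yyc) (smf Yyc) K Xx.
rewrite -/blk -/u -/z; have -> : b_A blk = A by rewrite /blk block_A.
rewrite -vE => h.
have t01 : 0 <= (1 + A)^-1 <= 1.
  by rewrite invr_ge0 (ltW A1)/= invf_le1// lerDl.
have := concave_onP (ccf Xx) (inv_yb inv) Yyc t01.
rewrite -weighted_mean ?gt_eqF//.
have -> : (1 + A)^-1 * f x (ct_yb s) + (1 - (1 + A)^-1) * f x yc =
   (f x (ct_yb s) + A * f x yc) / (1 + A).
  by field; rewrite gt_eqF.
apply: le_trans; rewrite ler_pdivlMr//.
set dz := dotv (x - z) (x - z) in h *.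
have dz0 : 0 <= mu * A * dz by rewrite mulr_ge0 ?dotv_ge0// mulr_ge0// ltW.
rewrite mulrDl divfK ?gt_eqF//; lra.
Qed.

Lemma step_yb : Y (ct_yb (step s)).
Proof.
have Yb := inv_yb inv; rewrite stepE; case: ifP => //= hv.
rewrite weighted_mean ?gt_eqF//.
by apply: vY => //; rewrite invr_ge0 (ltW A1)/= invf_le1// lerDl.
Qed.

Lemma step_inv : state_inv (step s).
Proof.
have [c1 c2 _ _ c5] := cur_bounds inv w0.
split.
- exact: step_valid.
- by have := inv_xb inv; rewrite stepE; case: ifP.
- exact: step_yb.
- exact: step_certificate.
- by rewrite step_W; exact: lt_le_trans c5.
- by rewrite step_W step_h; exact: le_trans step_b_ge.
- by rewrite step_W step_h; apply: le_trans step_upper_le _.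
Qed.

(** A reset may lower h and so enlarge the level set. The new h is still at least the old b >= h -
    W/2, and max U >= h + W/6, so at weights 1/6 and 5/6 the model is above the old h. *)
Lemma step_reset : 0 < width (step s) -> width (step s) <= 2 / 3 * cur_W s ->
  [/\ cur_W (step s) <= 2 / 3 * cur_W s,
      cur_h (step s) - ct_b (step s) = cur_W (step s) / 2 &
      rvol (cur_level (step s)) <= 6 ^+ m * rvol (cur_level s)].
Proof.
move=> w0' rs; rewrite /cur_W /cur_h step_W rs; split => //; first by ring.
have [c1 c2 c3 _ c5] := cur_bounds inv w0.
have [M YM] := Y_cube.
have mS := cur_level_measurable inv; have mS' := cur_level_measurable step_inv.
have [[p [ps [E va]]] _ _ _ _ _ _] := inv.
have [ys Yys [UE Umax]] := model_argmax Y0 cY va.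
have th0 : (0 : R) < 6^-1 by rewrite invr_gt0.
have th1 : (6^-1 : R) <= 1 by lra.
have th01 : 0 <= (6^-1 : R) <= 1 by rewrite (ltW th0) th1.
have H y : cur_level (step s) y -> cur_level s (6^-1 *: y + (1 - 6^-1) *: ys).
  move=> [Yy hy]; split; first exact: vY.
  rewrite E; apply: le_trans (model_concave p ps y ys th01).
  have := step_model_le y; rewrite E => h.
  have [d1 d2 d3 d4 d5] := cur_bounds step_inv w0'.
  have b1 := step_b_ge; rewrite UE -E in c3 *.
  rewrite -E in h.
  have h3 : ct_b s <= cur_h (step s) by have := lt_le_trans w0' d5; lra.
  lra.
have := rvol_scale_sub th0 mS mS' (subset_trans (@cur_level_sub s) YM)
   (subset_trans (@cur_level_sub (step s)) YM) H.
by rewrite exprVn mulrC ler_pdivrMr ?exprn_gt0// mulrC.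
Qed.

Lemma step_noreset : 2 / 3 * cur_W s < width (step s) ->
  [/\ cur_W (step s) = cur_W s, cur_h (step s) = cur_h s &
   (cur_h s - ct_b (step s) <= (cur_h s - ct_b s) / (1 + A) /\
     rvol (cur_level (step s)) <= rvol (cur_level s)) \/
   (cur_h s - ct_b (step s) <= cur_h s - ct_b s /\
     rvol (cur_level (step s)) <= 5 / 6 * rvol (cur_level s))].
Proof.
move=> nr; have hE : cur_h (step s) = cur_h s.
  by rewrite /cur_h step_W step_h leNgt nr.
split => //; first by rewrite /cur_W step_W leNgt nr.
have [c1 c2 c3 _ c5] := cur_bounds inv w0.
have [M YM] := Y_cube.
have mS := cur_level_measurable inv; have mS' := cur_level_measurable step_inv.
have SM := subset_trans (@cur_level_sub s) YM.
have sub : cur_level (step s) `<=` cur_level s.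
  by move=> y [Yy]; rewrite hE => h; split => //; apply: le_trans (step_model_le y).
have b1 := step_b_ge.
have [hv|hv] := ltP (cur_h s) v.
  by left; split; [exact: step_up|exact: le_rvol SM sub].
right; split; first by lra.
(* A zero supergradient stores a constant plane of height at most h; the width would drop to W / 2
   and a reset would be due. *)
have [g00|g00] := eqVneq g 0.
  have : upper (step s) <= cur_h s.
    apply: max_over_le => // y Yy; apply: (le_trans (step_model_new y)).
    by rewrite g00 dotv0l addr0.
  by move: nr; rewrite /ct_width; have := lt_le_trans w0 c5; lra.
have [[p [ps [E va]]] _ _ _ _ _ _] := inv.
have cS : vconvex (cur_level s) by rewrite /cur_level E; exact: vconvex_level.
have := rvol_cut mS SM (cur_level_pos inv w0 WB) cS g00; apply: le_trans.
have mC : measurable (cur_level s `&` [set y | 0 <= dotv g (y - center_of_gravity (cur_level s))]).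
  apply: measurableI => //.
  rewrite (_ : mkset _ = (fun y => dotv g y) @^-1` `[dotv g yc, +oo[%classic).
    by rewrite -[X in measurable X]setTI; exact: measurable_dotv.
  by apply/seteqP; split => y; rewrite /= in_itv /= andbT dotvDr dotvNr subr_ge0.
apply: (le_rvol mS' mC (M := M)); first by move=> y [/SM].
move=> y Sy; split; first exact: sub.
(* Since v <= h, the new plane can reach h only where the linear part is nonnegative. *)
have [_ ] := Sy; rewrite hE => h; have := step_model_new y; rewrite /= -/yc; lra.
Qed.

End one_step.
End loop.

(** * Counting iterations *)

Section real_bounds.
Context {R : realType}.

Lemma ln_le_sub1 (x : R) : 0 < x -> ln x <= x - 1.
Proof.
move=> x0; have := @le_ln1Dx R (x - 1); rewrite subrKC => -> //.
by rewrite -[ltLHS]add0r ltrD2r.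
Qed.

Lemma ln2_le : ln (2 : R) <= 5 / 6.
Proof.
have h1 : ln (4 / 3 : R) <= 4 / 3 - 1 by apply: ln_le_sub1; lra.
have h2 : ln (3 / 2 : R) <= 3 / 2 - 1 by apply: ln_le_sub1; lra.
have -> : (2 : R) = 4 / 3 * (3 / 2) by lra.
by rewrite lnM ?posrE; lra.
Qed.

Lemma ln3_le : ln (3 : R) <= 4 / 3.
Proof.
have h2 : ln (3 / 2 : R) <= 3 / 2 - 1 by apply: ln_le_sub1; lra.
have -> : (3 : R) = 2 * (3 / 2) by lra.
by rewrite lnM ?posrE; have := ln2_le; lra.
Qed.

Lemma lnX_natr (x : R) k : 0 < x -> ln (x ^+ k) = k%:R * ln x.
Proof. by move=> x0; rewrite lnXn// mulr_natl. Qed.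

(** Keeps 1 + ln (B / eps) away from zero, so that additive constants can be absorbed into multiples
    of it. *)
Lemma log_factor_ge (B eps : R) : 0 < B -> 0 < eps -> eps < 2 * B -> 1 / 6 <= 1 + ln (B / eps).
Proof.
move=> B0 e0 eB.
have : ln (2^-1 : R) <= ln (B / eps).
  by rewrite ler_ln ?posrE ?divr_gt0 ?invr_gt0// ler_pdivlMr//; lra.
by rewrite lnV ?posrE//; have := ln2_le; lra.
Qed.

(* c, p and r count the iterations that cut the level set, those that raise b,
   and the resets of W; D stands for h - b and V for the volume of Y. *)
Lemma count_bound (m c p r : nat) (B eps w A D V q : R) : (1 <= m)%N ->
  0 < B -> 0 < eps -> eps < 2 * B -> eps < w -> w <= (2 / 3) ^+ r * (2 * B) ->
  0 < V -> (w / (6 * B)) ^+ m * V <= (5 / 6) ^+ c * 6 ^+ (m * r) * V ->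
  w / 6 <= D -> D <= w / 2 * 3 ^+ r / (1 + A) ^+ p -> 0 < q -> q <= A ->
  (c + p + r)%:R <= 150 * (m%:R + q^-1) * (1 + ln (B / eps)).
Proof.
move=> m1 B0 e0 eB ew wr V0 hV hD hD' q0 qA.
have l6 := log_factor_ge B0 e0 eB; set ell := 1 + _ in l6 *.
have lE : ln (B / eps) = ell - 1 by rewrite /ell; ring.
have l2 := @ln2_le; have l2' := @ln2_ge R; have l3 := @ln3_le.
have w0 : 0 < w := lt_trans e0 ew.
have m1' : 1 <= m%:R :> R by rewrite ler1n.
have rB : r%:R <= 3 * ell.
  have h1 : (3 / 2) ^+ r <= 2 * (B / eps).
    rewrite mulrA ler_pdivlMr//.
    (* Resets are counted by comparing eps with (2/3) ^ r * 2 B. *)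
    have : (3 / 2) ^+ r * eps <= (3 / 2) ^+ r * ((2 / 3) ^+ r * (2 * B)).
      by rewrite ler_wpM2l ?exprn_ge0 ?divr_ge0//; exact: le_trans (ltW ew) wr.
    by rewrite mulrA -exprMn (_ : 3 / 2 * (2 / 3) = 1) ?expr1n ?mul1r//; lra.
  have : ln ((3 / 2) ^+ r) <= ln (2 * (B / eps)).
    have p32 : (0 : R) < (3 / 2) ^+ r by apply: exprn_gt0; lra.
    by rewrite ler_ln ?posrE//; exact: lt_le_trans h1.
  rewrite lnX_natr; last by lra.
  rewrite lnM ?posrE ?divr_gt0// lE.
  have l32 : 3^-1 <= ln (3 / 2 : R).
    by have := @ln_ge_1BV R (3 / 2) ltac:(lra); lra.
  have := ler_wpM2l (ler0n R r) l32; lra.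
have pB : p%:R <= 12 * ell * (1 + q^-1).
  have A1 : 0 < 1 + A by lra.
  have Ap : 0 < (1 + A) ^+ p by exact: exprn_gt0.
  have h1 : (1 + A) ^+ p <= 3 ^+ r.+1.
    have := le_trans hD hD'; rewrite ler_pdivlMr//.
    rewrite (_ : w / 6 * _ = w / 6 * (1 + A) ^+ p)// (_ : w / 2 * 3 ^+ r = w / 6 * 3 ^+ r.+1).
      by rewrite ler_pM2l// divr_gt0.
    by rewrite exprS; field.
  have : ln ((1 + A) ^+ p) <= ln (3 ^+ r.+1).
    by rewrite ler_ln ?posrE ?exprn_gt0.
  rewrite !lnX_natr// => h2.
  have h3 : 1 - (1 + q)^-1 <= ln (1 + A).
    apply: le_trans (@ln_ge_1BV _ (1 + A) A1).
    by rewrite lerD2l lerN2 lef_pV2 ?posrE; lra.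
  have h4 := ler_wpM2l (ler0n R p) h3.
  have h5 : r.+1%:R * ln 3 <= r.+1%:R * (4 / 3) :> R by rewrite ler_wpM2l ?ler0n.
  rewrite -natr1 in h5 h2.
  have h6 : p%:R * (1 - (1 + q)^-1) <= 12 * ell by lra.
  have q1 : 0 < 1 + q^-1 by rewrite addr_gt0 ?invr_gt0.
  (* 1 + q^-1 is the inverse of 1 - (1 + q)^-1, which handles small and large q alike. *)
  have := ler_wpM2r (ltW q1) h6.
  rewrite (_ : p%:R * (1 - (1 + q)^-1) * (1 + q^-1) = p%:R)//.
  by field; rewrite !gt_eqF//; lra.
have cB : c%:R <= 132 * m%:R * ell.
  have B6 : 0 < 6 * B by lra.
  (* The two volume bounds with w replaced by eps; after logarithms, c is controlled by m, the
     logarithm of B / eps and the number r of resets bounded above. *)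
  have h1 : (eps / (6 * B)) ^+ m <= (5 / 6) ^+ c * 6 ^+ (m * r).
    have : (w / (6 * B)) ^+ m <= (5 / 6) ^+ c * 6 ^+ (m * r) by rewrite -(ler_pM2r V0).
    apply: le_trans; rewrite lerXn2r ?nnegrE ?divr_ge0 ?(ltW B6) ?(ltW e0) ?(ltW w0)//.
    by rewrite ler_pM2r ?invr_gt0// ltW.
  have p0 : 0 < (5 / 6 : R) by lra.
  have eB6 : 0 < eps / (6 * B) by rewrite divr_gt0.
  have : ln ((eps / (6 * B)) ^+ m) <= ln ((5 / 6) ^+ c * 6 ^+ (m * r)).
    by rewrite ler_ln ?posrE ?mulr_gt0 ?exprn_gt0.
  rewrite lnM ?posrE ?exprn_gt0// !lnX_natr// natrM.
  have e1 : ln (eps / (6 * B)) = - ln 6 - (ell - 1).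
    rewrite -lE (_ : eps / (6 * B) = (6 * (B / eps))^-1).
      have Be : 0 < B / eps by rewrite divr_gt0.
      have Be6 : 0 < 6 * (B / eps) by rewrite mulr_gt0.
      have -> : ln (6 * (B / eps))^-1 = - ln (6 * (B / eps)) by rewrite lnV.
      have -> : ln (6 * (B / eps)) = ln 6 + ln (B / eps) by rewrite lnM ?posrE.
      by ring.
    by field; rewrite !gt_eqF.
  have e2 : ln (5 / 6 : R) <= - 6^-1.
    by have := @ln_le_sub1 (5 / 6) p0; lra.
  have e3 : ln (6 : R) <= 3.
    rewrite (_ : (6 : R) = 2 * 3); last by lra.
    by rewrite lnM ?posrE//; lra.
  have e30 : 0 <= ln (6 : R) by apply: ln_ge0; rewrite ler1n.
  rewrite e1 => h2.
  have h3 := ler_wpM2l (ler0n R c) e2.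
  have h4 : m%:R * (r%:R * ln 6) <= m%:R * (9 * ell) :> R.
    rewrite ler_wpM2l ?ler0n//.
    have := ler_pM (ler0n R r) e30 rB e3; lra.
  have h5 : m%:R * (ln 6 + (ell - 1)) <= m%:R * (13 * ell) :> R.
    by rewrite ler_wpM2l ?ler0n//; lra.
  lra.
have iq : 0 < q^-1 by rewrite invr_gt0.
rewrite !natrD; set Q := q^-1 in pB iq *.
have h1 : ell <= m%:R * ell by rewrite ler_peMl//; lra.
have h2 : 0 <= ell * Q by rewrite mulr_ge0 ?(ltW iq)//; lra.
have E : 150 * (m%:R + Q) * ell = 150 * (m%:R * ell) + 150 * (ell * Q) by ring.
lra.
Qed.

End real_bounds.

Section counting.
Context {R : realType} {n m : nat}.
Variables (X : set 'rV[R]_n) (Y : set 'rV[R]_m) (f : 'rV[R]_n -> 'rV[R]_m -> R).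
Variables (Ox : 'rV[R]_n -> 'rV[R]_m -> 'rV[R]_n).
Variables (Oy : 'rV[R]_n -> 'rV[R]_m -> R * 'rV[R]_m).
Variables (mu L My Ry eps : R) (K : nat).
Hypotheses (X0 : X !=set0) (cX : compact X) (vX : vconvex X).
Hypotheses (Y0 : Y !=set0) (cY : compact Y) (vY : vconvex Y) (dY : diameter_at_most Y Ry).
Hypothesis iY : interior Y !=set0.
Hypotheses (mu0 : 0 < mu) (muL : mu <= L).
Hypothesis scf : forall y, Y y -> strongly_convex_on X mu (f^~ y).
Hypothesis smf : forall y, Y y -> smooth_on X L (f^~ y) (Ox^~ y).
Hypothesis ccf : forall x, X x -> concave_on Y (f x).
Hypothesis Oyf : forall x y, X x -> Y y ->
  [/\ (Oy x y).1 = f x y, supergradient Y (f x) y (Oy x y).2 & enorm (Oy x y).2 <= My].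
Local Notation B := (My * Ry).
Hypotheses (B0 : 0 < B) (eps0 : 0 < eps).

Local Notation step := (ct_step X Y Ox Oy mu L K).
Local Notation width := (ct_width Y).
Local Notation inv := (state_inv X Y f mu My).
Local Notation A := (block_gain mu L K).

Variable s0 : ct_state R n m.
Hypotheses (inv0 : inv s0) (width0 : width s0 = ct_W s0).
Hypotheses (h0 : ct_h s0 = ct_b s0 + ct_W s0 / 2) (W0 : ct_W s0 <= 2 * B).

Local Notation st j := (iter j step s0).

Let A0 : 0 <= A.
Proof. exact: (block_weight_ge0 mu0 muL (divr_gt0 mu0 (ltr0n _ 2))). Qed.

Let cur_W_le6 (w : R) r : w <= (2 / 3) ^+ r * (2 * B) -> w <= 6 * B.
Proof.
move=> hw; apply: (le_trans hw).
have h1 : (2 / 3 : R) ^+ r <= 1 by rewrite exprn_ile1//; lra.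
have B20 : 0 <= 2 * B by rewrite mulr_ge0// ltW.
have := ler_wpM2r B20 h1; have := B0; lra.
Qed.

Lemma loop_counts j : (forall i, (i <= j)%N -> eps < width (st i)) ->
  inv (st j) /\ exists c p r : nat, [/\ (c + p + r)%N = j,
    cur_W Y (st j) <= (2 / 3) ^+ r * (2 * B),
    rvol (cur_level Y (st j)) <= (5 / 6) ^+ c * 6 ^+ (m * r) * rvol Y &
    cur_h Y (st j) - ct_b (st j) <= cur_W Y (st j) / 2 * 3 ^+ r / (1 + A) ^+ p].
Proof.
have mY : measurable Y.
  by apply: closed_measurable_rV; apply: compact_closed => //; exact: norm_hausdorff.
have [M YM] := Y_cube Y0 dY.
have A1 : 0 < 1 + A by rewrite (lt_le_trans ltr01)// lerDl.
elim: j => [|j IH] H.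
  split => //; exists 0%N, 0%N, 0%N; have W0p := inv_W inv0.
  (* W starts as the full width, so the first pass through step (1) makes no reset. *)
  have nr : (width s0 <= 2 / 3 * ct_W s0) = false by rewrite width0; apply/negbTE; rewrite -ltNge; lra.
  split => //=.
  - by rewrite /cur_W nr expr0 mul1r.
  - rewrite muln0 !expr0 !mul1r; apply: le_rvol YM _ => //.
    + by apply: (cur_level_measurable (X := X) (f := f) (mu := mu) (My := My)).
    + exact: cur_level_sub.
  - by rewrite /cur_W /cur_h nr h0 expr0 divr1 mulr1; lra.
have [invj [c [p [r [cpr hW hV hD]]]]] := IH (fun i ij => H i (leqW ij)).
have wj : 0 < width (st j) := lt_trans eps0 (H j (leqnSn _)).
have wj1 : 0 < width (st j.+1) := lt_trans eps0 (H j.+1 (leqnn _)).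
have W6 := cur_W_le6 hW.
have inv1 : inv (st j.+1).
  rewrite iterS.
  by apply: (@step_inv _ _ _ X Y f Ox Oy mu L My Ry K).
split => //; rewrite iterS in wj1 *.
have [rs|nr] := leP (width (step (st j))) (2 / 3 * cur_W Y (st j)).
  have [a1 a2 a3] := @step_reset _ _ _ X Y f Ox Oy mu L My Ry K X0 cX vX Y0 cY vY dY iY
     mu0 muL scf smf ccf Oyf B0 (st j) invj wj W6 wj1 rs.
  exists c, p, r.+1; split.
  - by rewrite addnS cpr.
  - by apply: (le_trans a1); rewrite exprS -[leRHS]mulrA ler_wpM2l//; lra.
  - apply: (le_trans a3); rewrite mulnS exprD.
    have -> : (5 / 6) ^+ c * (6 ^+ m * 6 ^+ (m * r)) * rvol Y =
       6 ^+ m * ((5 / 6) ^+ c * 6 ^+ (m * r) * rvol Y) :> R by ring.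
    by rewrite ler_wpM2l// exprn_ge0.
  (* A reset puts h - b at W / 2. Before it h - b was at least W / 6, so the previous bound forces 3
     ^ (r + 1) >= (1 + A) ^ p, and one more factor 3 restores the bound. *)
  - have [_ _ _ c4 c5] := cur_bounds invj wj.
    have [_ _ _ _ c5'] := cur_bounds inv1 wj1.
    have Ap : 0 < (1 + A) ^+ p by exact: exprn_gt0.
    rewrite a2 -mulrA ler_peMr//; first by rewrite divr_ge0// (le_trans (ltW wj1)).
    rewrite ler_pdivlMr// mul1r.
    have := le_trans c4 hD; rewrite ler_pdivlMr//.
    have Wp : 0 < cur_W Y (st j) := lt_le_trans wj c5.
    rewrite (_ : cur_W Y (st j) / 2 * 3 ^+ r = cur_W Y (st j) / 6 * 3 ^+ r.+1); last first.
      by rewrite exprS; field.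
    by rewrite ler_pM2l// divr_gt0.
have [a1 a2 a3] := @step_noreset _ _ _ X Y f Ox Oy mu L My Ry K X0 cX vX Y0 cY vY dY iY
     mu0 muL scf smf ccf Oyf B0 (st j) invj wj W6 nr.
case: a3 => -[b1 b2].
- exists c, p.+1, r; split.
  + by rewrite addnS addSn cpr.
  + by rewrite a1.
  + exact: le_trans hV.
  + rewrite a1 a2; apply: (le_trans b1).
    by rewrite exprSr invfM mulrA ler_pM2r ?invr_gt0.
- exists c.+1, p, r; split.
  + by rewrite !addSn cpr.
  + by rewrite a1.
  + apply: (le_trans b2); rewrite exprS -!mulrA.
    by rewrite ler_pM2l// ler_pM2l ?invr_gt0// mulrA.
  + by rewrite a1 a2; apply: (le_trans b1).
Qed.

Lemma loop_state N : (forall i, (i < N)%N -> eps < width (st i)) ->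
  [/\ inv (st N), ct_Tx (st N) = (ct_Tx s0 + N * K)%N & ct_Ty (st N) = (ct_Ty s0 + N)%N].
Proof.
elim: N => [|N IH] H; first by split => //=; rewrite ?mul0n addn0.
have [i1 i2 i3] := IH (fun i iN => H i (leqW iN)).
have [_ [c [p [r [_ hW _ _]]]]] := loop_counts H.
have wN : 0 < width (st N) := lt_trans eps0 (H N (leqnn _)).
have W6 := cur_W_le6 hW.
rewrite iterS; split.
- by apply: (@step_inv _ _ _ X Y f Ox Oy mu L My Ry K).
- by rewrite step_Tx// i2 mulSn addnCA addnA addnC addnA [(K + _)%N]addnC.
- by rewrite step_Ty// i3 addnS.
Qed.

Lemma loop_iterations j : (1 <= m)%N -> (1 <= K)%N -> eps < 2 * B ->
  (forall i, (i <= j)%N -> eps < width (st i)) ->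
  j%:R <= 1200 * (m%:R + (L / mu) / K%:R ^+ 2) * (1 + ln (B / eps)).
Proof.
move=> m1 K1 eB H; have [invj [c [p [r [cpr hW hV hD]]]]] := loop_counts H.
have wj : eps < width (st j) := H j (leqnn _).
have wj0 : 0 < width (st j) := lt_trans eps0 wj.
have [_ _ _ c4 c5] := cur_bounds invj wj0.
have W6 := cur_W_le6 hW.
have lo := cur_level_lower Y0 cY vY dY B0 invj wj0 W6.
have K0 : 0 < K%:R :> R by rewrite ltr0n.
have L0 : 0 < L := lt_le_trans mu0 muL.
(* The quadratic part of the block weight, with its linear term in K dropped. *)
pose q := K%:R ^+ 2 / (8 * (L / mu)).
have q0 : 0 < q by rewrite /q divr_gt0 ?exprn_gt0// mulr_gt0// divr_gt0.
have qA : q <= A.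
  rewrite /q /block_gain /block_weight.
  have -> : K%:R ^+ 2 / (8 * (L / mu)) = mu / (8 * L) * K%:R ^+ 2 by field; rewrite !gt_eqF.
  have -> : mu / 2 * (K%:R * (K%:R + 3)) / (4 * L) = mu / (8 * L) * (K%:R ^+ 2 + 3 * K%:R).
    by field; rewrite gt_eqF.
  have cf : 0 < mu / (8 * L) by rewrite divr_gt0// mulr_gt0.
  by rewrite ler_pM2l// lerDl mulr_ge0.
have := @count_bound R m c p r B eps (cur_W Y (st j)) A _ (rvol Y) q m1 B0 eps0 eB
  (lt_le_trans wj c5) hW (rvol_Y_gt0 Y0 cY dY iY) (le_trans lo hV) c4 hD q0 qA.
rewrite cpr => /le_trans; apply.
(* This 8 turns the constant 150 into 1200. *)
have qE : q^-1 = 8 * ((L / mu) / K%:R ^+ 2) by rewrite /q; field; rewrite !gt_eqF.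
rewrite qE ler_wpM2r//; first by have := log_factor_ge B0 eps0 eB; lra.
have : 0 <= m%:R :> R by rewrite ler0n.
lra.
Qed.

Lemma loop_terminates : (1 <= m)%N -> (1 <= K)%N -> eps < 2 * B ->
  exists N : nat, [/\ forall i, (i < N)%N -> eps < width (st i), width (st N) <= eps &
    N%:R <= 1200 * (m%:R + (L / mu) / K%:R ^+ 2) * (1 + ln (B / eps)) + 1].
Proof.
move=> m1 K1 eB; set bound := 1200 * _ * _.
have bound0 : 0 <= bound.
  have l0 : 0 <= 1 + ln (B / eps) by have := log_factor_ge B0 eps0 eB; lra.
  have k0 : 0 <= L / mu by rewrite divr_ge0 ?(ltW mu0)// (le_trans (ltW mu0)).
  exact: mulr_ge0 (mulr_ge0 (ler0n _ _) (addr_ge0 (ler0n _ _)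
    (divr_ge0 k0 (exprn_ge0 _ (ler0n _ _))))) l0.
have ex : exists j, width (st j) <= eps.
  apply/not_existsP => H.
  have big j : (forall i, (i <= j)%N -> eps < width (st i)).
    by move=> i _; rewrite ltNge; apply/negP; exact: H.
  have := loop_iterations m1 K1 eB (big (ceil_nat bound).+1).
  rewrite -/bound -natr1 => h; have := ceil_nat_ge bound0; lra.
case: (ex_minnP ex) => N wN minN; exists N; split => //.
  by move=> i iN; rewrite ltNge; apply/negP => /minN; rewrite leqNgt iN.
(* The count bounds the last index at which the width still exceeds eps, which is N - 1; hence the
   additive 1. *)
case: N wN minN => [|N] wN minN.
  exact: addr_ge0.
rewrite -natr1 lerD2r; apply: loop_iterations => // i iN.
by rewrite ltNge; apply/negP => /minN; rewrite ltnNge iN.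
Qed.

End counting.

(** * Initial state and total cost *)

Section initialization.
Context {R : realType} {n m : nat}.
Variables (X : set 'rV[R]_n) (Y : set 'rV[R]_m) (f : 'rV[R]_n -> 'rV[R]_m -> R).
Variables (Ox : 'rV[R]_n -> 'rV[R]_m -> 'rV[R]_n).
Variables (Oy : 'rV[R]_n -> 'rV[R]_m -> R * 'rV[R]_m).
Variables (mu L Rx My Ry : R) (y0 : 'rV[R]_m) (v : 'rV[R]_n).
Hypotheses (X0 : X !=set0) (cX : compact X) (vX : vconvex X) (dX : diameter_at_most X Rx).
Hypotheses (Yy0 : Y y0) (Xv : X v) (dY : diameter_at_most Y Ry).
Hypotheses (mu0 : 0 < mu) (muL : mu <= L).
Hypothesis scf : strongly_convex_on X mu (f^~ y0).
Hypothesis smf : smooth_on X L (f^~ y0) (Ox^~ y0).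
Hypothesis Oyf : forall x, X x ->
  [/\ (Oy x y0).1 = f x y0, supergradient Y (f x) y0 (Oy x y0).2 & enorm (Oy x y0).2 <= My].
Local Notation B := (My * Ry).
Hypothesis B0 : 0 < B.

Local Notation s0 := (ct_init X Y Ox Oy mu L Rx B y0 v).

Lemma init_Tx : ct_Tx s0 =
  ((ceil_nat (log2_plus (mu * Rx ^+ 2 / (4 * (B / 3))))).+2 * ceil_nat (Num.sqrt (8 * (L / mu))))%N.
Proof. by rewrite /ct_init addn1; exact: init_runs_count. Qed.

Lemma init_cost : (ct_Tx s0)%:R <= 12 * (Num.sqrt (L / mu) * (1 + log_plus (mu * Rx ^+ 2 / B))).
Proof.
rewrite init_Tx natrM; set t := mu * Rx ^+ 2 / (4 * _); set s := mu * Rx ^+ 2 / B.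
have k1 : 1 <= L / mu by rewrite ler_pdivlMr ?mul1r.
set S := Num.sqrt (L / mu).
have S1 : 1 <= S by rewrite -[leLHS]sqrtr1 ler_wsqrtr.
have hk : (ceil_nat (Num.sqrt (8 * (L / mu))))%:R <= 4 * S.
  have : Num.sqrt (8 * (L / mu)) <= 3 * S.
    rewrite -(@ler_pXn2r _ 2)// ?nnegrE ?sqrtr_ge0 ?mulr_ge0 ?sqrtr_ge0//.
    rewrite exprMn !sqr_sqrtr; lra.
  have := ceil_nat_lt (sqrtr_ge0 (8 * (L / mu))); lra.
have p0 : 0 <= log_plus s by rewrite /log_plus le_max lexx.
have hN : (ceil_nat (log2_plus t))%:R <= 2 * log_plus s + 1.
  have lt0 : 0 <= log2_plus t by rewrite /log2_plus le_max lexx.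
  suff : log2_plus t <= 2 * log_plus s by have := ceil_nat_lt lt0; lra.
  rewrite /log2_plus ge_max mulr_ge0//=.
  have l2 := @ln2_ge R; rewrite ler_pdivrMr; last by lra.
  have lnt : ln t <= log_plus s.
    have aux (a b : R) : b != 0 -> a / (4 * (b / 3)) = 3 / 4 * (a / b) by move=> b0; field.
    have ts : t = 3 / 4 * s by apply: aux; rewrite gt_eqF.
    have s_ge0 : 0 <= s by exact: divr_ge0 (mulr_ge0 (ltW mu0) (sqr_ge0 _)) (ltW B0).
    (* s = 0 occurs when Rx = 0; then t = 0 and ln 0 = 0 by convention. *)
    have [s_0|s_gt0] := leP s 0.
      have sE : s = 0 by apply/eqP; rewrite eq_le s_0.
      have -> : t = 0 by rewrite ts sE mulr0.
      by rewrite ln0.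
    rewrite /log_plus le_max; apply/orP; right.
    by rewrite ts ler_ln ?posrE//; lra.
  have := ler_wpM2l p0 l2; lra.
have h := ler_pM (ler0n R _) (ler0n R _) (_ : (ceil_nat (log2_plus t)).+2%:R <= 3 * (1 + log_plus s)) hk.
apply: le_trans (h _) _; last by lra.
by rewrite -addn2 natrD; lra.
Qed.

(** b lies B below the value of the plane at y0, and the plane varies by at most B over Y, so the
    initial width is between B and 2 B. *)
Lemma init_spec : [/\ state_inv X Y f mu My s0, ct_width Y s0 = ct_W s0,
  ct_h s0 = ct_b s0 + ct_W s0 / 2, ct_W s0 <= 2 * B & ct_Ty s0 = 1%N].
Proof.
have [xs Xxs Hxs] := smooth_argmin X0 cX vX dX mu0 muL scf smf.
have E0 : 0 <= B / 3 by rewrite divr_ge0 ?(ltW B0).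
set t := mu * Rx ^+ 2 / (4 * (B / 3)).
set N := ceil_nat (log2_plus t).
have small : f (b_u (iter N.+1 (init_run X (Ox^~ y0) mu L) (block_init (mu / 2) v, 0%N)).1) y0
   - f xs y0 <= B / 3.
  apply: (le_trans (init_runs_halving X0 cX vX dX mu0 muL scf smf Xxs Hxs Xv N)).
  rewrite ler_pdivrMr ?exprn_gt0//.
  have -> : mu / 4 * Rx ^+ 2 = B / 3 * t.
    have aux (a b c : R) : b != 0 -> a / 4 * c = b / 3 * (a * c / (4 * (b / 3))) by move=> b0; field.
    by apply: aux; rewrite gt_eqF.
  by rewrite ler_wpM2l//; exact: pow2_ceil_log2.
have [Xz cert] := init_runs_certificate X0 cX vX mu0 muL scf smf Xxs Hxs Xv E0 small.
have Xu : X (b_u (iter N.+2 (init_run X (Ox^~ y0) mu L) (block_init (mu / 2) v, 0%N)).1).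
  exact: init_runs_inX.
have -> : s0 = let p := iter N.+2 (init_run X (Ox^~ y0) mu L) (block_init (mu / 2) v, 0%N) in
  let pl := Plane (Oy (b_u p.1) y0).1 (Oy (b_u p.1) y0).2 y0 (b_u p.1) in
  let b := (Oy (b_u p.1) y0).1 - B in
  let W := max_over Y (model [:: pl]) - b in
  CTState [:: pl] b (b_z p.1) y0 W (b + W / 2) p.2 1.
  by rewrite /ct_init addn1.
move: Xz cert Xu; set p := iter N.+2 _ _ => Xz cert Xu /=.
have [v0E sg gM] := Oyf Xu.
set pl := Plane _ _ _ _; set W := max_over _ _ - _.
have va : valid_plane X Y f My pl.
  by split => //= y Yy; rewrite /plane_val /= v0E; exact: sg.
have My0 : 0 <= My := le_trans (enorm_ge0 _) gM.
have mE y : model [:: pl] y = plane_val pl y by rewrite /model big_nil.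
have plE : plane_val pl y0 = (Oy (b_u p.1) y0).1 by rewrite /plane_val /= subrr dotv0r addr0.
have up y : Y y -> model [:: pl] y <= (Oy (b_u p.1) y0).1 + B.
  move=> Yy; rewrite mE -lerBlDl -plE; apply: (le_trans (plane_lipschitz _ _ va)).
  by apply: ler_wpM2l => //; exact: dY.
have W_le : W <= 2 * B.
  have := @max_over_le _ _ Y (model [:: pl]) _ (ex_intro _ y0 Yy0) up; rewrite /W; lra.
have W_ge : B <= W.
  have := max_over_ge up Yy0; rewrite mE plE /W; lra.
split => //; split => //=.
- by exists pl, [::]; split => // q [<-|[]].
- by move=> x Xx; apply: le_trans (cert x Xx); rewrite v0E; lra.
- exact: lt_le_trans W_ge.
- by lra.
- by rewrite /W; lra.
Qed.

End initialization.

(** The additive 1 is absorbed because m * ell >= 1/6, which turns 1200 into 1206; the first call to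
    the second oracle is absorbed the same way. *)
Lemma total_cost {R : realType} (m K N : nat) (kappa ell : R) :
  (1 <= m)%N -> (1 <= K)%N -> 0 <= kappa -> 1 / 6 <= ell ->
  N%:R <= 1200 * (m%:R + kappa / K%:R ^+ 2) * ell + 1 ->
  [/\ 1 + N%:R <= 5000 * ((m%:R + kappa / K%:R ^+ 2) * ell),
      N%:R * K%:R <= 5000 * ((m%:R * K%:R + kappa / K%:R) * ell) &
      K = ceil_nat (Num.sqrt (8 * kappa / m%:R)) ->
        N%:R * K%:R + (1 + N%:R) <= 5000 * ((m%:R + Num.sqrt (m%:R * kappa)) * ell) /\
        1 + N%:R <= 5000 * (m%:R * ell)].
Proof.
move=> m1 K1 k0 l6 hN.
have m1' : 1 <= m%:R :> R by rewrite ler1n.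
have K1' : 1 <= K%:R :> R by rewrite ler1n.
have K0 : 0 < K%:R :> R by rewrite ltr0n.
have m0 : 0 < m%:R :> R by rewrite ltr0n.
set q := kappa / K%:R ^+ 2 in hN *.
have q0 : 0 <= q by rewrite divr_ge0// exprn_ge0.
have ql0 : 0 <= q * ell by rewrite mulr_ge0//; lra.
have lm : ell <= m%:R * ell by rewrite ler_peMl//; lra.
have hN1 : N%:R <= 1206 * (m%:R * ell + q * ell) by lra.
have qK : q * K%:R = kappa / K%:R by rewrite /q; field; rewrite gt_eqF.
have hNK := ler_wpM2r (ltW K0) hN1.
have hNK' : N%:R * K%:R <= 1206 * ((m%:R * K%:R + kappa / K%:R) * ell).
  by rewrite -qK; lra.
have NK0 : 0 <= (m%:R * K%:R + kappa / K%:R) * ell.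
  by rewrite mulr_ge0 ?addr_ge0 ?mulr_ge0 ?divr_ge0//; lra.
split; [lra|lra|move=> KE].
set s := Num.sqrt (8 * kappa / m%:R) in KE.
have sq : s ^+ 2 = 8 * kappa / m%:R by rewrite sqr_sqrtr// divr_ge0// mulr_ge0.
have s0 : 0 <= s := sqrtr_ge0 _.
have sK : s <= K%:R by rewrite KE; exact: ceil_nat_ge.
have Ks : K%:R <= s + 1 by rewrite KE ltW// ceil_nat_lt.
(* Rounding up gives kappa / K ^ 2 <= m / 8, hence a number of iterations of order m * ell; K <= s +
   1 then keeps m * K of order sqrt (m * kappa) + m. *)
have qm : q <= m%:R / 8.
  rewrite /q ler_pdivrMr ?exprn_gt0//.
  have : s ^+ 2 <= K%:R ^+ 2 by rewrite lerXn2r ?nnegrE// (le_trans s0).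
  rewrite sq ler_pdivrMr//; lra.
set S := Num.sqrt (m%:R * kappa).
have S0 : 0 <= S := sqrtr_ge0 _.
have msS : m%:R * s <= 3 * S.
  rewrite -(@ler_pXn2r _ 2)// ?nnegrE ?mulr_ge0//.
  rewrite !exprMn sq sqr_sqrtr ?mulr_ge0//.
  have -> : m%:R ^+ 2 * (8 * kappa / m%:R) = 8 * (m%:R * kappa) by field; rewrite gt_eqF.
  by have : 0 <= m%:R * kappa by [rewrite mulr_ge0]; lra.
have mK : m%:R * K%:R <= 3 * S + m%:R.
  by have := ler_wpM2l (ltW m0) Ks; lra.
have kK : kappa / K%:R <= m%:R * K%:R / 8.
  by rewrite -qK; have := ler_wpM2r (ltW K0) qm; lra.
have l0 : 0 <= ell by lra.
have h1 : q * ell <= m%:R / 8 * ell by rewrite ler_wpM2r.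
have h2 : (m%:R * K%:R + kappa / K%:R) * ell <= 9 / 8 * (3 * S + m%:R) * ell.
  by rewrite ler_wpM2r//; lra.
have h3 : 0 <= S * ell by rewrite mulr_ge0.
have h4 : 0 <= m%:R * ell by rewrite mulr_ge0// ltW.
split; lra.
Qed.

Theorem theorem1 (R : realType) :
  exists C : R,
  forall (n m : nat) (X : set 'rV[R]_n) (Y : set 'rV[R]_m)
    (f : 'rV[R]_n -> 'rV[R]_m -> R)
    (Ox : 'rV[R]_n -> 'rV[R]_m -> 'rV[R]_n)
    (Oy : 'rV[R]_n -> 'rV[R]_m -> R * 'rV[R]_m)
    (mu L Rx Ry My eps : R) (y0 : 'rV[R]_m) (v : 'rV[R]_n) (K : nat),
  X !=set0 -> closed X -> convex_set X -> diameter_at_most X Rx ->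
  (1 <= m)%N ->
  compact Y -> convex_set Y -> interior Y !=set0 -> diameter_at_most Y Ry ->
  0 < mu -> mu <= L ->
  (forall y, Y y -> strongly_convex_on X mu (f^~ y)) ->
  (forall y, Y y -> smooth_on X L (f^~ y) (Ox^~ y)) ->
  (forall x, X x -> concave_on Y (f x)) ->
  (forall x y, X x -> Y y ->
    [/\ (Oy x y).1 = f x y,
        supergradient Y (f x) y (Oy x y).2
      & enorm (Oy x y).2 <= My]) ->
  let B := My * Ry in
  let kappa := L / mu in
  let s0 := ct_init X Y Ox Oy mu L Rx B y0 v in
  let state j := iter j (ct_step X Y Ox Oy mu L K) s0 in
  let I0 := (ct_Tx s0)%:R : R in
  let logB := 1 + ln (B / eps) in
  0 < B -> Y y0 -> X v -> 0 < eps -> eps < 2 * B -> (1 <= K)%N ->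
  I0 <= C * (Num.sqrt kappa * (1 + log_plus (mu * Rx ^+ 2 / B))) /\
  exists N : nat,
    let s := state N in
    let Tx := (ct_Tx s)%:R : R in
    let Ty := (ct_Ty s)%:R : R in
    [/\ (forall j, (j < N)%N -> eps < ct_width Y (state j)) /\
          ct_width Y s <= eps,
        (exists lam, optimal_weights Y (ps := ct_planes s) lam) /\
        (forall lam, optimal_weights Y (ps := ct_planes s) lam ->
          [/\ X (mixed_point lam), Y (ct_yb s)
            & Gap X Y f (mixed_point lam) (ct_yb s) <= eps]),
        Ty <= C * ((m%:R + kappa / K%:R ^+ 2) * logB),
        Tx <= I0 + C * ((m%:R * K%:R + kappa / K%:R) * logB)
      & K = ceil_nat (Num.sqrt (8 * kappa / m%:R)) ->
          Tx + Ty <= I0 + C * ((m%:R + Num.sqrt (m%:R * kappa)) * logB) /\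
          Ty <= C * (m%:R * logB)].
Proof.
exists 5000 => n m X Y f Ox Oy mu L Rx Ry My eps y0 v K X0 clX coX dX m1 cY coY iY dY
  mu0 muL scf smf ccf Oyf B kappa s0 state I0 logB B0 Yy0 Xv e0 eB K1.
have cX := diameter_compact clX dX.
have vX := convex_set_vconvex coX; have vY := convex_set_vconvex coY.
have Y0 : Y !=set0 by exists y0.
have [inv0 w0 h0 W0 Ty0] := init_spec X0 cX vX dX Yy0 Xv dY mu0 muL (scf _ Yy0) (smf _ Yy0)
  (fun x Xx => Oyf x y0 Xx Yy0) B0.
have k1 : 1 <= kappa by rewrite /kappa ler_pdivlMr ?mul1r.
have l6 := log_factor_ge B0 e0 eB.
split.
  apply: (le_trans (init_cost X Y Ox Oy Rx y0 v mu0 muL B0)).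
  apply: ler_wpM2r; last by rewrite ler_nat.
  by rewrite mulr_ge0 ?sqrtr_ge0// addr_ge0// /log_plus le_max lexx.
have [N [big small hN]] := loop_terminates X0 cX vX Y0 cY vY dY iY mu0 muL scf smf ccf Oyf
  B0 e0 inv0 w0 h0 W0 m1 K1 eB.
have [invN TxE TyE] := loop_state X0 cX vX Y0 cY vY dY iY mu0 muL scf smf ccf Oyf
  B0 e0 inv0 w0 h0 W0 big.
exists N => s Tx Ty.
have TxN : Tx = I0 + N%:R * K%:R by rewrite /Tx TxE natrD natrM.
have TyN : Ty = 1 + N%:R by rewrite /Ty TyE Ty0 natrD.
have [t1 t2 t3] := total_cost m1 K1 (le_trans ler01 k1) l6 hN.
have [[p [ps [E va]]] _ Yb cert _ _ _] := invN.
split.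
- by [].
- have wN : max_over Y (model (p :: ps)) - ct_b s <= eps by rewrite -E.
  rewrite [ct_planes s]E.
  have [lam [olam _]] := optimal_weights_exist Y0 cY vY dY va.
  split; first by exists lam.
  move=> lam' /(optimal_gap X0 vX Y0 cY vY dY mu0 scf smf va) og.
  have [|Xm gap] := og (ct_b s) (ct_yb s).
    move=> x Xx; apply: le_trans (cert x Xx); rewrite lerDl.
    by rewrite mulr_ge0 ?dotv_ge0// divr_ge0 ?(ltW mu0).
  by split => //; exact: le_trans wN.
- by rewrite TyN.
- by rewrite TxN lerD2l.
- by move=> KE; have [h1 h2] := t3 KE; rewrite TyN; split => //; rewrite TxN -addrA lerD2l.
Qed.
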